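(* Let $K\subset\mathbb{R}^n$ and $L\subset\mathbb{R}^m$ be non-trivial closed convex cones, and let $G\in\mathbb{R}^{m\times n}$ be a standard Gaussian matrix. There exists a universal constant $C>0$ such that for every $t\ge 1$: (1) if $\sqrt{\delta(K)}-\sqrt{m-\delta(L)}\le -C\sqrt{t}$, then $\mathbb{P}\big(L\cap GK=\{0\}\big)\ge 1-e^{-t}$; (2) if $\sqrt{\delta(K)}-\sqrt{m-\delta(L)}\ge C\sqrt{t}$, then $\mathbb{P}\big(L\cap GK\neq\{0\}\big)\ge 1-e^{-t}$.
   Context: A standard Gaussian matrix $G\in\mathbb{R}^{m\times n}$ has i.i.d. $\mathcal{N}(0,1)$ entries. For a set $K$, $GK\equiv\{G\mu:\mu\in K\}$. A closed convex cone is non-trivial if it is not $\{0\}$. For a closed convex cone $K\subset\mathbb{R}^n$, the statistical dimension is $\delta(K)\equiv\mathbb{E}\|\Pi_K(g)\|^2$ with $g\sim\mathcal{N}(0,I_n)$, where $\Pi_K(y)=\arg\min_{\mu\in K}\|y-\mu\|$ is the Euclidean metric projection onto $K$ and $\|\cdot\|$ is the Euclidean norm. *)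

(* Defs.v *)
From HB Require Import structures.
From mathcomp Require Import all_boot all_order all_algebra.
From mathcomp Require Import all_classical all_reals all_analysis.
Set Implicit Arguments. Unset Strict Implicit. Unset Printing Implicit Defensive.
Import Order.TTheory GRing.Theory Num.Theory.
Import numFieldNormedType.Exports.
Local Open Scope classical_set_scope.
Local Open Scope ring_scope.

Section Defs.
Variable R : realType.

Definition sqnorm n (v : 'cV[R]_n) : R := \sum_(i < n) (v i 0) ^+ 2.

Definition closed_convex_cone n (K : set 'cV[R]_n) : Prop :=
  [/\ closed K, K 0,
      (forall x (l : R), K x -> 0 <= l -> K (l *: x)) &
      (forall x y (l : R), K x -> K y -> 0 <= l <= 1 -> K (l *: x + (1 - l) *: y))].

Definition nontrivial n (K : set 'cV[R]_n) : Prop := K <> [set 0].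

Definition proj n (K : set 'cV[R]_n) (y : 'cV[R]_n) : 'cV[R]_n :=
  xget 0 [set mu | K mu /\ forall nu, K nu -> sqnorm (y - mu) <= sqnorm (y - nu)].

(* Expectation of a nonnegative function of a standard Gaussian vector
   g ~ N(0, I_k) in R^k (as a row vector), as an iterated integral against
   the one-dimensional standard normal distribution in each coordinate. *)
Fixpoint gexp (k : nat) : ('rV[R]_k -> \bar R) -> \bar R :=
  match k with
  | 0 => fun f => f 0
  | k'.+1 => fun f : 'rV[R]_k'.+1 -> \bar R =>
      (\int[normal_prob (0:R) 1]_x
         gexp (fun v : 'rV[R]_k' =>
           f (\row_(i < k'.+1) if unlift ord0 i is Some j then v ord0 j else (x : R))))%E
  end.

Definition stat_dim n (K : set 'cV[R]_n) : \bar R :=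
  gexp (fun g : 'rV[R]_n => (sqnorm (proj K g^T))%:E).

Definition gauss_mx_prob m n (P : 'M[R]_(m, n) -> Prop) : \bar R :=
  gexp (fun v : 'rV[R]_(m * n) => (\1_[set v | P (vec_mx v)] v)%:E).

Definition trivial_intersection m n (L : set 'cV[R]_m) (G : 'M[R]_(m, n))
    (K : set 'cV[R]_n) : Prop :=
  L `&` [set G *m mu | mu in K] = [set 0].

End Defs.

(* Main.v *)
(* For sets A, B of unit vectors, put F(G) = min_(a in A) max_(b in B) <b, G a>.
   Gordon's comparison bounds E exp(-lam F(G)) by
   exp(2 lam^2 + lam (E max_A <g, a> - E max_B <h, b>)), so lam = sqrt t shows that F(G) > 0
   with probability at least 1 - e^(-t) as soon as sqrt(E d(h)^2) - sqrt(E p(g)^2) is a large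
   multiple of sqrt t, where p dominates <g, .> on A and d is attained by <h, .> on B.
   The comparison is obtained by interpolating between the two Gaussian processes, for a
   smooth soft-min-max on finite nets of A and B whose temperature tends to zero; the
   interpolation also gives the bounded variance of the maxima.
   Part (1) takes A in K and B in the polar of L: F(G) > 0 forbids nonzero points of L in GK.
   Part (2) takes B in K and A in the polar of L' = {x in L : <a, x> >= 0}, with a unit vector
   a of L, and -G^T for G: if L meets GK only in 0, then L' and GK - a are disjoint, and
   separating L' from truncations of GK - a makes F(-G^T) <= eta for every eta > 0.
   Replacing L by L' raises the mean square of the residual by at most 1. *)
Require Import Defs.
From HB Require Import structures.
From mathcomp Require Import all_boot all_order all_algebra.
From mathcomp Require Import all_classical all_reals all_analysis.
From mathcomp Require Import measurable_realfun ring lra.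
Set Implicit Arguments.
Unset Strict Implicit.
Unset Printing Implicit Defensive.
Import Order.TTheory GRing.Theory Num.Theory.
Import numFieldNormedType.Exports.
Local Open Scope classical_set_scope.
Local Open Scope ring_scope.

(** * Gaussian smoothing of exponentially Lipschitz functions *)

Section StandardNormal.
Variable R : realType.
Implicit Types (f g : R -> R).
Local Notation gamma := (normal_prob (0:R) 1).
Local Notation mu := (@lebesgue_measure R).

(** The probability is an iterated integral of an indicator whose measurability is never
    established. It is only bounded below, by the integral of a continuous function lying under the
    indicator. All other expectations are averages of functions in a class, [explip], that is stable
    under sums, products, composition with Lipschitz maps and Gaussian averaging, so integrability
    and Fubini are settled once. The interpolation is discrete: Gaussian averaging is split into
    many small independent blocks of variance s, and exchanging one block costs a second-order
    Taylor term plus an error of order s^(3/2). This replaces differentiation along a path and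
    Gaussian integration by parts. Concentration is the same comparison, applied to psi(x) - psi(x')
    with an independent pair against the pair (x, x). The cones supply mean squares, while the
    comparison sees the mean of a maximum. A variance bound free of the dimension converts one into
    the other, at the price of [core_loss]. *)

Lemma ge0_integral_normal_prob (m s : R) (f : R -> \bar R) :
  measurable_fun setT f -> (forall x, 0 <= f x)%E ->
  (\int[normal_prob m s]_x f x = \int[mu]_x (f x * (normal_pdf m s x)%:E))%E.
Proof.
move=> mf f0.
rewrite -(Radon_Nikodym_SigmaFinite.change_of_variables (normal_prob_dominates m s))//=.
have idom := Radon_Nikodym_SigmaFinite.f_integrable (normal_prob_dominates m s).
apply: ae_eq_integral => //.
- by apply: emeasurable_funM => //; exact: measurable_int idom.
- apply: emeasurable_funM => //=; apply/measurableT_comp => //=.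
  exact: measurable_normal_pdf.
- apply: ae_eqe_mul2l => /=.
  apply: integral_ae_eq => //=.
  + by apply/measurableT_comp =>//; exact: measurable_normal_pdf.
  + move=> E E01 mE; rewrite -(Radon_Nikodym_SigmaFinite.f_integral (normal_prob_dominates m s))//=.
Qed.

Lemma integral_expR_gamma (c : R) :
  (\int[gamma]_x (expR (c * x))%:E = (expR (c ^+ 2 / 2))%:E)%E.
Proof.
have mE : measurable_fun setT (fun x : R => expR (c * x)).
  apply: measurableT_comp => //; exact: measurable_funM.
rewrite ge0_integral_normal_prob//; last exact/measurable_EFinP.
under eq_integral.
  move=> x _.
  (* Completing the square turns the tilted density into that of N(c, 1). *)
  have -> : ((expR (c * x))%:E * (normal_pdf 0 1 x)%:E =
      (expR (c ^+ 2 / 2))%:E * (normal_pdf c 1 x)%:E)%E.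
    rewrite -!EFinM !normal_pdfE ?oner_eq0// /normal_fun; congr EFin.
    rewrite !(mulrC _ (normal_peak 1 * _)) -!mulrA; congr (_ * _).
    rewrite -!expRD; congr expR.
    rewrite !expr1n; by field.
  over.
rewrite ge0_integralZl ?integral_normal_pdf ?mule1//.
- by apply/measurable_EFinP; exact: measurable_normal_pdf.
- by move=> x _; rewrite lee_fin normal_pdf_ge0.
Qed.

Lemma integral_expR_abs_gamma (c : R) :
  (\int[gamma]_x (expR (c * `|x|))%:E < +oo)%E.
Proof.
have mE a : measurable_fun setT (fun x : R => (expR (a * x))%:E).
  apply/measurable_EFinP; apply: measurableT_comp => //; exact: measurable_funM.
apply: (@le_lt_trans _ _
   (\int[gamma]_x ((expR (c * x))%:E + (expR (- c * x))%:E))%E).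
  apply: ge0_le_integral => //.
  - apply/measurable_EFinP; apply: measurableT_comp => //.
    by apply: measurable_funM => //; exact: measurableT_comp.
  - by apply: emeasurable_funD; exact: mE.
  move=> x _; rewrite -EFinD lee_fin.
  have [x0|x0] := ger0P x; first by rewrite lerDl expR_ge0.
  by rewrite mulrN mulNr lerDr expR_ge0.
rewrite ge0_integralD ?integral_expR_gamma -?EFinD ?ltry//; exact: mE.
Qed.

Definition exp_growth f := exists C c : R, forall x, `|f x| <= C * expR (c * `|x|).

Lemma integrable_gamma f : measurable_fun setT f -> exp_growth f ->
  gamma.-integrable setT (EFin \o f).
Proof.
move=> mf [C [c fC]]; apply/integrableP; split; first exact/measurable_EFinP.
have mE : measurable_fun setT (fun x : R => expR (c * `|x|)).
    apply: measurableT_comp => //.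
    by apply: measurable_funM => //; exact: measurableT_comp.
have C0 : 0 <= C.
  by have := le_trans (normr_ge0 _) (fC 0); rewrite normr0 mulr0 expR0 mulr1.
apply: (@le_lt_trans _ _ (\int[gamma]_x (C%:E * (expR (c * `|x|))%:E))%E).
  apply: ge0_le_integral => //=.
  - by apply/measurable_EFinP; exact: measurableT_comp.
  - by apply: emeasurable_funM => //; exact/measurable_EFinP.
  - by move=> x _; rewrite lee_fin fC.
rewrite ge0_integralZl//; last exact/measurable_EFinP.
by rewrite lte_mul_pinfty// integral_expR_abs_gamma.
Qed.

(** For w = c x + s y with x, y independent, the joint density of (x, w) factors into the marginal
    of w and the conditional law N(c w, s^2) of x given w. *)
Lemma normal_pdf_rotation (c s : R) : c ^+ 2 + s ^+ 2 = 1 -> 0 < s ->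
  forall x w, normal_pdf 0 1 x * (normal_pdf 0 1 ((w - c * x) / s) / s) =
    normal_pdf 0 1 w * normal_pdf (c * w) s x.
Proof.
move=> cs s0 x w.
have sN0 : s != 0 by rewrite gt_eqF.
rewrite !normal_pdfE ?oner_eq0// /normal_fun.
have -> : normal_peak s = normal_peak 1 / s.
  rewrite /normal_peak -mulrnAr sqrtrM ?sqr_ge0// sqrtr_sqr gtr0_norm//.
  by rewrite -[in RHS]mulrnAr expr1n mul1r invfM mulrC.
have e : - (x - 0) ^+ 2 / (1 ^+ 2 *+ 2) + - ((w - c * x) / s - 0) ^+ 2 / (1 ^+ 2 *+ 2)
    = - (w - 0) ^+ 2 / (1 ^+ 2 *+ 2) + - (x - c * w) ^+ 2 / (s ^+ 2 *+ 2).
  have cs' : c ^+ 2 = 1 - s ^+ 2 by rewrite -cs addrK.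
  have : (x ^+ 2 - w ^+ 2) * (1 - s ^+ 2 - c ^+ 2) / (s ^+ 2 *+ 2) = 0.
    by rewrite cs' subrr mulr0 mul0r.
  move=> e0; apply/eqP; rewrite -subr_eq0; apply/eqP; rewrite -[RHS]e0.
  by field; rewrite sN0.
move: (congr1 (@expR R) e); rewrite !expRD.
move: (expR _) (expR _) (expR _) (expR _) (normal_peak 1) => E1 E2 E3 E4 P e'.
by transitivity (P * (P / s) * (E4 * E3)); [ring|rewrite e'; ring].
Qed.

(** Substitute w = c x + s y in the inner integral, exchange the integrals by Tonelli, and integrate
    out the conditional density of x given w. *)
Lemma gamma_rotation_ge0 (c s : R) (f : R -> R) : c ^+ 2 + s ^+ 2 = 1 -> 0 < s ->
  continuous f -> (forall x, 0 <= f x) ->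
  (\int[gamma]_x \int[gamma]_y (f (c * x + s * y))%:E =
   \int[gamma]_x (f x)%:E)%E.
Proof.
move=> cs s0 cf f0.
have sN0 : s != 0 by rewrite gt_eqF.
have mf : measurable_fun setT f by exact: continuous_measurable_fun.
have mp := @measurable_normal_pdf R.
have inner x : (\int[gamma]_y (f (c * x + s * y))%:E =
    \int[mu]_w (f w * (normal_pdf 0 1 ((w - c * x) / s) / s))%:E)%E.
  have cl : continuous (fun y => f (c * x + s * y)).
    move=> y; apply: (@continuous_comp _ _ _ (fun y => c * x + s * y) f); last exact: cf.
    by apply: cvgD; [exact: cvg_cst|apply: cvgM; [exact: cvg_cst|exact: cvg_id]].
  rewrite ge0_integral_normal_prob; last 2 first.
  - by apply/measurable_EFinP; exact: continuous_measurable_fun.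
  - by move=> y; rewrite lee_fin.
  under eq_integral do rewrite -EFinM.
  have dF : (fun w : R => (w - c * x) / s)^`()%classic = cst s^-1.
    apply/funext => w; rewrite derive1E deriveM// deriveB// derive_cst scaler0.
    by rewrite add0r derive_id derive_cst subr0 scaler1.
  rewrite (@increasing_ge0_integration_by_substitutionT _
      (fun w : R => (w - c * x) / s)).
  - apply: eq_integral => w _; congr EFin.
    rewrite dF /= !fctE /= -mulrA; congr (f _ * _).
    by field; rewrite sN0.
  - by move=> a b ab; rewrite ltr_pM2r ?invr_gt0// ltrD2r.
  - by rewrite dF => ?; exact: cvg_cst.
  - by rewrite dF; exact: is_cvg_cst.
  - by rewrite dF; exact: is_cvg_cst.
  - by [].
  - apply/gt0_cvgMlNy; last exact: cvg_addrr_Ny.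
    by rewrite invr_gt0.
  - apply/gt0_cvgMly; last exact: cvg_addrr.
    by rewrite invr_gt0.
  - move=> y; apply: cvgM; first exact: cl.
    exact: continuous_normal_pdf.
  - by move=> y; rewrite mulr_ge0// normal_pdf_ge0.
under eq_integral do rewrite inner.
pose h (z : R * R) := f z.2 * (normal_pdf 0 1 z.2 * normal_pdf (c * z.2) s z.1).
have mh : measurable_fun setT h.
  apply: measurable_funM; first exact: measurableT_comp.
  apply: measurable_funM; first exact: (measurableT_comp (mp 0 1)).
  rewrite /normal_pdf (negbTE sN0) /normal_fun.
  apply: measurable_funM => //; apply: measurableT_comp => //.
  apply: measurable_funM => //; apply: measurableT_comp => //.
  apply: measurable_funX; apply: measurable_funB => //.
  exact: measurable_funM.
have h0 z : 0 <= h z by rewrite !mulr_ge0// normal_pdf_ge0.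
have mq : measurable_fun setT (fun z : R * R => normal_pdf 0 1 ((z.2 - c * z.1) / s) / s).
  apply: measurable_funM => //; apply: (measurableT_comp (mp 0 1)).
  apply: measurable_funM => //; apply: measurable_funB => //.
  exact: measurable_funM.
rewrite [LHS]ge0_integral_normal_prob; last 2 first.
- apply: (@measurable_fun_fubini_tonelli_F _ _ _ _ _ mu
    (fun z : R * R => (f z.2 * (normal_pdf 0 1 ((z.2 - c * z.1) / s) / s))%:E)).
    apply/measurable_EFinP; apply: measurable_funM => //.
    exact: measurableT_comp.
  by move=> z; rewrite lee_fin !mulr_ge0// ?normal_pdf_ge0// invr_ge0 ltW.
- move=> x; apply: integral_ge0 => w _.
  by rewrite lee_fin !mulr_ge0// ?normal_pdf_ge0// invr_ge0 ltW.
transitivity (\int[mu]_x \int[mu]_w (h (x, w))%:E)%E.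
  apply: eq_integral => x _.
  rewrite muleC -ge0_integralZl//.
  - apply: eq_integral => w _; rewrite -EFinM; congr EFin.
    by rewrite /h/= -normal_pdf_rotation// mulrCA.
  - apply/measurable_EFinP; apply: measurable_funM => //.
    exact: (measurableT_comp mq (measurable_pair1 x)).
  - by move=> w _; rewrite lee_fin !mulr_ge0// ?normal_pdf_ge0// invr_ge0 ltW.
  - by rewrite lee_fin normal_pdf_ge0.
rewrite (@fubini_tonelli _ _ _ _ _ mu mu (EFin \o h))//; last first.
  exact/measurable_EFinP.
rewrite ge0_integral_normal_prob; last 2 first.
- exact/measurable_EFinP.
- by move=> y; rewrite lee_fin.
apply: eq_integral => w _.
rewrite /= /h/=.
under eq_integral do rewrite mulrA EFinM.
rewrite ge0_integralZl//.
- by rewrite integral_normal_pdf mule1.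
- by apply/measurable_EFinP; exact: mp.
- by move=> x _; rewrite lee_fin normal_pdf_ge0.
- by rewrite lee_fin mulr_ge0// normal_pdf_ge0.
Qed.

End StandardNormal.

(** * Functions whose local Lipschitz constant grows at most exponentially *)

Section ExpLipschitz.
Variable R : realType.
Implicit Types (V W : normedModType R).

(** Lipschitz functions alone are not closed under products or exponentials. This class is closed
    under products, contains exp of every Lipschitz function, and still gives continuity and
    Gaussian integrability. *)
Definition explip V (f : V -> R) := exists C c : R, [/\ 0 <= C, 0 <= c &
  forall z z', `|f z - f z'| <= C * `|z - z'| * expR (c * (`|z| + `|z'|))].

Lemma explip_le V (f : V -> R) (C c : R) :
  (forall z z', `|f z - f z'| <= C * `|z - z'| * expR (c * (`|z| + `|z'|))) ->
  explip f.
Proof.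
move=> h; exists `|C|, `|c|; split => // z z'.
apply: (le_trans (h z z')).
apply: (@le_trans _ _ (`|C| * `|z - z'| * expR (c * (`|z| + `|z'|)))).
  by rewrite ler_wpM2r ?expR_ge0// ler_wpM2r// ler_norm.
by rewrite ler_wpM2l ?mulr_ge0// ler_expR ler_wpM2r ?addr_ge0// ler_norm.
Qed.

Lemma lip_explip V (f : V -> R) (C : R) :
  (forall z z', `|f z - f z'| <= C * `|z - z'|) -> explip f.
Proof.
by move=> h; apply: (@explip_le _ _ C 0) => z z'; rewrite mul0r expR0 mulr1.
Qed.

Lemma explip_cst V (k : R) : explip (fun _ : V => k).
Proof. by apply: (@lip_explip _ _ 0) => z z'; rewrite subrr normr0 mul0r. Qed.

Lemma explip_growth V (f : V -> R) : explip f ->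
  exists C c : R, [/\ 0 <= C, 0 <= c & forall z, `|f z| <= C * expR (c * `|z|)].
Proof.
move=> [C [c [C0 c0 h]]]; exists (`|f 0| + C), (c + 1); split; rewrite ?addr_ge0// => z.
have h1 : `|f z| <= `|f 0| + C * `|z| * expR (c * `|z|).
  have := h z 0; rewrite subr0 normr0 addr0 => h1.
  by rewrite -(subrK (f 0) (f z)) addrC (le_trans (ler_normD _ _))// lerD2l.
apply: (le_trans h1); rewrite mulrDl lerD//.
  by rewrite ler_peMr// -expR0 ler_expR mulr_ge0// addr_ge0.
rewrite -mulrA ler_wpM2l// mulrDl mul1r expRD mulrC ler_wpM2l ?expR_ge0//.
by rewrite (le_trans _ (expR_ge1Dx _))// lerDr.
Qed.

Lemma explipD V (f g : V -> R) : explip f -> explip g ->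
  explip (fun z : V => f z + g z).
Proof.
move=> [C [c [C0 c0 hf]]] [D [d [D0 d0 hg]]].
apply: (@explip_le _ _ (C + D) (c + d)) => z z'.
rewrite opprD addrACA (le_trans (ler_normD _ _))// !mulrDl lerD//.
  rewrite (le_trans (hf _ _))// ler_wpM2l ?mulr_ge0// ler_expR lerDl.
  by rewrite mulr_ge0// addr_ge0.
rewrite (le_trans (hg _ _))// ler_wpM2l ?mulr_ge0// ler_expR lerDr.
by rewrite mulr_ge0// addr_ge0.
Qed.

Lemma explipM V (f g : V -> R) : explip f -> explip g ->
  explip (fun z : V => f z * g z).
Proof.
move=> ef eg.
have [A [a [A0 a0 gf]]] := explip_growth ef.
have [B [b [B0 b0 gg]]] := explip_growth eg.
move: ef eg => [C [c [C0 c0 hf]]] [D [d [D0 d0 hg]]].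
apply: (@explip_le _ _ (A * D + B * C) (a + b + c + d)) => z z'.
have -> : f z * g z - f z' * g z' = f z * (g z - g z') + g z' * (f z - f z') by ring.
have zz0 : 0 <= `|z| + `|z'| by rewrite addr_ge0.
rewrite (le_trans (ler_normD _ _))// !normrM mulrDl mulrDl lerD//.
  have -> : A * D * `|z - z'| * expR ((a + b + c + d) * (`|z| + `|z'|)) =
     A * expR ((a + b + c) * (`|z| + `|z'|)) * (D * `|z - z'| * expR (d * (`|z| + `|z'|))).
    rewrite mulrDl expRD; ring.
  rewrite ler_pM// (le_trans (gf z))// ler_wpM2l// ler_expR.
  by rewrite ler_pM// ?lerDl// -addrA lerDl addr_ge0.
have -> : B * C * `|z - z'| * expR ((a + b + c + d) * (`|z| + `|z'|)) =
     B * expR ((a + b + d) * (`|z| + `|z'|)) * (C * `|z - z'| * expR (c * (`|z| + `|z'|))).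
  have -> : a + b + c + d = a + b + d + c by ring.
  by rewrite [in LHS]mulrDl expRD; ring.
rewrite ler_pM// (le_trans (gg z'))// ler_wpM2l// ler_expR.
by rewrite ler_pM// ?lerDr// (addrC a) -addrA lerDl addr_ge0.
Qed.

Lemma explipZ V (k : R) (f : V -> R) : explip f -> explip (fun z : V => k * f z).
Proof. exact/explipM/explip_cst. Qed.

Lemma explipN V (f : V -> R) : explip f -> explip (fun z : V => - f z).
Proof.
by move=> [C [c [C0 c0 h]]]; exists C, c; split => // z z'; rewrite -opprD normrN.
Qed.

Lemma explipB V (f g : V -> R) : explip f -> explip g ->
  explip (fun z : V => f z - g z).
Proof. by move=> ef eg; apply: explipD => //; exact: explipN. Qed.

Lemma explip_sum V (I : Type) (r : seq I) (f : I -> V -> R) :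
  (forall i, explip (f i)) -> explip (fun z : V => \sum_(i <- r) f i z).
Proof.
move=> h; elim: r => [|i r IH].
  by under eq_fun do rewrite big_nil; exact: explip_cst.
by under eq_fun do rewrite big_cons; exact: explipD.
Qed.

Lemma lip_comp_explip V (phi : R -> R) (K : R) (f : V -> R) :
  (forall x y, `|phi x - phi y| <= K * `|x - y|) -> explip f ->
  explip (phi \o f).
Proof.
move=> hphi [C [c [C0 c0 h]]]; apply: (@explip_le _ _ (`|K| * C) c) => z z'.
rewrite (le_trans (hphi _ _))// -!mulrA.
apply: (@le_trans _ _ (`|K| * `|f z - f z'|)); first by rewrite ler_wpM2r// ler_norm.
by rewrite ler_wpM2l// mulrA.
Qed.

Lemma explip_abs V (f : V -> R) : explip f -> explip (fun z : V => `|f z|).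
Proof. by apply: (@lip_comp_explip _ _ 1) => x y; rewrite mul1r ler_dist_dist. Qed.

Lemma explip_max0 V (f : V -> R) : explip f -> explip (fun z : V => Num.max 0 (f z)).
Proof.
apply: (@lip_comp_explip _ (Num.max 0) 1) => x y; rewrite mul1r.
rewrite /Num.max; case: ltP => x0; case: ltP => y0 //;
  rewrite ?subrr ?normr0// ?subr0 ?sub0r ?normrN.
  by rewrite gtr0_norm// (le_trans _ (ler_norm _))// lerDl oppr_ge0.
by rewrite gtr0_norm// distrC (le_trans _ (ler_norm _))// lerDl oppr_ge0.
Qed.

Lemma expR_lip (a b : R) : `|expR a - expR b| <= `|a - b| * expR (`|a| + `|b|).
Proof.
wlog ab : a b / b <= a => [hw|].
  have [/hw//|/ltW/hw] := leP b a; by rewrite distrC (distrC b) (addrC `|b|).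
rewrite (ger0_norm (_ : 0 <= expR a - _)) ?subr_ge0 ?ler_expR//.
rewrite (ger0_norm (_ : 0 <= a - b)) ?subr_ge0//.
apply: (@le_trans _ _ ((a - b) * expR a)).
  have /(ler_wpM2l (expR_ge0 a)) := expR_ge1Dx (b - a).
  rewrite -expRD subrKC mulrDr mulr1 => h.
  by rewrite lerBlDr; lra.
rewrite ler_wpM2l ?subr_ge0// ler_expR (le_trans (ler_norm _))// lerDl//.
Qed.

Lemma explip_expR V (psi : V -> R) (K : R) :
  (forall z z', `|psi z - psi z'| <= K * `|z - z'|) ->
  explip (fun z : V => expR (psi z)).
Proof.
move=> h; set k := `|psi 0|.
have g z : `|psi z| <= k + `|K| * `|z|.
  have := h z 0; rewrite subr0 => h1.
  rewrite -(subrK (psi 0) (psi z)) addrC (le_trans (ler_normD _ _))// lerD2l.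
  by rewrite (le_trans h1)// ler_wpM2r// ler_norm.
apply: (@explip_le _ _ (`|K| * expR (k + k)) `|K|) => z z'.
rewrite (le_trans (expR_lip _ _))//.
have -> : `|K| * expR (k + k) * `|z - z'| * expR (`|K| * (`|z| + `|z'|)) =
  (`|K| * `|z - z'|) * expR (k + k + `|K| * (`|z| + `|z'|)) by rewrite (expRD (k + k)); ring.
rewrite ler_pM ?expR_ge0// ?ler_expR.
  by rewrite (le_trans (h _ _))// ler_wpM2r// ler_norm.
by rewrite mulrDr addrACA lerD.
Qed.

Lemma explip_comp V W (f : V -> R) (T : W -> V) (K : R) :
  (forall z z', `|T z - T z'| <= K * `|z - z'|) -> explip f ->
  explip (f \o T).
Proof.
move=> hT [C [c [C0 c0 h]]]; set k := `|T 0|.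
have g z : `|T z| <= k + `|K| * `|z|.
  have := hT z 0; rewrite subr0 => h1.
  rewrite -(subrK (T 0) (T z)) addrC (le_trans (ler_normD _ _))// lerD2l.
  by rewrite (le_trans h1)// ler_wpM2r// ler_norm.
apply: (@explip_le _ _ (C * `|K| * expR (c * (k + k))) (c * `|K|)) => z z'.
rewrite (le_trans (h _ _))//.
have -> : C * `|K| * expR (c * (k + k)) * `|z - z'| * expR (c * `|K| * (`|z| + `|z'|))
  = C * (`|K| * `|z - z'|) * expR (c * (k + k + `|K| * (`|z| + `|z'|))).
  by rewrite (mulrDr c (k + k)) expRD (mulrA c `|K|); ring.
rewrite ler_pM ?expR_ge0 ?mulr_ge0//.
  by rewrite ler_wpM2l// (le_trans (hT _ _))// ler_wpM2r// ler_norm.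
by rewrite ler_expR ler_wpM2l// mulrDr addrACA lerD.
Qed.

Lemma explip_shift V (f : V -> R) (v : V) : explip f -> explip (fun z : V => f (z + v)).
Proof.
apply: (@explip_comp _ _ _ _ 1) => z z'.
by rewrite opprD addrACA subrr addr0 mul1r.
Qed.

Lemma explip_scale V (f : V -> R) (k : R) : explip f -> explip (fun z : V => f (k *: z)).
Proof. by apply: (@explip_comp _ _ _ _ `|k|) => z z'; rewrite -scalerBr normrZ. Qed.

Lemma explip_continuous V (f : V -> R) : explip f -> continuous f.
Proof.
move=> [C [c [C0 c0 h]]] z; apply/cvgrPdist_le => e e0.
pose K := C * expR (c * (`|z| + (`|z| + 1))) + 1.
have K0 : 0 < K by rewrite ltr_wpDl// mulr_ge0// expR_ge0.
near=> z'.
have zz' : `|z - z'| < e / K by near: z'; apply: cvgr_dist_lt; rewrite // divr_gt0.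
have zz1 : `|z - z'| < 1 by near: z'; apply: cvgr_dist_lt.
rewrite (le_trans (h _ _))//.
apply: (@le_trans _ _ (`|z - z'| * K)); last by rewrite -ler_pdivlMr// ltW.
rewrite mulrC mulrA mulrC ler_wpM2l// /K ler_wpDr// mulrC ler_wpM2l//.
rewrite ler_expR ler_wpM2l// lerD2l -lerBlDl.
by rewrite (le_trans (lerB_dist _ _))// distrC ltW.
Unshelve. all: by end_near. Qed.

End ExpLipschitz.

Section ContinuousMeasurable2.
Variable R : realType.

(** An open subset of the plane is the union of the countably many rational squares inside it, so it
    belongs to the product sigma-algebra that Fubini uses. *)
Lemma continuous_measurable_fun2 (F : R * R -> R) :
  continuous F -> measurable_fun setT F.
Proof.
move=> /continuousP cF; apply: (measurability _ (RGenOpens.measurableE R)).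
move=> _ [_ [a [b ->] <-]]; rewrite setTI.
have : open (F @^-1` `]a, b[%classic) by exact/cF/interval_open.
set U := F @^-1` _ => oU.
pose B (i : rat * rat * nat) : set (R * R) :=
  ball (ratr i.1.1 : R) i.2.+1%:R^-1 `*` ball (ratr i.1.2 : R) i.2.+1%:R^-1.
(* Squares that leave [U] are replaced by the empty set, so that the union runs over a whole
   countable type. *)
pose G (i : rat * rat * nat) := if `[< B i `<=` U >] then B i else set0.
have -> : U = \bigcup_i G i.
  apply/seteqP; split => [[x y] Uxy|xy [i _]]; last first.
    by rewrite /G; case: asboolP => // h /h.
  have [[/= A1 A2] [hA1 hA2] A12] : nbhs (x, y) U by exact: open_nbhs_nbhs.
  have /nbhs_ballP[e1 /= e10 he1] := hA1.
  have /nbhs_ballP[e2 /= e20 he2] := hA2.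
  pose e := Num.min e1 e2.
  have e0 : 0 < e / 2 by rewrite divr_gt0// lt_min e10.
  have [n hn] : exists n : nat, n.+1%:R^-1 < e / 2.
    have [n _ h] := near_infty_natSinv_lt (PosNum e0).
    by exists n; apply: h => /=.
  have n0 : 0 < n.+1%:R^-1 :> R by rewrite invr_gt0.
  have lt_pm (k u : R) : 0 < k -> u - k < u + k by move=> ?; lra.
  have /rat_in_itvoo[p hp] := lt_pm _ x n0.
  have /rat_in_itvoo[q hq] := lt_pm _ y n0.
  have bp : `|ratr p - x| < n.+1%:R^-1.
    by rewrite distrC ltr_distlC; move: hp; rewrite in_itv.
  have bq : `|ratr q - y| < n.+1%:R^-1.
    by rewrite distrC ltr_distlC; move: hq; rewrite in_itv.
  exists (p, q, n) => //; rewrite /G; case: asboolP => [_|[]].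
    by split; rewrite /ball/=.
  move=> [x' y'] [/=]; rewrite /ball/= => bx' by'.
  have d1 : `|x - x'| < e.
    rewrite -(subrKC (ratr p) x') opprD addrA (le_lt_trans (ler_normB _ _))//.
    rewrite [X in _ + X]distrC (distrC x).
    by have := lt_trans bp hn; have := lt_trans bx' hn; lra.
  have d2 : `|y - y'| < e.
    rewrite -(subrKC (ratr q) y') opprD addrA (le_lt_trans (ler_normB _ _))//.
    rewrite [X in _ + X]distrC (distrC y).
    by have := lt_trans bq hn; have := lt_trans by' hn; lra.
  move: d1 d2; rewrite !lt_min => /andP[d1 _] /andP[_ d2].
  by apply: A12; split; [exact: he1|exact: he2].
apply: countable_bigcupT_measurable; first exact: countableP.
move=> i; rewrite /G; case: asboolP => _; last exact: measurable0.
by apply: measurableX; exact: measurable_ball.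
Qed.

End ContinuousMeasurable2.

(** * Gaussian averaging along one direction *)

Section GaussianSmoothing.
Variable R : realType.
Implicit Types (V W : normedModType R).
Local Notation gamma := (normal_prob (0:R) 1).

Definition gsmooth V (a : V) (f : V -> R) (z : V) : R :=
  \int[gamma]_x f (z + x *: a).

Lemma explip_line V (a z : V) (f : V -> R) : explip f ->
  continuous (fun x : R => f (z + x *: a)) /\ exp_growth (fun x : R => f (z + x *: a)).
Proof.
move=> ef; split.
  move=> x; apply: (@continuous_comp _ _ _ (fun x : R => z + x *: a) f).
    by apply: cvgD; [exact: cvg_cst|apply: cvgZr_tmp; exact: cvg_id].
  exact: explip_continuous.
have [C [c [C0 c0 h]]] := explip_growth ef.
exists (C * expR (c * `|z|)), (c * `|a|) => x.
rewrite (le_trans (h _))// -mulrA ler_wpM2l// -expRD ler_expR.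
rewrite -mulrA -mulrDr ler_wpM2l// (le_trans (ler_normD _ _))//.
by rewrite normrZ mulrC.
Qed.

Lemma integrable_line V (a z : V) (f : V -> R) : explip f ->
  gamma.-integrable setT (EFin \o (fun x : R => f (z + x *: a))).
Proof.
move=> /(explip_line a z)[cf gf]; apply: integrable_gamma => //.
exact: continuous_measurable_fun.
Qed.

Lemma gsmooth_EFin V (a : V) (f : V -> R) (z : V) : explip f ->
  (gsmooth a f z)%:E = (\int[gamma]_x (f (z + x *: a))%:E)%E.
Proof.
move=> ef; rewrite /gsmooth /Rintegral fineK//.
by apply: integrable_fin_num => //; exact: integrable_line.
Qed.

Lemma gsmooth_le V (a : V) (f g : V -> R) (z : V) : explip f -> explip g ->
  (forall z, f z <= g z) -> gsmooth a f z <= gsmooth a g z.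
Proof. by move=> ef eg fg; apply: le_Rintegral => //; exact: integrable_line. Qed.

Lemma gsmoothD V (a : V) (f g : V -> R) (z : V) : explip f -> explip g ->
  gsmooth a (fun z => f z + g z) z = gsmooth a f z + gsmooth a g z.
Proof. by move=> ef eg; rewrite /gsmooth RintegralD//; exact: integrable_line. Qed.

Lemma gsmoothZ V (a : V) (k : R) (f : V -> R) (z : V) : explip f ->
  gsmooth a (fun z => k * f z) z = k * gsmooth a f z.
Proof. by move=> ef; rewrite /gsmooth RintegralZl//; exact: integrable_line. Qed.

Lemma gsmooth_cst V (a : V) (k : R) (z : V) : gsmooth a (fun _ : V => k) z = k.
Proof.
rewrite /gsmooth Rintegral_cst// [X in fine X](_ : _ = 1%E) ?mulr1//.
exact: probability_setT.
Qed.

Lemma explip_expabs V (c : R) : explip (fun z : V => expR (c * `|z|)).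
Proof.
apply: (@explip_expR _ _ _ `|c|) => z z'.
by rewrite -mulrBr normrM ler_wpM2l// ler_dist_dist.
Qed.

Definition gexpabs (c : R) : R := \int[gamma]_x (expR (c * `|x|)).

Lemma gsmooth_expabs V (a : V) (c : R) (z : V) : 0 <= c ->
  gsmooth a (fun z => expR (c * `|z|)) z <= gexpabs (c * `|a|) * expR (c * `|z|).
Proof.
move=> c0.
have i : gamma.-integrable setT (EFin \o (fun x : R => expR (c * `|a| * `|x|))).
  apply: integrable_gamma.
    by apply: measurableT_comp => //; apply: measurable_funM => //.
  by exists 1, (c * `|a|) => x; rewrite mul1r ger0_norm// expR_ge0.
rewrite mulrC -RintegralZl//; apply: le_Rintegral => //.
- exact: (integrable_line a z (explip_expabs V c)).
- rewrite (_ : EFin \o _ = (fun x => (expR (c * `|z|))%:E * (expR (c * `|a| * `|x|))%:E)%E).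
    exact: integrableZl.
  by apply/funext => x; rewrite /= EFinM.
- move=> x _; rewrite -expRD ler_expR -mulrA -mulrDr ler_wpM2l//.
  by rewrite (le_trans (ler_normD _ _))// normrZ (mulrC `|a|).
Qed.

Lemma gexpabs_ge0 c : 0 <= gexpabs c.
Proof. by apply: Rintegral_ge0 => x _; exact: expR_ge0. Qed.

Lemma gsmooth_dist V (a : V) (f g : V -> R) (h : V -> R) (z z' : V) :
  explip f -> explip g -> explip h ->
  (forall x, `|f (z + x *: a) - g (z' + x *: a)| <= h (z + x *: a)) ->
  `|gsmooth a f z - gsmooth a g z'| <= gsmooth a h z.
Proof.
move=> ef eg eh H; rewrite /gsmooth -RintegralB//; try exact: integrable_line.
have eB : explip (fun w => f w - g (w + (z' - z))).
  by apply: explipB => //; exact: explip_shift.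
have e x : g (z' + x *: a) = g (z + x *: a + (z' - z)).
  by congr g; rewrite addrAC addrCA subrr addr0.
have i : gamma.-integrable setT (EFin \o (fun x : R => f (z + x *: a) - g (z' + x *: a))).
  under eq_fun do rewrite e; exact: (integrable_line _ _ eB).
rewrite (le_trans (le_normr_Rintegral _ i))//.
apply: le_Rintegral => //; last exact: integrable_line.
have := integrable_line a z (explip_abs eB).
by under eq_fun do rewrite -e.
Qed.

Lemma explip_gsmooth V (a : V) (f : V -> R) : explip f -> explip (gsmooth a f).
Proof.
move=> ef; have [C [c [C0 c0 h]]] := ef.
(* On the shifted lines |z' + x a| <= |w| + |z - z'| with w = z + x a, which gives the factors 2 and
   1 in [g]. The rate 3 then comes from |z - z'| + 2|z| <= 3(|z| + |z'|). *)
apply: (@explip_le _ _ _ (C * gexpabs (c * 2 * `|a|)) (c * 3)) => z z'.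
pose g (w : V) := C * `|z - z'| * expR (c * `|z - z'|) * expR (c * 2 * `|w|).
apply: (@le_trans _ _ (gsmooth a g z)).
  apply: gsmooth_dist => //; first exact/explipZ/explip_expabs.
  move=> x; rewrite (le_trans (h _ _))// opprD addrACA subrr addr0 /g -!mulrA.
  rewrite ler_wpM2l// ler_wpM2l// -expRD ler_expR -mulrDr ler_wpM2l//.
  set w := z + x *: a; have -> : z' + x *: a = w - (z - z').
    by rewrite /w opprB addrAC addrCA subrr addr0.
  by have := ler_normB w (z - z'); lra.
rewrite gsmoothZ; last exact: explip_expabs.
apply: (@le_trans _ _ (C * `|z - z'| * expR (c * `|z - z'|) *
   (gexpabs (c * 2 * `|a|) * expR (c * 2 * `|z|)))).
  by rewrite ler_wpM2l ?gsmooth_expabs ?mulr_ge0 ?expR_ge0.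
rewrite (_ : _ * _ = C * gexpabs (c * 2 * `|a|) * `|z - z'| *
  (expR (c * `|z - z'|) * expR (c * 2 * `|z|))); last by ring.
rewrite ler_wpM2l ?mulr_ge0 ?gexpabs_ge0// -expRD ler_expR -!mulrA -mulrDr ler_wpM2l//.
have := ler_normB z z'; have := normr_ge0 z'; lra.
Qed.

Lemma gsmooth_fubini V (a b z : V) (f : V -> R) : explip f ->
  (gsmooth a (gsmooth b f) z)%:E =
   (\int[gamma]_x \int[gamma]_y (f (z + x *: a + y *: b))%:E)%E.
Proof.
move=> ef; rewrite gsmooth_EFin; last exact: explip_gsmooth.
by apply: eq_integral => x _; rewrite gsmooth_EFin.
Qed.

(** Fubini. Joint integrability holds because the iterated integral of |f| is the finite number
    given by smoothing |f| twice. *)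
Lemma gsmoothC V (a b z : V) (f : V -> R) : explip f ->
  gsmooth a (gsmooth b f) z = gsmooth b (gsmooth a f) z.
Proof.
move=> ef; apply: EFin_inj; rewrite !gsmooth_fubini//.
pose F (xy : R * R) := (f (z + xy.1 *: a + xy.2 *: b))%:E.
have mF : measurable_fun setT F.
  apply/measurable_EFinP; apply: continuous_measurable_fun2 => xy.
  apply: (@continuous_comp _ _ _ (fun xy : R * R => z + xy.1 *: a + xy.2 *: b) f).
    apply: cvgD; [apply: cvgD; first exact: cvg_cst|]; apply: cvgZr_tmp.
      exact: cvg_fst.
    exact: cvg_snd.
  exact: explip_continuous.
have iF : (gamma \x gamma)%E.-integrable setT F.
  apply/integrable12ltyP => //.
  have eA := explip_abs ef.
  have := gsmooth_fubini a b z eA.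
  rewrite /F/= => <-; exact: ltry.
have := Fubini iF; rewrite /F/= => ->.
by apply: eq_integral => x _; apply: eq_integral => y _; rewrite addrAC.
Qed.

Lemma gsmooth_rotation V (a z : V) (c s : R) (f : V -> R) : explip f ->
  c ^+ 2 + s ^+ 2 = 1 -> 0 < s ->
  gsmooth (c *: a) (gsmooth (s *: a) f) z = gsmooth a f z.
Proof.
move=> ef cs s0.
have H (g : V -> R) : explip g -> (forall z, 0 <= g z) ->
    gsmooth (c *: a) (gsmooth (s *: a) g) z = gsmooth a g z.
  move=> eg g0; apply: EFin_inj; rewrite gsmooth_fubini// gsmooth_EFin//.
  rewrite -(@gamma_rotation_ge0 _ c s (fun x => g (z + x *: a)))//; last first.
    by have [] := explip_line a z eg.
  apply: eq_integral => x _; apply: eq_integral => y _.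
  by rewrite !scalerA (mulrC c) (mulrC s) scalerDl addrA.
(* The rotation identity is known for nonnegative functions, so [f] is split into its positive and
   negative parts. *)
have fE w : f w = Num.max 0 (f w) + -1 * Num.max 0 (- f w).
  by rewrite /Num.max oppr_gt0; case: ltgtP => // ?; lra.
have e1 := explip_max0 ef.
have e2 := explip_max0 (explipN ef).
have {fE} -> : f = (fun w => Num.max 0 (f w) + -1 * Num.max 0 (- f w)).
  by apply/funext => w; exact: fE.
have -> b : gsmooth b (fun w => Num.max 0 (f w) + -1 * Num.max 0 (- f w)) =
    (fun w => gsmooth b (fun w => Num.max 0 (f w)) w + -1 *
              gsmooth b (fun w => Num.max 0 (- f w)) w).
  apply/funext => w; rewrite gsmoothD//; last exact: explipZ.
  by rewrite gsmoothZ.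
rewrite gsmoothD; [|exact: explip_gsmooth|exact/explipZ/explip_gsmooth].
rewrite gsmoothZ; last exact: explip_gsmooth.
rewrite [RHS]gsmoothD//; last exact: explipZ.
by rewrite (gsmoothZ a)// !H// => w; rewrite le_max lexx.
Qed.

End GaussianSmoothing.

Section ExpTaylor.
Variable R : realType.

(** In the tail of the series, (k + N)! >= k! lets |x|^N be factored out and leaves a partial sum of
    exp |x|. *)
Lemma expR_taylor (x : R) (N : nat) :
  `|expR x - \sum_(k < N) x ^+ k / k`!%:R| <= `|x| ^+ N * expR `|x|.
Proof.
have cx := is_cvg_series_exp_coeff x.
have nd : nondecreasing_seq (series (exp_coeff `|x|)).
  apply/nondecreasing_seqP => n; rewrite /series/= big_nat_recr//= lerDl.
  exact: exp_coeff_ge0.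
have ex n : \sum_(0 <= k < n) exp_coeff `|x| k <= expR `|x|.
  exact: (nondecreasing_cvgn_le nd (is_cvg_series_exp_coeff _)).
pose S : R := \sum_(k < N) x ^+ k / k`!%:R.
have cS : `|series (exp_coeff x) n - S| @[n --> \oo] --> `|expR x - S|.
  by apply: cvg_norm; apply: cvgB; [exact: cx|exact: cvg_cst].
rewrite -/S; apply: (cvgr_to_le cS); near=> n.
have Nn : (N <= n)%N by near: n; exact: nbhs_infty_ge.
rewrite /series/= /S -(big_mkord xpredT (fun k => x ^+ k / k`!%:R)).
rewrite (big_cat_nat (leq0n N) Nn)/= addrAC subrr add0r.
rewrite (le_trans (ler_norm_sum _ _ _))//.
apply: (@le_trans _ _ (`|x| ^+ N * \sum_(0 <= k < n - N) exp_coeff `|x| k)); last first.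
  by rewrite ler_wpM2l ?exprn_ge0.
rewrite mulr_sumr -{1}(add0n N) big_addn; apply: ler_sum => k _.
rewrite /exp_coeff/= normrM normrX normfV addnC exprD (ger0_norm (ler0n _ _)) -mulrA.
rewrite ler_wpM2l ?exprn_ge0// ler_wpM2l ?exprn_ge0//.
rewrite lef_pV2 ?posrE ?ltr0n ?fact_gt0// ler_nat.
by elim: (N) => // i IH; rewrite addSn factS (leq_trans IH)// leq_pmull.
Unshelve. all: by end_near. Qed.

Lemma expR_taylor2 (x : R) : `|expR x - (1 + x)| <= `|x| ^+ 2 * expR `|x|.
Proof.
have := expR_taylor x 2; rewrite !big_ord_recr big_ord0 /= expr0 expr1.
by rewrite !divr1 add0r.
Qed.

Lemma expR_taylor3 (x : R) :
  `|expR x - (1 + x + x ^+ 2 / 2)| <= `|x| ^+ 3 * expR `|x|.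
Proof.
have := expR_taylor x 3; rewrite !big_ord_recr big_ord0 /= expr0 expr1.
by rewrite !divr1 add0r.
Qed.

Lemma eq0_linear_bound (A K : R) :
  (forall c : R, 0 < c <= 1 -> `|A| <= K * c) -> A = 0.
Proof.
move=> h; apply/eqP; rewrite -normr_eq0; apply/eqP.
have [//|A0] := eqVneq `|A| 0.
have {}A0 : 0 < `|A| by rewrite lt_def A0 normr_ge0.
(* At c = |A| / (2k) the bound would read |A| <= K |A| / (2k), which is at most |A| / 2. *)
pose k : R := `|K| + `|A|.
have k0 : 0 < k by rewrite ltr_wpDl.
have := h (`|A| / (2 * k)).
rewrite divr_gt0 ?mulr_gt0//= ler_pdivrMr ?mulr_gt0// mul1r.
have -> : `|A| <= 2 * k by have := normr_ge0 K; rewrite /k; lra.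
move=> /(_ isT); rewrite mulrA ler_pdivlMr ?mulr_gt0// => h1.
have : K * `|A| <= k * `|A|.
  by rewrite ler_wpM2r// (le_trans (ler_norm _))// lerDl.
by have : 0 < k * `|A| := mulr_gt0 k0 A0; lra.
Qed.

End ExpTaylor.

Section NormalMoments.
Variable R : realType.
Local Notation gamma := (normal_prob (0:R) 1).
Let m1 : R := \int[gamma]_x x.
Let m2 : R := \int[gamma]_x (x ^+ 2).

Let id_growth (c k : R) (n : nat) : `|k| <= 1 -> (n <= 3)%N ->
  gamma.-integrable setT (EFin \o (fun x : R => `|x| ^+ n * expR (k * `|x|))).
Proof.
move=> k1 n3; apply: integrable_gamma.
  apply: measurable_funM; first by apply: measurable_funX.
  by apply: measurableT_comp => //; apply: measurable_funM.
(* The factor 6 = 3! comes from y^n <= n! exp y with n <= 3, and the rate 2 adds the exponent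
   already present. *)
exists 6, 2 => x; rewrite ger0_norm ?mulr_ge0 ?expR_ge0 ?exprn_ge0//.
have x0 := normr_ge0 x; move: (`|x|) x0 => y y0.
have -> : 2 * y = y + 1 * y by rewrite mul1r mulr2n mulrDl mul1r.
rewrite expRD mulrA; apply: ler_pM; rewrite ?exprn_ge0 ?expR_ge0//; last first.
  by rewrite ler_expR ler_wpM2r// (le_trans (ler_norm _)).
have h0 : 1 <= expR y by rewrite -expR0 ler_expR.
case: n n3 => [_|n n3]; first by rewrite expr0; lra.
have := expR_ge1Dxn n y0 => h.
have f0 : 0 < (n.+1)`!%:R :> R by rewrite ltr0n fact_gt0.
have : y ^+ n.+1 / (n.+1)`!%:R <= expR y by lra.
rewrite ler_pdivrMr// => /le_trans; apply; rewrite mulrC ler_wpM2r ?expR_ge0//.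
by rewrite (ler_nat _ _ 6); case: n n3 {h f0} => [|[|[|]]].
Qed.

(** The moments are read off the identity E exp(c x) = exp(c^2 / 2). Expanding both sides to second
    order gives c m1 + (c^2 / 2)(m2 - 1) = O(c^3); dividing by c, then by c^2 / 2, and letting c
    tend to 0 yields the two values. *)
Lemma normal_moments : m1 = 0 /\ m2 = 1.
Proof.
pose K : R := \int[gamma]_x (`|x| ^+ 3 * expR (1 * `|x|)).
have K0 : 0 <= K by apply: Rintegral_ge0 => x _; rewrite mulr_ge0 ?exprn_ge0 ?expR_ge0.
have i1 : gamma.-integrable setT (EFin \o (fun x : R => x)).
  apply: integrable_gamma => //; exists 1, 1 => x; rewrite !mul1r.
  by rewrite (le_trans _ (expR_ge1Dx _))// lerDr.
have i2 : gamma.-integrable setT (EFin \o (fun x : R => x ^+ 2)).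
  have := @id_growth 0 0 2; rewrite normr0 ler01 => /(_ isT isT).
  by under eq_fun do rewrite mul0r expR0 mulr1 real_normK ?num_real//.
have i0 (k : R) : gamma.-integrable setT (EFin \o (fun _ : R => k)).
  exact: finite_measure_integrable_cst.
have main (c : R) : 0 < c <= 1 -> `|c * m1 + c ^+ 2 / 2 * (m2 - 1)| <= (K + 2) * c ^+ 3.
  move=> /andP[c0 c1].
  have ie : gamma.-integrable setT (EFin \o (fun x : R => expR (c * x))).
    apply: integrable_gamma.
      by apply: measurableT_comp => //; exact: measurable_funM.
    by exists 1, c => x; rewrite mul1r ger0_norm ?expR_ge0// ler_expR ler_wpM2l ?ler_norm// ltW.
  have Ee : \int[gamma]_x expR (c * x) = expR (c ^+ 2 / 2).
    by rewrite /Rintegral integral_expR_gamma.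
  have iz1 : gamma.-integrable setT (EFin \o (fun x : R => c * x)).
    by have := integrableZl measurableT c i1; apply: eq_integrable.
  have iz2 : gamma.-integrable setT (EFin \o (fun x : R => c ^+ 2 / 2 * x ^+ 2)).
    by have := integrableZl measurableT (c ^+ 2 / 2) i2; apply: eq_integrable.
  have ip1 : gamma.-integrable setT (EFin \o (fun x : R => 1 + c * x)).
    by have := integrableD measurableT (i0 1) iz1; apply: eq_integrable.
  have ip : gamma.-integrable setT (EFin \o (fun x : R => 1 + c * x + c ^+ 2 / 2 * x ^+ 2)).
    by have := integrableD measurableT ip1 iz2; apply: eq_integrable.
  have Ep : \int[gamma]_x (1 + c * x + c ^+ 2 / 2 * x ^+ 2) = 1 + c * m1 + c ^+ 2 / 2 * m2.
    rewrite RintegralD// RintegralD// !RintegralZl// Rintegral_cst//.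
    by rewrite [X in fine X](_ : _ = 1%E) ?mulr1//; exact: probability_setT.
  have id : gamma.-integrable setT
      (EFin \o (fun x : R => expR (c * x) - (1 + c * x + c ^+ 2 / 2 * x ^+ 2))).
    by have := integrableB measurableT ie ip; apply: eq_integrable.
  have i3 := @id_growth 0 1 3; rewrite normr1 lexx in i3; have {}i3 := i3 isT isT.
  have b1 : `|expR (c ^+ 2 / 2) - (1 + c * m1 + c ^+ 2 / 2 * m2)| <= c ^+ 3 * K.
    rewrite -Ee -Ep -RintegralB//.
    rewrite (le_trans (le_normr_Rintegral _ id))// -RintegralZl//.
    apply: le_Rintegral => //.
    - exact: (integrable_abse id).
    - by have := integrableZl measurableT (c ^+ 3) i3; apply: eq_integrable.
    - move=> x _; have := expR_taylor3 (c * x).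
      have -> : 1 + c * x + (c * x) ^+ 2 / 2 = 1 + c * x + c ^+ 2 / 2 * x ^+ 2 by ring.
      move=> /le_trans; apply; rewrite normrM exprMn (gtr0_norm c0) -mulrA.
      rewrite ler_wpM2l ?exprn_ge0 ?(ltW c0)// ler_wpM2l ?exprn_ge0// ler_expR ler_wpM2r//.
  have b2 : `|expR (c ^+ 2 / 2) - (1 + c ^+ 2 / 2)| <= 2 * c ^+ 3.
    apply: (le_trans (expR_taylor2 _)).
    have h0 : 0 <= c ^+ 2 / 2 by rewrite divr_ge0// exprn_ge0// ltW.
    have c2 : c ^+ 2 <= 1 by rewrite expr_le1// ltW.
    rewrite ger0_norm//.
    have e2 : expR (c ^+ 2 / 2) <= 2.
      have := expR_ge1Dx (- (c ^+ 2 / 2)); rewrite expRN => h.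
      have h2 : 2^-1 <= (expR (c ^+ 2 / 2))^-1 by lra.
      by rewrite -[leRHS]invrK -[leLHS]invrK lef_pV2 ?posrE ?invr_gt0 ?expR_gt0//.
    rewrite mulrC ler_pM ?expR_ge0 ?exprn_ge0//.
    have -> : (c ^+ 2 / 2) ^+ 2 = c ^+ 3 * (c / 4) by field.
    by rewrite ler_piMr ?exprn_ge0 ?(ltW c0)//; lra.
  have -> : c * m1 + c ^+ 2 / 2 * (m2 - 1) = (expR (c ^+ 2 / 2) - (1 + c ^+ 2 / 2)) -
     (expR (c ^+ 2 / 2) - (1 + c * m1 + c ^+ 2 / 2 * m2)) by ring.
  by rewrite (le_trans (ler_normB _ _))//; lra.
have M1 : m1 = 0.
  apply: (@eq0_linear_bound _ _ (K + 2 + `|m2 - 1|)) => c c01.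
  have [c0 c1] := andP c01; have := main c c01.
  have -> : c * m1 + c ^+ 2 / 2 * (m2 - 1) = c * (m1 + c / 2 * (m2 - 1)) by ring.
  rewrite normrM (gtr0_norm c0) exprS mulrCA ler_pM2l// => h.
  have : `|m1| <= `|m1 + c / 2 * (m2 - 1)| + `|c / 2 * (m2 - 1)|.
    by rewrite -{1}(addrK (c / 2 * (m2 - 1)) m1) (le_trans (ler_normB _ _)).
  rewrite [X in _ + X]normrM (gtr0_norm (_ : 0 < c / 2)) ?divr_gt0// => h2.
  have h3 : (K + 2) * c ^+ 2 <= (K + 2) * c.
    by rewrite ler_wpM2l ?addr_ge0// expr2 ler_piMl// ltW.
  have h4 : c / 2 * `|m2 - 1| <= c * `|m2 - 1| by rewrite ler_wpM2r//; lra.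
  by rewrite mulrDl; lra.
split=> //; apply/eqP; rewrite -subr_eq0; apply/eqP.
apply: (@eq0_linear_bound _ _ (2 * (K + 2))) => c c01.
have [c0 c1] := andP c01; have := main c c01; rewrite M1 mulr0 add0r.
rewrite normrM (ger0_norm (_ : 0 <= c ^+ 2 / 2)) ?divr_ge0 ?exprn_ge0 ?(ltW c0)//.
have -> : (K + 2) * c ^+ 3 = c ^+ 2 / 2 * (2 * (K + 2) * c) by field.
by rewrite ler_pM2l// divr_gt0// exprn_gt0.
Qed.

End NormalMoments.

(** * Averaging over a list of directions and its heat semigroup *)

Section IteratedSmoothing.
Variable R : realType.
Implicit Types (V W : normedModType R).
Local Notation gamma := (normal_prob (0:R) 1).

(** The list [l] stands for the centred Gaussian vector obtained by summing its entries with
    independent standard normal coefficients; the value at [z] is the expectation of [f] at [z] plus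
    that vector. *)
Definition gsmooths V (l : seq V) (f : V -> R) : V -> R :=
  foldr (@gsmooth R V) f l.

Lemma explip_gsmooths V (l : seq V) f : explip f -> explip (gsmooths l f).
Proof. by move=> ef; elim: l => //= a l IH; exact: explip_gsmooth. Qed.

Lemma gsmooths_cat V (l1 l2 : seq V) f :
  gsmooths (l1 ++ l2) f = gsmooths l1 (gsmooths l2 f).
Proof. by rewrite /gsmooths foldr_cat. Qed.

Lemma gsmooths_le V (l : seq V) f g z : explip f -> explip g ->
  (forall z, f z <= g z) -> gsmooths l f z <= gsmooths l g z.
Proof.
move=> ef eg fg; elim: l z => //= a l IH z.
by apply: gsmooth_le => //; exact: explip_gsmooths.
Qed.

Lemma gsmoothsD V (l : seq V) f g z : explip f -> explip g ->
  gsmooths l (fun z => f z + g z) z = gsmooths l f z + gsmooths l g z.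
Proof.
move=> ef eg; elim: l z => //= a l IH z.
rewrite (_ : gsmooths l _ = (fun z => gsmooths l f z + gsmooths l g z)).
  by rewrite gsmoothD//; exact: explip_gsmooths.
exact/funext.
Qed.

Lemma gsmoothsZ V (l : seq V) k f z : explip f ->
  gsmooths l (fun z => k * f z) z = k * gsmooths l f z.
Proof.
move=> ef; elim: l z => //= a l IH z.
rewrite (_ : gsmooths l _ = (fun z => k * gsmooths l f z)).
  by rewrite gsmoothZ//; exact: explip_gsmooths.
exact/funext.
Qed.

Lemma gsmooths_cst V (l : seq V) k z : gsmooths l (fun=> k) z = k.
Proof.
elim: l z => //= a l IH z.
rewrite (_ : gsmooths l _ = (fun=> k)); first exact: gsmooth_cst.
exact/funext.
Qed.

Lemma gsmoothsB V (l : seq V) f g z : explip f -> explip g ->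
  gsmooths l (fun z => f z - g z) z = gsmooths l f z - gsmooths l g z.
Proof.
move=> ef eg; rewrite -mulN1r -gsmoothsZ// -gsmoothsD//; last exact: explipZ.
by congr (gsmooths l _ z); apply/funext => w; rewrite mulN1r.
Qed.

Lemma gsmooths_sum V (l : seq V) (I : Type) (r : seq I) (f : I -> V -> R) z :
  (forall i, explip (f i)) ->
  gsmooths l (fun z => \sum_(i <- r) f i z) z = \sum_(i <- r) gsmooths l (f i) z.
Proof.
move=> ef; elim: r => [|i r IH].
  rewrite big_nil; under [X in gsmooths l X]eq_fun do rewrite big_nil.
  exact: gsmooths_cst.
rewrite big_cons -IH -gsmoothsD//; last exact: explip_sum.
by under [X in gsmooths l X]eq_fun do rewrite big_cons.
Qed.

Lemma gsmooth_gsmoothsC V a (l : seq V) f : explip f ->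
  gsmooth a (gsmooths l f) = gsmooths l (gsmooth a f).
Proof.
move=> ef; elim: l => //= b l IH; rewrite -IH; apply/funext => z.
by rewrite gsmoothC//; exact: explip_gsmooths.
Qed.

Lemma gsmoothsC V (l1 l2 : seq V) f : explip f ->
  gsmooths l1 (gsmooths l2 f) = gsmooths l2 (gsmooths l1 f).
Proof.
move=> ef; elim: l1 => //= a l IH.
by rewrite IH gsmooth_gsmoothsC//; exact: explip_gsmooths.
Qed.

Definition scaled V (s : R) (l : seq V) : seq V := [seq Num.sqrt s *: a | a <- l].

(** Variances of independent Gaussians add: this is rotation invariance in direction sqrt(s + t) a,
    with cosine sqrt(s / (s + t)). *)
Lemma gsmooth_semigroup V (s t : R) (a : V) f : explip f -> 0 <= s -> 0 < t ->
  gsmooth (Num.sqrt s *: a) (gsmooth (Num.sqrt t *: a) f) =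
  gsmooth (Num.sqrt (s + t) *: a) f.
Proof.
move=> ef s0 t0; apply/funext => z.
have st0 : 0 < s + t by rewrite ltr_wpDl.
have r0 : 0 < Num.sqrt (s + t) by rewrite sqrtr_gt0.
have rN0 : Num.sqrt (s + t) != 0 by rewrite gt_eqF.
rewrite -(@gsmooth_rotation _ _ (Num.sqrt (s + t) *: a) z
   (Num.sqrt s / Num.sqrt (s + t)) (Num.sqrt t / Num.sqrt (s + t)))//.
- by rewrite !scalerA !divfK.
- by rewrite !expr_div_n !sqr_sqrtr ?(ltW st0) ?(ltW t0)// -mulrDl divff// gt_eqF.
- by rewrite divr_gt0// sqrtr_gt0.
Qed.

Lemma gsmooths_semigroup V (s t : R) (l : seq V) f : explip f -> 0 <= s -> 0 < t ->
  gsmooths (scaled s l) (gsmooths (scaled t l) f) = gsmooths (scaled (s + t) l) f.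
Proof.
move=> ef s0 t0; elim: l => //= a l <-.
have e1 := explip_gsmooths (scaled t l) ef.
rewrite -gsmooth_gsmoothsC// gsmooth_semigroup//.
exact: explip_gsmooths.
Qed.

(** A Gaussian vector pushed forward by an affine map; [T'] is the linear part of [T]. *)
Lemma gsmooths_affine V W (T : W -> V) (T' : W -> V) (l : seq W) f z :
  (forall z x a, T (z + x *: a) = T z + x *: T' a) ->
  gsmooths l (f \o T) z = gsmooths (map T' l) f (T z).
Proof.
move=> hT; elim: l z => //= a l IH z; rewrite /gsmooth.
by apply: eq_Rintegral => x _; rewrite IH hT.
Qed.

Lemma gsmooth_quad V (a z : V) (f : V -> R) (b q : R) :
  (forall x, f (z + x *: a) = f z + b * x + q * x ^+ 2) ->
  gsmooth a f z = f z + q.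
Proof.
move=> hf; rewrite /gsmooth; under eq_Rintegral do rewrite hf.
have [M1 M2] := normal_moments R.
have i1 : gamma.-integrable setT (EFin \o (fun x : R => x)).
  apply: integrable_gamma => //; exists 1, 1 => x; rewrite !mul1r.
  by rewrite (le_trans _ (expR_ge1Dx _))// lerDr.
have i2 : gamma.-integrable setT (EFin \o (fun x : R => x ^+ 2)).
  apply: integrable_gamma => //.
  exists 2, 1 => x; rewrite !mul1r normrX.
  have := expR_ge1Dxn 1 (normr_ge0 x); rewrite (_ : (2`!)%:R = 2)// => h.
  by have := sqr_ge0 `|x|; lra.
have i0 (k : R) : gamma.-integrable setT (EFin \o (fun _ : R => k)).
  exact: finite_measure_integrable_cst.
have iz1 : gamma.-integrable setT (EFin \o (fun x : R => b * x)).
  by have := integrableZl measurableT b i1; apply: eq_integrable.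
have iz2 : gamma.-integrable setT (EFin \o (fun x : R => q * x ^+ 2)).
  by have := integrableZl measurableT q i2; apply: eq_integrable.
have ip1 : gamma.-integrable setT (EFin \o (fun x : R => f z + b * x)).
  by have := integrableD measurableT (i0 (f z)) iz1; apply: eq_integrable.
rewrite RintegralD// RintegralD// !RintegralZl// M1 M2 mulr0 addr0 mulr1.
by rewrite Rintegral_cst// [X in fine X](_ : _ = 1%E) ?mulr1//; exact: probability_setT.
Qed.

Definition quadratic_along V (f q : V -> R) :=
  forall z a, exists b, forall x, f (z + x *: a) = f z + b * x + q a * x ^+ 2.

(** First moments vanish and second moments are 1, so only the quadratic coefficients survive; their
    sum is the trace of [q] against the covariance of the list. *)
Lemma gsmooths_quad V (l : seq V) (f q : V -> R) z : quadratic_along f q ->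
  gsmooths l f z = f z + \sum_(a <- l) q a.
Proof.
move=> hf; elim: l z => [|a l IH] z; first by rewrite big_nil addr0.
rewrite /= (_ : gsmooths l f = (fun z => f z + \sum_(a <- l) q a)); last exact/funext.
have [b hb] := hf z a.
rewrite (@gsmooth_quad _ _ _ _ b (q a)); first by rewrite big_cons addrAC addrA.
by move=> x; rewrite hb; ring.
Qed.

Lemma gsmooths_expabs V (l : seq V) (c : R) : 0 <= c ->
  exists2 K : R, 0 <= K & forall z, gsmooths l (fun z => expR (c * `|z|)) z <= K * expR (c * `|z|).
Proof.
move=> c0; elim: l => [|a l [K K0 IH]]; first by exists 1 => // z; rewrite mul1r.
exists (K * gexpabs (c * `|a|)); first by rewrite mulr_ge0 ?gexpabs_ge0.
move=> z /=; have e := explip_expabs V c.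
apply: (le_trans (@gsmooth_le _ _ _ _ (fun z => K * expR (c * `|z|)) _ _ _ _)) => //.
- exact: explip_gsmooths.
- exact: explipZ.
- by rewrite gsmoothZ// -mulrA ler_wpM2l// gsmooth_expabs.
Qed.

Lemma gsmooths_norm V (l : seq V) f z : explip f ->
  `|gsmooths l f z| <= gsmooths l (fun z => `|f z|) z.
Proof.
move=> ef; rewrite ler_norml -mulN1r -gsmoothsZ; last exact: explip_abs.
have ea := explip_abs ef.
apply/andP; split; apply: gsmooths_le => //; try exact: explipZ.
  by move=> w; rewrite mulN1r lerNl (le_trans (ler_norm _))// normrN.
by move=> w; exact: ler_norm.
Qed.

End IteratedSmoothing.

(** * Gaussian interpolation *)

Section Interpolation.
Variable R : realType.
Implicit Types (V : normedModType R).

Definition linear_form V (l : V -> R) :=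
  forall x z a, l (z + x *: a) = l z + x * l a.

(** The bilinear form is left existential, as the coefficient [b]: Gaussian averaging kills the
    terms linear in x. *)
Definition quadratic_form V (q : V -> R) :=
  (forall z a, exists b, forall x, q (z + x *: a) = q z + b * x + q a * x ^+ 2) /\
  (forall x a, q (x *: a) = x ^+ 2 * q a).

Lemma linear_form0 V (l : V -> R) : linear_form l -> l 0 = 0.
Proof.
by move=> h; have := h 1 0 0; rewrite scaler0 add0r mul1r => h1; lra.
Qed.

Lemma linear_formZ V (l : V -> R) x a : linear_form l -> l (x *: a) = x * l a.
Proof. by move=> h; rewrite -[x *: a]add0r h linear_form0// add0r. Qed.

Lemma quadratic_form0 V (q : V -> R) : quadratic_form q -> q 0 = 0.
Proof. by move=> [_ h]; rewrite -(scale0r 0) h expr0n mul0r. Qed.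

(* [l] and [q / 2] are the first two Taylor terms of [exp (psi (z + .) - psi z)]. *)
Record exp_jet V (psi : V -> R) (C : R) (z : V) (l q : V -> R) : Prop := ExpJet {
  jet_linear : linear_form l;
  jet_quadratic : quadratic_form q;
  jet_explip_l : explip l;
  jet_explip_q : explip q;
  jet_bound : forall v, `|expR (psi (z + v) - psi z) - (1 + l v + q v / 2)| <=
      C * `|v| ^+ 3 * expR (C * `|v|) }.

Lemma expR_ge_cube (y : R) : 0 <= y -> y ^+ 3 <= 6 * expR y.
Proof.
move=> y0; have := expR_ge1Dxn 2 y0; rewrite (_ : (3`!)%:R = 6)// => h.
by move: (expR y) h => e h; lra.
Qed.

Section Step.
Variables (V : normedModType R) (psi : V -> R) (C : R).
Hypothesis C0 : 0 <= C.
Hypothesis lip : forall z z', `|psi z - psi z'| <= C * `|z - z'|.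
Let f z := expR (psi z).
Let ef : explip f. Proof. exact: explip_expR lip. Qed.

Let g (z : V) (r : R) v := expR (psi (z + r *: v) - psi z).

Let eg z r : explip (g z r).
Proof.
apply: (@explip_expR _ _ _ (C * `|r|)) => v v'.
rewrite opprB addrA subrK (le_trans (lip _ _))// -mulrA ler_wpM2l//.
by rewrite opprD addrACA subrr add0r -scalerBr normrZ.
Qed.

Let gsmooths_ratio (A : seq V) (s : R) z :
  gsmooths (scaled s A) f z = f z * gsmooths A (g z (Num.sqrt s)) 0.
Proof.
rewrite -gsmoothsZ//; pose T v := z + Num.sqrt s *: v.
have -> : (fun v => f z * g z (Num.sqrt s) v) = f \o T.
  by apply/funext => v; rewrite /f /g /= -expRD subrKC.
rewrite (@gsmooths_affine _ _ _ _ (fun a => Num.sqrt s *: a)).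
  by rewrite /T scaler0 addr0.
by move=> v x a; rewrite /T scalerDr addrA !scalerA mulrC.
Qed.

(** Dividing by f(z) makes the error relative, so [K] does not depend on [z]. The Taylor polynomial
    is averaged exactly; in the remainder, r^3 |v|^3 is absorbed by r^3 exp |v| up to the factor 6,
    with r = sqrt s. *)
Lemma gsmooths_expansion (A : seq V) : exists2 K : R, 0 <= K &
  forall z l q, exp_jet psi C z l q -> forall s : R, 0 < s <= 1 ->
  `|gsmooths (scaled s A) f z - f z * (1 + s / 2 * \sum_(a <- A) q a)| <=
    K * Num.sqrt s ^+ 3 * f z.
Proof.
have C1 : 0 <= C + 1 by rewrite addr_ge0.
have [K0 K00 hK0] := gsmooths_expabs A C1.
exists (6 * C * K0) => [|z l q jet s /andP[s0 s1]]; first by rewrite !mulr_ge0.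
set r : R := Num.sqrt s.
have r0 : 0 < r by rewrite sqrtr_gt0.
have r1 : r <= 1 by rewrite -sqrtr1 ler_wsqrtr.
have rs : r ^+ 2 = s by rewrite sqr_sqrtr// ltW.
rewrite gsmooths_ratio -/r -mulrBr normrM ger0_norm ?expR_ge0// mulrC ler_wpM2r ?expR_ge0//.
have [lin [qq qh] el eq hb] := jet.
pose p v := 1 + l (r *: v) + q (r *: v) / 2.
have ep : explip p.
  apply: explipD; first apply: explipD; first exact: explip_cst.
    exact: explip_scale.
  rewrite /p; under eq_fun do rewrite mulrC.
  exact/explipZ/explip_scale.
have -> : 1 + s / 2 * \sum_(a <- A) q a = gsmooths A p 0.
  rewrite (@gsmooths_quad _ _ _ _ (fun a => s / 2 * q a)); last first.
    move=> w a; have [b hb'] := qq (r *: w) (r *: a).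
    exists (r * l a + b / 2) => x; rewrite /p scalerDr.
    have -> : r *: (x *: a) = x *: (r *: a) by rewrite !scalerA mulrC.
    by rewrite hb' lin (linear_formZ r a lin) (qh r a) rs; ring.
  rewrite /p scaler0 (linear_form0 lin) (quadratic_form0 (conj qq qh)).
  by rewrite mul0r !addr0 mulr_sumr.
rewrite -gsmoothsB//.
apply: (le_trans (gsmooths_norm _ _ _)); first exact: explipB.
apply: (@le_trans _ _ (gsmooths A (fun v => 6 * C * r ^+ 3 * expR ((C + 1) * `|v|)) 0)).
  have ed := explipB (eg z r) ep.
  apply: gsmooths_le => //; first exact: explip_abs.
    exact/explipZ/explip_expabs.
  move=> v; rewrite /g /p (le_trans (hb _))// normrZ (gtr0_norm r0) exprMn.
  rewrite (mulrDl C 1) mul1r expRD.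
  have h1 : expR (C * (r * `|v|)) <= expR (C * `|v|).
    by rewrite ler_expR ler_wpM2l// ler_piMl.
  have h2 := expR_ge_cube (normr_ge0 v).
  have -> : 6 * C * r ^+ 3 * (expR (C * `|v|) * expR `|v|) =
     C * (r ^+ 3 * (6 * expR `|v|)) * expR (C * `|v|) by ring.
  rewrite ler_pM ?expR_ge0 ?mulr_ge0 ?exprn_ge0 ?(ltW r0)//.
  by rewrite ler_wpM2l// ler_wpM2l ?exprn_ge0 ?(ltW r0).
rewrite gsmoothsZ; last exact: explip_expabs.
have := hK0 0; rewrite normr0 mulr0 expR0 mulr1 => h.
have -> : 6 * C * K0 * r ^+ 3 = 6 * C * r ^+ 3 * K0 by ring.
by rewrite ler_wpM2l// !mulr_ge0 ?exprn_ge0 ?(ltW r0).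
Qed.

(** By exp u >= 1 + u, a short averaging cannot shrink f(z) by much. This turns errors relative to
    f(z) into errors relative to its average. *)
Lemma gsmooths_lower (A : seq V) : exists2 K : R, 0 <= K & forall z (s : R), 0 < s <= 1 ->
  f z * (1 - K * Num.sqrt s) <= gsmooths (scaled s A) f z.
Proof.
have [K0 K00 hK0] := gsmooths_expabs A (@ler01 R).
exists (C * K0) => [|z s /andP[s0 s1]]; first by rewrite mulr_ge0.
set r : R := Num.sqrt s; have r0 : 0 < r by rewrite sqrtr_gt0.
rewrite gsmooths_ratio -/r ler_wpM2l ?expR_ge0//.
have e1 : explip (fun v : V => C * r * expR (1 * `|v|)) by exact/explipZ/explip_expabs.
apply: (@le_trans _ _ (gsmooths A (fun v => 1 - C * r * expR (1 * `|v|)) 0)).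
  rewrite gsmoothsB//; last exact: explip_cst.
  rewrite gsmooths_cst gsmoothsZ; last exact: explip_expabs.
  have := hK0 0; rewrite normr0 mulr0 expR0 mulr1 => h.
  by rewrite lerD2l lerN2 [leRHS]mulrAC ler_wpM2l// mulr_ge0// ltW.
apply: gsmooths_le => //; first by apply: explipB => //; exact: explip_cst.
move=> v; rewrite /g; apply: le_trans (expR_ge1Dx _).
rewrite lerD2l mul1r lerNl.
have h1 : `|psi (z + r *: v) - psi z| <= C * r * `|v|.
  rewrite (le_trans (lip _ _))// addrAC subrr add0r normrZ gtr0_norm// mulrA//.
have h2 : `|v| <= expR `|v| by rewrite (le_trans _ (expR_ge1Dx _))// lerDr.
have h3 : C * r * `|v| <= C * r * expR `|v| by rewrite ler_wpM2l// mulr_ge0// ltW.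
have := ler_norm (- (psi (z + r *: v) - psi z)); rewrite normrN; lra.
Qed.

End Step.

Lemma scaled0 V (A : seq V) (f : V -> R) : gsmooths (scaled 0 A) f = f.
Proof.
elim: A => //= a A IH; rewrite -/(scaled 0 A) IH; apply/funext => z.
rewrite /gsmooth sqrtr0 scale0r; under eq_Rintegral do rewrite scaler0 addr0.
rewrite Rintegral_cst// [X in fine X](_ : _ = 1%E) ?mulr1//.
exact: probability_setT.
Qed.

Lemma scaled1 V (A : seq V) : scaled 1 A = A.
Proof. by elim: A => //= a A ->; rewrite sqrtr1 scale1r. Qed.

(** Here [j] counts the blocks already exchanged and [k] those still to exchange. Averaging is
    monotone, so the inequality for one block can be applied underneath the others. *)
Lemma swap_blocks V (A B : seq V) (f : V -> R) (s d : R) : explip f -> 0 < s -> 0 <= d ->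
  (forall z, gsmooths (scaled s A) f z <= (1 + d) * gsmooths (scaled s B) f z) ->
  forall k j z, gsmooths (scaled (s *+ k) A) (gsmooths (scaled (s *+ j) B) f) z <=
    (1 + d) ^+ k * gsmooths (scaled (s *+ (k + j)) B) f z.
Proof.
move=> ef s0 d0 h k; elim: k => [|k IH] j z.
  by rewrite mulr0n scaled0 expr0 mul1r.
have sn n : 0 <= s *+ n by rewrite mulrn_wge0// ltW.
have e1 := explip_gsmooths (scaled (s *+ j) B) ef.
rewrite mulrSr -gsmooths_semigroup//.
apply: (@le_trans _ _ (gsmooths (scaled (s *+ k) A)
    (fun z => (1 + d) * gsmooths (scaled (s *+ j.+1) B) f z) z)).
  apply: gsmooths_le; [exact: explip_gsmooths|exact/explipZ/explip_gsmooths|].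
  (* The hypothesis concerns an [A] block acting directly on [f], so that block is first commuted
     past the [j] blocks of [B]. *)
  move=> w; rewrite gsmoothsC// mulrSr -gsmooths_semigroup//.
  rewrite -gsmoothsZ; last exact: explip_gsmooths.
  apply: gsmooths_le => //; first exact: explip_gsmooths.
  exact/explipZ/explip_gsmooths.
rewrite gsmoothsZ; last exact: explip_gsmooths.
rewrite exprS -mulrA ler_wpM2l ?addr_ge0//.
by rewrite addSnnS; exact: IH.
Qed.

(* Lindeberg replacement: both Gaussian sums are split into [N] independent
   blocks of variance [1 / N], which are exchanged one at a time. *)
Theorem gaussian_interpolation V (psi : V -> R) (C kappa : R) (A B : seq V) :
  0 <= C -> 0 <= kappa ->
  (forall z z', `|psi z - psi z'| <= C * `|z - z'|) ->
  (forall z, exists l q, exp_jet psi C z l q /\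
     \sum_(a <- A) q a - \sum_(b <- B) q b <= kappa) ->
  forall z, gsmooths A (fun z => expR (psi z)) z <=
    expR (kappa / 2) * gsmooths B (fun z => expR (psi z)) z.
Proof.
move=> C0 kappa0 lip jets z; set f := fun z => _.
have ef : explip f by exact: explip_expR lip.
have [KA KA0 hA] := gsmooths_expansion C0 lip A.
have [KB KB0 hB] := gsmooths_expansion C0 lip B.
have [L L0 hL] := gsmooths_lower C0 lip B.
pose K := KA + KB.
(* The coefficient of r^3 in (1 + 2 L r)(r^2 kappa / 2 + K r^3), bounded with r <= 1. *)
pose K' := K + kappa * L + 2 * K * L.
have K0 : 0 <= K by rewrite addr_ge0.
have K'0 : 0 <= K' by rewrite !addr_ge0 ?mulr_ge0.
have step (s : R) : 0 < s <= 1 -> L * Num.sqrt s <= 2^-1 -> forall w,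
    gsmooths (scaled s A) f w <=
      (1 + (s * kappa / 2 + K' * Num.sqrt s ^+ 3)) * gsmooths (scaled s B) f w.
  move=> s01 Ls w; have [l [q [jet hk]]] := jets w.
  have := hA _ _ _ jet _ s01; have := hB _ _ _ jet _ s01; have := hL w _ s01.
  have [s0 s1] := andP s01.
  set r : R := Num.sqrt s; rewrite -/f.
  have r0 : 0 < r by rewrite sqrtr_gt0.
  have r1 : r <= 1 by rewrite -sqrtr1 ler_wsqrtr.
  have rs : r ^+ 2 = s by rewrite sqr_sqrtr// ltW.
  have f0 : 0 < expR (psi w) by exact: expR_gt0.
  move: (expR (psi w)) f0 (gsmooths (scaled s A) f w) (gsmooths (scaled s B) f w) => F F0 SA SB.
  rewrite !ler_norml => hF /andP[hB1 hB2] /andP[hA1 hA2].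
  have hk' : s / 2 * \sum_(a <- A) q a - s / 2 * \sum_(b <- B) q b <= s / 2 * kappa.
    by rewrite -mulrBr ler_wpM2l// divr_ge0// ltW.
  have hAB : SA <= SB + F * (s * kappa / 2 + K * r ^+ 3).
    have : F * (s / 2 * \sum_(a <- A) q a - s / 2 * \sum_(b <- B) q b) <=
      F * (s / 2 * kappa) by rewrite ler_pM2l.
    rewrite /K; lra.
  (* For L r <= 1/2 one has (1 - L r)(1 + 2 L r) >= 1, which inverts the lower bound on [SB]. *)
  have hF2 : F <= SB * (1 + 2 * L * r).
    have Lr0 : 0 <= L * r by rewrite mulr_ge0// ltW.
    have : F * (1 - L * r) * (1 + 2 * L * r) <= SB * (1 + 2 * L * r).
      by rewrite ler_wpM2r//; lra.
    apply: le_trans.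
    have -> : F * (1 - L * r) * (1 + 2 * L * r) =
       F + F * (L * r) * (1 - 2 * (L * r)) by ring.
    rewrite lerDl mulr_ge0//; first by rewrite mulr_ge0// ltW.
    by have Lr : L * r <= 2^-1 := Ls; lra.
  have SB0 : 0 <= SB.
    apply: le_trans hF; rewrite mulr_ge0 ?(ltW F0)//.
    by have Lr : L * r <= 2^-1 := Ls; lra.
  have k0 : 0 <= s * kappa / 2 + K * r ^+ 3.
    by rewrite addr_ge0 ?divr_ge0 ?mulr_ge0 ?exprn_ge0 ?(ltW s0) ?(ltW r0).
  apply: (le_trans hAB); rewrite [leRHS]mulrDl mul1r lerD2l.
  apply: (@le_trans _ _ (SB * (1 + 2 * L * r) * (s * kappa / 2 + K * r ^+ 3))).
    by rewrite ler_wpM2r.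
  rewrite -mulrA [leLHS]mulrC ler_wpM2r//.
  have -> : (1 + 2 * L * r) * (s * kappa / 2 + K * r ^+ 3) =
    s * kappa / 2 + (K + kappa * L + 2 * K * L * r) * r ^+ 3 by rewrite -rs; field.
  rewrite lerD2l ler_wpM2r ?exprn_ge0 ?(ltW r0)// /K' lerD2l.
  by rewrite ler_piMr ?mulr_ge0.
(* With N r^2 = 1 the N exchanges cost (1 + d)^N <= exp(N d) = exp(kappa / 2 + K' r), whose last
   term vanishes as the blocks shrink. *)
have lim (r : R) (N : nat) : 0 < r -> N%:R * r ^+ 2 = 1 -> L * r <= 2^-1 ->
    gsmooths A f z <= expR (kappa / 2 + K' * r) * gsmooths B f z.
  move=> r0 Nr Lr.
  have sr : Num.sqrt (r ^+ 2) = r by rewrite sqrtr_sqr gtr0_norm.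
  have s0 : 0 < r ^+ 2 by rewrite exprn_gt0.
  have N0 : (0 < N)%N.
    by case: N Nr => // /eqP; rewrite mul0r eq_sym oner_eq0.
  have s1 : r ^+ 2 <= 1.
    by rewrite -Nr ler_peMl ?(ltW s0)// ler1n.
  have := step (r ^+ 2); rewrite s0 s1 sr => /(_ isT Lr) hstep.
  set d := r ^+ 2 * kappa / 2 + K' * r ^+ 3 in hstep.
  have d0 : 0 <= d.
    by rewrite addr_ge0 ?divr_ge0 ?mulr_ge0 ?exprn_ge0 ?(ltW r0).
  have := swap_blocks ef s0 d0 hstep N 0 z.
  rewrite mulr0n scaled0 addn0 -[r ^+ 2 *+ N]mulr_natl Nr !scaled1.
  move=> /le_trans; apply; rewrite ler_wpM2r//.
    by rewrite -(gsmooths_cst B 0 z); apply: gsmooths_le => //;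
      [exact: explip_cst|move=> ?; exact: expR_ge0].
  have -> : kappa / 2 + K' * r = d *+ N.
    rewrite -[d *+ N]mulr_natl /d.
    have -> : N%:R * (r ^+ 2 * kappa / 2 + K' * r ^+ 3) =
      (N%:R * r ^+ 2) * (kappa / 2 + K' * r) by field.
    by rewrite Nr mul1r.
  rewrite -mulr_natl expRM_natl; apply: lerXn2r (expR_ge1Dx d).
    by rewrite nnegrE addr_ge0.
  by rewrite nnegrE expR_ge0.
set SA := gsmooths A f z in lim *; set SB := gsmooths B f z in lim *.
have SB0 : 0 <= SB.
  by rewrite -(gsmooths_cst B 0 z); apply: gsmooths_le => //;
      [exact: explip_cst|move=> ?; exact: expR_ge0].
apply/ler_addgt0Pr => /= e e0.
pose M := expR (kappa / 2 + K') * K' * SB + 1.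
have M0 : 0 < M by rewrite ltr_wpDl// !mulr_ge0// expR_ge0.
pose b := Num.min (e / M) (Num.min 1 (2 * (L + 1))^-1).
have b0 : 0 < b.
  by rewrite !lt_min divr_gt0//= ltr01/= invr_gt0 mulr_gt0// ltr_wpDl.
have [n hn] : exists n : nat, n.+1%:R^-1 < b.
  have [n _ h] := near_infty_natSinv_lt (PosNum b0).
  by exists n; apply: h => /=.
pose r : R := n.+1%:R^-1.
have r0 : 0 < r by rewrite invr_gt0.
move: hn; rewrite -/r !lt_min => /and3P[rM r1 rL].
(* Taking (n + 1)^2 blocks makes the scale r = 1 / (n + 1) an exact square root of the block
   variance. *)
have Nr : (n.+1 ^ 2)%:R * r ^+ 2 = 1.
  by rewrite natrX -exprMn divff ?expr1n// pnatr_eq0.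
have Lr : L * r <= 2^-1.
  apply: (@le_trans _ _ ((L + 1) * r)); first by rewrite ler_wpM2r ?(ltW r0)// lerDl.
  rewrite mulrC -ler_pdivlMr ?ltr_wpDl//; apply: (le_trans (ltW rL)).
  by rewrite invfM.
apply: (le_trans (lim _ _ r0 Nr Lr)).
suff : (expR (kappa / 2 + K' * r) - expR (kappa / 2)) * SB <= e by lra.
have rM' : r * M <= e by rewrite -ler_pdivlMr// ltW.
have Kr : K' * r <= K' by rewrite ler_piMr// ltW.
have h1 : expR (kappa / 2 + K' * r) - expR (kappa / 2) <= K' * r * expR (kappa / 2 + K').
  have h2 := expR_ge1Dx (- (K' * r)).
  have -> : expR (kappa / 2) = expR (kappa / 2 + K' * r) * expR (- (K' * r)).
    by rewrite -expRD addrK.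
  have h3 : expR (kappa / 2 + K' * r) <= expR (kappa / 2 + K') by rewrite ler_expR lerD2l.
  have h4 := expR_ge0 (kappa / 2 + K' * r).
  have h5 : 0 <= K' * r by rewrite mulr_ge0// ltW.
  apply: (@le_trans _ _ (K' * r * expR (kappa / 2 + K' * r))); last by rewrite ler_wpM2l.
  rewrite lerBlDr -lerBlDl; apply: le_trans (ler_wpM2l h4 h2).
  by rewrite le_eqVlt; apply/orP; left; apply/eqP; ring.
apply: (le_trans (ler_wpM2r SB0 h1)); apply: le_trans rM'.
rewrite /M mulrDr mulr1.
have -> : r * (expR (kappa / 2 + K') * K' * SB) = K' * r * expR (kappa / 2 + K') * SB by ring.
by rewrite lerDl ltW.
Qed.

End Interpolation.

(** * Second-order expansion of the logarithm of an exponential mean *)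

Section Cumulants.
Variables (R : realType) (I : finType).
Implicit Types (p x : I -> R).

(** The term 4 serves the range rho > 1. For rho <= 1 the centred variables are at most 2 rho <= 2:
    the third-order remainder gives 8 e^2, and the square of the bound 4 e^2 rho^2 on [S] gives 16
    e^4. *)
Definition cumulant_const : R := 4 + 8 * expR 2 + 16 * expR 2 ^+ 2.

Lemma ln_ge1 (S : R) : 0 <= S -> 0 <= S - ln (1 + S) <= S ^+ 2.
Proof.
move=> S0; have S1 : 0 < 1 + S by rewrite ltr_wpDr.
have h1 : ln (1 + S) <= S by rewrite -ler_expR lnK ?posrE// expR_ge1Dx.
have h2 : - ln (1 + S) <= (1 + S)^-1 - 1.
  by rewrite -lnV ?posrE// -ler_expR lnK ?posrE ?invr_gt0//;
    have := expR_ge1Dx ((1 + S)^-1 - 1); lra.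
rewrite subr_ge0 h1/=.
have : (1 + S)^-1 <= 1 - S + S ^+ 2.
  rewrite -[leLHS]mul1r ler_pdivrMr//.
  have -> : (1 - S + S ^+ 2) * (1 + S) = 1 + S ^+ 3 by ring.
  by rewrite lerDl exprn_ge0.
by lra.
Qed.

(** After centring, y = x - m, the logarithm is m + ln(1 + S) with S the mean of exp y - 1 - y. Here
    S is half the variance up to rho^3, and ln(1 + S) is S up to S^2. The bounds must hold for every
    rho, so rho > 1 is treated crudely. *)
Lemma log_mean_exp_bounds p x (rho : R) :
  (forall i, 0 <= p i) -> \sum_i p i = 1 -> (forall i, `|x i| <= rho) ->
  let A := ln (\sum_i p i * expR (x i)) in
  let m := \sum_i p i * x i in
  [/\ `|A| <= rho, `|A - m| <= cumulant_const * rho ^+ 2 &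
      `|A - m - (\sum_i p i * x i ^+ 2 - m ^+ 2) / 2| <= cumulant_const * rho ^+ 3].
Proof.
move=> p0 p1 xr A m.
have rho0 : 0 <= rho.
  have [i _|I0] := pickP (@predT I); first exact: le_trans (normr_ge0 _) (xr i).
  by move: p1; rewrite big_pred0// => /eqP; rewrite eq_sym oner_eq0.
have mean_le f (c : R) : (forall i, f i <= c) -> \sum_i p i * f i <= c.
  move=> fc; rewrite -[c]mul1r -p1 mulr_suml; apply: ler_sum => i _.
  exact: ler_wpM2l.
have mean_ge f (c : R) : (forall i, c <= f i) -> c <= \sum_i p i * f i.
  move=> fc; rewrite -[c]mul1r -p1 mulr_suml; apply: ler_sum => i _.
  exact: ler_wpM2l.
have mean_abs f (c : R) : (forall i, `|f i| <= c) -> `|\sum_i p i * f i| <= c.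
  move=> fc; rewrite ler_norml mean_le ?mean_ge// => i.
    by move: (fc i); rewrite ler_norml => /andP[].
  by move: (fc i); rewrite ler_norml => /andP[].
have hm : `|m| <= rho by exact: mean_abs.
have E_ge : expR (- rho) <= \sum_i p i * expR (x i).
  by apply: mean_ge => i; rewrite ler_expR; have := xr i; rewrite ler_norml => /andP[].
have E_le : \sum_i p i * expR (x i) <= expR rho.
  by apply: mean_le => i; rewrite ler_expR; have := xr i; rewrite ler_norml => /andP[].
have E0 : 0 < \sum_i p i * expR (x i) by apply: lt_le_trans E_ge; exact: expR_gt0.
have hA : `|A| <= rho.
  by rewrite ler_norml -ler_expR -[X in _ && X]ler_expR lnK ?posrE// E_ge E_le.
set v := \sum_i p i * x i ^+ 2 - m ^+ 2.
pose y i := x i - m.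
have yr i : `|y i| <= 2 * rho.
  by rewrite /y (le_trans (ler_normB _ _))//; have := xr i; lra.
have sum_y : \sum_i p i * y i = 0.
  rewrite /y; under eq_bigr do rewrite mulrBr.
  by rewrite sumrB -mulr_suml p1 mul1r subrr.
have vE : v = \sum_i p i * y i ^+ 2.
  have -> : \sum_i p i * y i ^+ 2 =
     \sum_i (p i * x i ^+ 2 - 2 * m * (p i * x i) + m ^+ 2 * p i).
    by apply: eq_bigr => i _; rewrite /y; ring.
  rewrite big_split/= sumrB -!mulr_sumr p1 -/m /v; ring.
have v0 : 0 <= v.
  by rewrite vE; apply: sumr_ge0 => i _; rewrite mulr_ge0// sqr_ge0.
have vle : v <= (2 * rho) ^+ 2.
  rewrite vE; apply: mean_le => i; rewrite -[y i ^+ 2]real_normK ?num_real//.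
  by rewrite lerXn2r ?nnegrE ?mulr_ge0// yr.
have K4 : 4 <= cumulant_const.
  by rewrite /cumulant_const; have := expR_ge0 (2:R); have := sqr_ge0 (expR (2:R)); lra.
have [rho1|rho1] := leP rho 1; last first.
  have h1 : rho <= rho ^+ 2 by rewrite expr2 ler_peMl// ltW.
  have h2 : rho ^+ 2 <= rho ^+ 3 by rewrite [leRHS]exprS ler_peMl ?sqr_ge0// ltW.
  have hAm : `|A - m| <= 2 * rho by rewrite (le_trans (ler_normB _ _))//; lra.
  split => //.
    by apply: (le_trans hAm); have := ler_wpM2r (sqr_ge0 rho) K4; lra.
  rewrite (le_trans (ler_normB _ _))//.
  rewrite (ger0_norm (_ : 0 <= v / 2)) ?divr_ge0//.
  have : 4 * rho ^+ 3 <= cumulant_const * rho ^+ 3.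
    by rewrite ler_wpM2r// exprn_ge0.
  by move: vle; rewrite exprMn; lra.
pose S := \sum_i p i * (expR (y i) - 1 - y i).
have AS : A = m + ln (1 + S).
  have -> : 1 + S = \sum_i p i * expR (y i).
    have -> : S = \sum_i p i * expR (y i) - \sum_i p i - \sum_i p i * y i.
      by rewrite /S -!sumrB; apply: eq_bigr => i _; ring.
    by rewrite p1 sum_y subr0 subrKC.
  rewrite -[m in RHS]expRK -lnM ?posrE ?expR_gt0//; last first.
    suff -> : \sum_i p i * expR (y i) = expR (- m) * \sum_i p i * expR (x i).
      by rewrite mulr_gt0// expR_gt0.
    by rewrite mulr_sumr; apply: eq_bigr => i _; rewrite /y addrC expRD; ring.
  rewrite mulr_sumr; congr ln; apply: eq_bigr => i _.
  by rewrite mulrCA -expRD /y subrKC.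
set E := expR (2:R).
have eyr i : expR `|y i| <= E.
  by rewrite ler_expR (le_trans (yr i))//; lra.
have S0 : 0 <= S.
  apply: sumr_ge0 => i _; rewrite mulr_ge0// -addrA -opprD subr_ge0.
  exact: expR_ge1Dx.
have E00 : 0 <= E by exact: expR_ge0.
have hS : S <= 4 * E * rho ^+ 2.
  apply: mean_le => i; have := expR_taylor2 (y i).
  rewrite opprD addrA => /(le_trans (ler_norm _)) /le_trans; apply.
  have -> : 4 * E * rho ^+ 2 = (2 * rho) ^+ 2 * E by ring.
  by rewrite ler_pM ?exprn_ge0 ?expR_ge0// lerXn2r ?nnegrE ?mulr_ge0.
have hSv : `|S - v / 2| <= 8 * E * rho ^+ 3.
  have -> : S - v / 2 = \sum_i p i * (expR (y i) - (1 + y i + y i ^+ 2 / 2)).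
    rewrite vE /S mulr_suml -sumrB; apply: eq_bigr => i _; ring.
  apply: mean_abs => i; apply: (le_trans (expR_taylor3 _)).
  have -> : 8 * E * rho ^+ 3 = (2 * rho) ^+ 3 * E by ring.
  by rewrite ler_pM ?exprn_ge0 ?expR_ge0// lerXn2r ?nnegrE ?mulr_ge0.
have /andP[l1 l2] := ln_ge1 S0.
have ln0 : 0 <= ln (1 + S) by apply: ln_ge0; rewrite lerDl.
have r2 := sqr_ge0 rho.
have Er2 : 0 <= E * rho ^+ 2 by rewrite mulr_ge0.
have EEr2 : 0 <= E ^+ 2 * rho ^+ 2 by rewrite mulr_ge0// sqr_ge0.
have AmE : A - m = ln (1 + S) by rewrite AS addrAC subrr add0r.
rewrite AmE; split => //.
  rewrite ger0_norm//.
  by rewrite /cumulant_const -/E; lra.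
have hS2 : S ^+ 2 <= 16 * E ^+ 2 * rho ^+ 3.
  apply: (@le_trans _ _ ((4 * E * rho ^+ 2) ^+ 2)).
    by rewrite lerXn2r ?nnegrE ?mulr_ge0.
  have -> : (4 * E * rho ^+ 2) ^+ 2 = 16 * E ^+ 2 * rho ^+ 3 * rho by ring.
  by rewrite ler_piMr ?mulr_ge0 ?exprn_ge0.
have -> : ln (1 + S) - v / 2 = (S - v / 2) - (S - ln (1 + S)) by ring.
rewrite (le_trans (ler_normB _ _))// (ger0_norm l1).
have r3 : 0 <= rho ^+ 3 by rewrite exprn_ge0.
by rewrite /cumulant_const -/E; lra.
Qed.

End Cumulants.

(** * Second-order jets and their behaviour under log-sum-exp *)

Section Jets.
Variable R : realType.
Implicit Types (V : normedModType R).

Lemma linear_form_explip V (l : V -> R) (C : R) : linear_form l ->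
  (forall v, `|l v| <= C * `|v|) -> explip l.
Proof.
move=> hl hC; apply: (@lip_explip _ _ _ C) => z z'.
by apply: le_trans (hC _); rewrite -[- z']scaleN1r hl mulN1r.
Qed.

Lemma quadratic_form_sqr V (l : V -> R) : linear_form l -> quadratic_form (fun v => l v ^+ 2).
Proof.
move=> hl; split => [z a|x a]; last by rewrite (linear_formZ _ _ hl) exprMn.
by exists (2 * l z * l a) => x; rewrite hl; ring.
Qed.

Lemma quadratic_formD V (q r : V -> R) : quadratic_form q -> quadratic_form r ->
  quadratic_form (fun v => q v + r v).
Proof.
move=> [q1 q2] [r1 r2]; split => [z a|x a]; last by rewrite q2 r2 mulrDr.
have [b hb] := q1 z a; have [c hc] := r1 z a.
by exists (b + c) => x; rewrite hb hc; ring.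
Qed.

Lemma quadratic_formZ V (k : R) (q : V -> R) : quadratic_form q ->
  quadratic_form (fun v => k * q v).
Proof.
move=> [q1 q2]; split => [z a|x a]; last by rewrite q2 mulrCA.
have [b hb] := q1 z a.
by exists (k * b) => x; rewrite hb; ring.
Qed.

Lemma quadratic_form_cst0 V : quadratic_form (fun _ : V => 0 : R).
Proof. by split => [z a|x a]; [exists 0 => x|]; ring. Qed.

Lemma quadratic_form_sum V (I : Type) (r : seq I) (q : I -> V -> R) :
  (forall i, quadratic_form (q i)) -> quadratic_form (fun v => \sum_(i <- r) q i v).
Proof.
move=> h; elim: r => [|i r IH].
  by under eq_fun do rewrite big_nil; exact: quadratic_form_cst0.
by under eq_fun do rewrite big_cons; exact: quadratic_formD.
Qed.

Lemma linear_formD V (k l : V -> R) : linear_form k -> linear_form l ->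
  linear_form (fun v => k v + l v).
Proof. by move=> hk hl x z a; rewrite hk hl; ring. Qed.

Lemma linear_form_scale V (k : R) (l : V -> R) : linear_form l ->
  linear_form (fun v => k * l v).
Proof. by move=> hl x z a; rewrite hl; ring. Qed.

Lemma linear_form_sum V (I : Type) (r : seq I) (l : I -> V -> R) :
  (forall i, linear_form (l i)) -> linear_form (fun v => \sum_(i <- r) l i v).
Proof.
move=> h; elim: r => [|i r IH].
  by under eq_fun do rewrite big_nil; move=> x z a; rewrite mulr0 addr0.
by under eq_fun do rewrite big_cons; exact: linear_formD.
Qed.

(* Second-order Taylor expansion of [psi] at [z] with differential [l] and
   Hessian [b]; the bounds are required for all [v], not only small ones. *)
Record jet2 V (psi : V -> R) (C : R) (z : V) (l b : V -> R) : Prop := Jet2 {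
  jet2_lin : linear_form l;
  jet2_quad : quadratic_form b;
  jet2_explip : explip b;
  jet2_bound_l : forall v, `|l v| <= C * `|v|;
  jet2_bound0 : forall v, `|psi (z + v) - psi z| <= C * `|v|;
  jet2_bound1 : forall v, `|psi (z + v) - psi z - l v| <= C * `|v| ^+ 2;
  jet2_bound2 : forall v, `|psi (z + v) - psi z - l v - b v / 2| <= C * `|v| ^+ 3 }.

(** The second derivative of exp psi, divided by exp psi, is the Hessian of psi plus the square of
    its differential. *)
Lemma jet2_exp_jet V (psi : V -> R) (C : R) (z : V) (l b : V -> R) :
  0 <= C -> jet2 psi C z l b ->
  exp_jet psi (C + C ^+ 2 + C ^+ 3) z l (fun v => l v ^+ 2 + b v).
Proof.
move=> C0 [lin quad eb hl h0 h1 h2].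
have el := linear_form_explip lin hl.
split => //.
- by apply: quadratic_formD => //; exact: quadratic_form_sqr.
- by apply: explipD => //; rewrite /= ; under eq_fun do rewrite expr2; exact: explipM.
move=> v; set w := psi (z + v) - psi z.
have v0 := normr_ge0 v.
set y := `|v| in v0 *; set e := expR (C * y).
have e1 : 1 <= e by rewrite -expR0 ler_expR mulr_ge0.
have hw := h0 v; have hw1 := h1 v; have hw2 := h2 v; have hlv := hl v.
rewrite -/w -/y in hw hw1 hw2 hlv.
have t3 : `|expR w - (1 + w + w ^+ 2 / 2)| <= C ^+ 3 * y ^+ 3 * e.
  rewrite (le_trans (expR_taylor3 _))// -exprMn ler_pM ?exprn_ge0 ?expR_ge0//.
    by rewrite lerXn2r ?nnegrE ?mulr_ge0.
  by rewrite ler_expR.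
have t2 : `|w ^+ 2 - l v ^+ 2| <= 2 * C ^+ 2 * y ^+ 3.
  rewrite subr_sqr normrM.
  have -> : 2 * C ^+ 2 * y ^+ 3 = (C * y ^+ 2) * (2 * (C * y)) by ring.
  by rewrite ler_pM// (le_trans (ler_normD _ _))//; lra.
have -> : expR w - (1 + l v + (l v ^+ 2 + b v) / 2) =
  (expR w - (1 + w + w ^+ 2 / 2)) + (w - l v - b v / 2) + (w ^+ 2 - l v ^+ 2) / 2 by field.
have y3 : 0 <= y ^+ 3 by rewrite exprn_ge0.
apply: (@le_trans _ _ ((C + C ^+ 2 + C ^+ 3) * y ^+ 3 * e)); last first.
  rewrite ler_wpM2l ?mulr_ge0 ?addr_ge0 ?exprn_ge0// ler_expR ler_wpM2r//.
  by rewrite -addrA lerDl addr_ge0 ?exprn_ge0.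
rewrite (le_trans (ler_normD _ _))//.
have := ler_normD (expR w - (1 + w + w ^+ 2 / 2)) (w - l v - b v / 2).
rewrite [X in _ + X <= _]normrM (ger0_norm (_ : 0 <= 2^-1)) ?invr_ge0// => hh.
have q1 : C * y ^+ 3 <= C * y ^+ 3 * e by rewrite ler_peMr// mulr_ge0.
have q2 : C ^+ 2 * y ^+ 3 <= C ^+ 2 * y ^+ 3 * e.
  by rewrite ler_peMr// mulr_ge0// exprn_ge0.
by rewrite !mulrDl; lra.
Qed.

Lemma jet2_linear V (l : V -> R) (C : R) z : 0 <= C -> linear_form l ->
  (forall v, `|l v| <= C * `|v|) -> jet2 l C z l (fun=> 0).
Proof.
move=> C0 hl hC.
have inc v : l (z + v) - l z = l v by rewrite -{1}[v]scale1r hl mul1r addrAC subrr add0r.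
split=> //.
- exact: quadratic_form_cst0.
- exact: explip_cst.
- by move=> v; rewrite inc.
- by move=> v; rewrite inc subrr normr0 mulr_ge0// exprn_ge0.
- by move=> v; rewrite inc subrr mul0r subrr normr0 mulr_ge0// exprn_ge0.
Qed.

Lemma jet2_scale V (psi : V -> R) (C k : R) z l b : jet2 psi C z l b ->
  jet2 (fun z => k * psi z) (`|k| * C) z (fun v => k * l v) (fun v => k * b v).
Proof.
move=> [lin quad eb hl h0 h1 h2]; split.
- exact: linear_form_scale.
- exact: quadratic_formZ.
- exact: explipZ.
- by move=> v; rewrite normrM -mulrA ler_wpM2l.
- by move=> v; rewrite -mulrBr normrM -mulrA ler_wpM2l.
- by move=> v; rewrite -!mulrBr normrM -mulrA ler_wpM2l.
- by move=> v; rewrite -!mulrA -!mulrBr normrM ler_wpM2l.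
Qed.

Definition lse (I : finType) (x : I -> R) : R := ln (\sum_i expR (x i)).
Definition softmax (I : finType) (x : I -> R) (i : I) : R :=
  expR (x i) / \sum_j expR (x j).

Lemma norm_combine (a t u w : R) :
  `|a + t + (u - w) / 2| <= `|a| + `|t| + (`|u| + `|w|) / 2.
Proof.
rewrite (le_trans (ler_normD _ _))// lerD ?ler_normD//.
by rewrite normrM (ger0_norm (_ : 0 <= 2^-1)) ?invr_ge0// ler_wpM2r ?invr_ge0// ler_normB.
Qed.

Lemma lse_const_bounds (K C : R) : 0 <= K -> 0 <= C ->
  [/\ C <= (K + 4) * (C + C ^+ 2 + C ^+ 3),
      K * C ^+ 2 + C <= (K + 4) * (C + C ^+ 2 + C ^+ 3) &
      K * C ^+ 3 + C + 2 * C ^+ 2 <= (K + 4) * (C + C ^+ 2 + C ^+ 3)].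
Proof.
move=> K0 C0.
have C2 : 0 <= C ^+ 2 by rewrite exprn_ge0.
have C3 : 0 <= C ^+ 3 by rewrite exprn_ge0.
have KC := mulr_ge0 K0 C0; have KC2 := mulr_ge0 K0 C2; have KC3 := mulr_ge0 K0 C3.
by split; lra.
Qed.

Section LSE.
Variables (I : finType) (i0 : I).
Implicit Types x : I -> R.

Lemma sum_expR_gt0 x : 0 < \sum_i expR (x i).
Proof.
rewrite (bigD1 i0)//= ltr_wpDr ?expR_gt0//.
by apply: sumr_ge0 => i _; exact: expR_ge0.
Qed.

Lemma softmax_ge0 x i : 0 <= softmax x i.
Proof. by rewrite divr_ge0 ?expR_ge0// ltW// sum_expR_gt0. Qed.

Lemma softmax_sum x : \sum_i softmax x i = 1.
Proof. by rewrite -mulr_suml divff// gt_eqF// sum_expR_gt0. Qed.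

(** Increments of log-sum-exp are logarithms of exponential means under the softmax weights, so the
    cumulant bounds apply to them. *)
Lemma lse_diff x w : lse (fun i => x i + w i) - lse x = ln (\sum_i softmax x i * expR (w i)).
Proof.
have x0 := sum_expR_gt0 x; have xw0 := sum_expR_gt0 (fun i => x i + w i).
rewrite /lse -ln_div ?posrE//; congr ln.
by rewrite mulr_suml; apply: eq_bigr => i _; rewrite expRD /softmax mulrAC.
Qed.

Lemma lse_ge x i : x i <= lse x.
Proof.
rewrite -ler_expR lnK ?posrE ?sum_expR_gt0// (bigD1 i)//= lerDl.
by apply: sumr_ge0 => j _; exact: expR_ge0.
Qed.

Lemma lse_le x (c : R) : (forall i, x i <= c) -> lse x <= c + ln #|I|%:R.
Proof.
move=> xc; have I0 : (0 < #|I|)%N by apply/card_gt0P; exists i0.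
have n0 : 0 < #|I|%:R :> R by rewrite ltr0n.
rewrite -ler_expR lnK ?posrE ?sum_expR_gt0// expRD lnK ?posrE//.
rewrite mulr_natr -sumr_const; apply: ler_sum => i _; by rewrite ler_expR.
Qed.

Variables (V : normedModType R) (phi : I -> V -> R) (C : R) (z : V) (l b : I -> V -> R).
Hypothesis C0 : 0 <= C.
Hypothesis jets : forall i, jet2 (phi i) C z (l i) (b i).
Let pi_ := softmax (phi^~ z).

(** The differential is the softmax mean of the differentials; the Hessian is the softmax mean of
    the Hessians plus the softmax variance of the differentials. *)
Lemma jet2_lse :
  jet2 (fun z => lse (phi^~ z)) ((cumulant_const R + 4) * (C + C ^+ 2 + C ^+ 3)) z
    (fun v => \sum_i pi_ i * l i v)
    (fun v => \sum_i pi_ i * (b i v + l i v ^+ 2) - (\sum_i pi_ i * l i v) ^+ 2).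
Proof.
have p0 i : 0 <= pi_ i by exact: softmax_ge0.
have p1 : \sum_i pi_ i = 1 by exact: softmax_sum.
have bnd v := log_mean_exp_bounds p0 p1
  (fun i => jet2_bound0 (jets i) v).
have K0 : 0 <= cumulant_const R.
  by rewrite /cumulant_const !addr_ge0 ?mulr_ge0 ?expR_ge0 ?sqr_ge0.
move: (cumulant_const R) K0 bnd => K K0 bnd.
have mean_abs f (c : R) : (forall i, `|f i| <= c) -> `|\sum_i pi_ i * f i| <= c.
  move=> fc; rewrite (le_trans (ler_norm_sum _ _ _))// -[c]mul1r -p1 mulr_suml.
  by apply: ler_sum => i _; rewrite normrM ger0_norm// ler_wpM2l.
have linl : linear_form (fun v => \sum_i pi_ i * l i v).
  by apply: linear_form_sum => i; apply: linear_form_scale; have [] := jets i.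
have hl v : `|\sum_i pi_ i * l i v| <= C * `|v|.
  by apply: mean_abs => i; have [] := jets i.
have C2 : 0 <= C ^+ 2 by rewrite exprn_ge0.
have C3 : 0 <= C ^+ 3 by rewrite exprn_ge0.
have [DC DC2 DC3] := lse_const_bounds K0 C0.
set D := (K + 4) * _ in DC DC2 DC3 *.
have explip_l i : explip (l i).
  by have [lin _ _ h _ _ _] := jets i; exact: linear_form_explip lin h.
have inc v : lse (phi^~ (z + v)) - lse (phi^~ z) =
    ln (\sum_i pi_ i * expR (phi i (z + v) - phi i z)).
  rewrite -lse_diff; congr (lse _ - _).
  by apply/funext => i; rewrite subrKC.
split=> //.
- have -> : (fun v => \sum_i pi_ i * (b i v + l i v ^+ 2) - (\sum_i pi_ i * l i v) ^+ 2) =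
    (fun v => \sum_i pi_ i * (b i v + l i v ^+ 2) + -1 * (\sum_i pi_ i * l i v) ^+ 2).
    by apply/funext => v; rewrite mulN1r.
  apply: quadratic_formD.
    apply: quadratic_form_sum => i; apply: quadratic_formZ.
    have [lin quad _ _ _ _ _] := jets i.
    by apply: quadratic_formD => //; exact: quadratic_form_sqr.
  by apply: quadratic_formZ; exact: quadratic_form_sqr.
- apply: explipB.
    apply: explip_sum => i; apply: explipZ; apply: explipD.
      by have [] := jets i.
    by under eq_fun do rewrite expr2; exact: explipM.
  have e := linear_form_explip linl hl.
  by under eq_fun do rewrite expr2; exact: explipM.
- by move=> v; rewrite (le_trans (hl v))// ler_wpM2r.
- move=> v; rewrite inc; have [+ _ _] := bnd v; move=> /le_trans; apply.
  by rewrite ler_wpM2r.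
- move=> v; rewrite inc; have [_ + _] := bnd v => h.
  set A := ln _ in h *; set W := \sum_i pi_ i * (phi i (z + v) - phi i z) in h.
  have -> : A - \sum_i pi_ i * l i v = (A - W) +
     \sum_i pi_ i * (phi i (z + v) - phi i z - l i v).
    have -> : \sum_i pi_ i * (phi i (z + v) - phi i z - l i v) = W - \sum_i pi_ i * l i v.
      by rewrite /W -sumrB; apply: eq_bigr => i _; ring.
    by ring.
  rewrite (le_trans (ler_normD _ _))//.
  have h2 : `|\sum_i pi_ i * (phi i (z + v) - phi i z - l i v)| <= C * `|v| ^+ 2.
    by apply: mean_abs => i; exact: jet2_bound1 (jets i) v.
  have := ler_wpM2r (sqr_ge0 `|v|) DC2.
  by rewrite exprMn in h; rewrite mulrDl; lra.
- move=> v; rewrite inc; have [_ _ +] := bnd v => h.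
  set w := fun i => phi i (z + v) - phi i z.
  rewrite -/(w _) in h *.
  set A := ln _ in h *; set W := \sum_i pi_ i * (phi i (z + v) - phi i z) in h.
  set L := \sum_i pi_ i * l i v.
  (* [T1] is the error of replacing the increments by Taylor polynomials in the mean; [T2] and the
     difference of W^2 and L^2 are the errors of replacing them by differentials in the variance. *)
  pose T1 := \sum_i pi_ i * (w i - l i v - b i v / 2).
  pose T2 := \sum_i pi_ i * (w i ^+ 2 - l i v ^+ 2).
  have WE : W = T1 + L + (\sum_i pi_ i * b i v) / 2.
    rewrite /T1 /L mulr_suml -!big_split/=.
    by apply: eq_bigr => i _; rewrite /w; ring.
  have y0 := normr_ge0 v; set y := `|v| in y0 h *.
  have hw i : `|w i| <= C * y by exact: jet2_bound0 (jets i) v.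
  have hT1 : `|T1| <= C * y ^+ 3.
    by apply: mean_abs => i; exact: jet2_bound2 (jets i) v.
  have hT2 : `|T2| <= 2 * C ^+ 2 * y ^+ 3.
    apply: mean_abs => i; rewrite subr_sqr normrM.
    have -> : 2 * C ^+ 2 * y ^+ 3 = (C * y ^+ 2) * (2 * (C * y)) by ring.
    rewrite ler_pM//; first exact: jet2_bound1 (jets i) v.
    have := jet2_bound_l (jets i) v; rewrite -/y.
    by have := hw i; have := ler_normD (w i) (l i v); lra.
  have hT3 : `|W ^+ 2 - L ^+ 2| <= 2 * C ^+ 2 * y ^+ 3.
    rewrite subr_sqr normrM.
    have -> : 2 * C ^+ 2 * y ^+ 3 = (C * y ^+ 2) * (2 * (C * y)) by ring.
    rewrite ler_pM//.
      rewrite /W /L -sumrB; under eq_bigr do rewrite -mulrBr.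
      by apply: mean_abs => i; exact: jet2_bound1 (jets i) v.
    have hW : `|W| <= C * y by exact: mean_abs.
    by have := hl v; rewrite -/L -/y; have := ler_normD W L; lra.
  have -> : A - L - (\sum_i pi_ i * (b i v + l i v ^+ 2) - L ^+ 2) / 2 =
     (A - W - (\sum_i pi_ i * w i ^+ 2 - W ^+ 2) / 2) + T1 + (T2 - (W ^+ 2 - L ^+ 2)) / 2.
    have -> : T2 = \sum_i pi_ i * w i ^+ 2 - \sum_i pi_ i * l i v ^+ 2.
      by rewrite /T2 -sumrB; apply: eq_bigr => i _; ring.
    have -> : \sum_i pi_ i * (b i v + l i v ^+ 2) =
        \sum_i pi_ i * b i v + \sum_i pi_ i * l i v ^+ 2.
      by rewrite -big_split; apply: eq_bigr => i _ /=; ring.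
    by rewrite {1}(_ : L = W - T1 - (\sum_i pi_ i * b i v) / 2) ?WE; field.
  apply: (le_trans (norm_combine _ _ _ _)).
  have y3 : 0 <= y ^+ 3 by rewrite exprn_ge0.
  have n4 := ler_wpM2r y3 DC3.
  rewrite !mulrDl in n4; rewrite exprMn mulrA in h.
  by move: h hT1 hT2 hT3 n4; rewrite -/(w _); lra.
Qed.

End LSE.

End Jets.

(** * Comparison and concentration for functions with jets *)

Section JetInterpolation.
Variable R : realType.
Implicit Types (V W : normedModType R).

Lemma jet2_lip V (psi : V -> R) (C : R) (l b : V -> V -> R) :
  (forall z, jet2 psi C z (l z) (b z)) ->
  forall z z', `|psi z - psi z'| <= C * `|z - z'|.
Proof.
by move=> jets z z'; have := jet2_bound0 (jets z') (z - z'); rewrite subrKC.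
Qed.

Lemma gaussian_comparison V (psi : V -> R) (C kappa : R) (l b : V -> V -> R)
    (A B : seq V) : 0 <= C -> 0 <= kappa ->
  (forall z, jet2 psi C z (l z) (b z)) ->
  (forall z, \sum_(a <- A) (l z a ^+ 2 + b z a) -
             \sum_(a <- B) (l z a ^+ 2 + b z a) <= kappa) ->
  gsmooths A (fun z => expR (psi z)) 0 <=
    expR (kappa / 2) * gsmooths B (fun z => expR (psi z)) 0.
Proof.
move=> C0 kappa0 jets hk; have lip := jet2_lip jets.
apply: (@gaussian_interpolation _ _ _ (C + C ^+ 2 + C ^+ 3)) => //.
- by rewrite !addr_ge0// exprn_ge0.
- move=> z z'; rewrite (le_trans (lip _ _))// ler_wpM2r//.
  by rewrite -addrA lerDl addr_ge0// exprn_ge0.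
- move=> z; exists (l z), (fun v => l z v ^+ 2 + b z v); split => //.
  exact: jet2_exp_jet.
Qed.

Lemma quadratic_form_comp V W (q : V -> R) (T : W -> V) :
  (forall z x a, T (z + x *: a) = T z + x *: T a) -> T 0 = 0 ->
  quadratic_form q -> quadratic_form (q \o T).
Proof.
move=> hT T0 [q1 q2]; split => [z a|x a] /=.
  by have [c hc] := q1 (T z) (T a); exists c => x; rewrite hT hc.
by rewrite -[x *: a]add0r hT T0 add0r q2.
Qed.

Lemma jet2_doubling V (psi : V -> R) (C : R) (l b : V -> V -> R) (z : V * V) :
  0 <= C -> (forall z, jet2 psi C z (l z) (b z)) ->
  jet2 (fun z : V * V => psi z.1 - psi z.2) (C + C) z
    (fun v => l z.1 v.1 - l z.2 v.2) (fun v => b z.1 v.1 - b z.2 v.2).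
Proof.
move=> C0 jets.
have [lin1 quad1 e1 hl1 h10 h11 h12] := jets z.1.
have [lin2 quad2 e2 hl2 h20 h21 h22] := jets z.2.
have n1 (v : V * V) : `|v.1| <= `|v| by rewrite [leRHS]prod_normE le_max lexx.
have n2 (v : V * V) : `|v.2| <= `|v| by rewrite [leRHS]prod_normE le_max lexx orbT.
have fst_lin (w : V * V) x a : (w + x *: a).1 = w.1 + x *: a.1 by [].
have snd_lin (w : V * V) x a : (w + x *: a).2 = w.2 + x *: a.2 by [].
have up n (u : V) (v : V * V) : `|u| <= `|v| -> C * `|u| ^+ n <= C * `|v| ^+ n.
  by move=> uv; rewrite ler_wpM2l// lerXn2r ?nnegrE.
split.
- by move=> x w a /=; rewrite lin1 lin2; ring.
- have -> : (fun v : V * V => b z.1 v.1 - b z.2 v.2) =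
    (fun v => (b z.1 \o fst) v + -1 * (b z.2 \o snd) v).
    by apply/funext => v /=; rewrite mulN1r.
  apply: quadratic_formD; last apply: quadratic_formZ; exact: quadratic_form_comp.
- apply: explipB.
    apply: (@explip_comp _ _ _ _ fst 1) => // w w'; rewrite mul1r.
    exact: (n1 (w - w')).
  apply: (@explip_comp _ _ _ _ snd 1) => // w w'; rewrite mul1r.
  exact: (n2 (w - w')).
- move=> v /=; rewrite (le_trans (ler_normB _ _))// mulrDl.
  by have := up 1%N _ _ (n1 v); have := up 1%N _ _ (n2 v); rewrite !expr1 => ? ?;
    rewrite lerD// (le_trans (hl1 _), le_trans (hl2 _)).
- move=> v /=; have -> : psi (z.1 + v.1) - psi (z.2 + v.2) - (psi z.1 - psi z.2) =
     (psi (z.1 + v.1) - psi z.1) - (psi (z.2 + v.2) - psi z.2) by ring.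
  rewrite (le_trans (ler_normB _ _))// mulrDl.
  by have := up 1%N _ _ (n1 v); have := up 1%N _ _ (n2 v); rewrite !expr1 => ? ?;
    rewrite lerD// (le_trans (h10 _), le_trans (h20 _)).
- move=> v /=; have -> : psi (z.1 + v.1) - psi (z.2 + v.2) - (psi z.1 - psi z.2) -
       (l z.1 v.1 - l z.2 v.2) =
     (psi (z.1 + v.1) - psi z.1 - l z.1 v.1) - (psi (z.2 + v.2) - psi z.2 - l z.2 v.2)
    by ring.
  rewrite (le_trans (ler_normB _ _))// mulrDl.
  by have := up 2 _ _ (n1 v); have := up 2 _ _ (n2 v) => ? ?;
    rewrite lerD// (le_trans (h11 _), le_trans (h21 _)).
- move=> v /=; have -> : psi (z.1 + v.1) - psi (z.2 + v.2) - (psi z.1 - psi z.2) -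
       (l z.1 v.1 - l z.2 v.2) - (b z.1 v.1 - b z.2 v.2) / 2 =
     (psi (z.1 + v.1) - psi z.1 - l z.1 v.1 - b z.1 v.1 / 2) -
     (psi (z.2 + v.2) - psi z.2 - l z.2 v.2 - b z.2 v.2 / 2) by field.
  rewrite (le_trans (ler_normB _ _))// mulrDl.
  by have := up 3 _ _ (n1 v); have := up 3 _ _ (n2 v) => ? ?;
    rewrite lerD// (le_trans (h12 _), le_trans (h22 _)).
Qed.

(* Comparison of the independent pair [(X, X')] with the diagonal pair [(X, X)]. *)
Theorem gaussian_exp_concentration V (psi : V -> R) (C kappa : R) (l b : V -> V -> R)
    (A : seq V) : 0 <= C -> 0 <= kappa ->
  (forall z, jet2 psi C z (l z) (b z)) ->
  (forall z z', \sum_(a <- A) l z a * l z' a <= kappa) ->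
  gsmooths A (fun z => expR (psi z)) 0 * gsmooths A (fun z => expR (- psi z)) 0 <=
    expR kappa.
Proof.
move=> C0 kappa0 jets hk; have lip := jet2_lip jets.
have e1 : explip (fun z => expR (psi z)) by exact: explip_expR lip.
have e2 : explip (fun z => expR (- psi z)).
  by apply: (@explip_expR _ _ _ C) => z z'; rewrite -opprD normrN.
pose XX := [seq (a, 0 : V) | a <- A] ++ [seq (0 : V, a) | a <- A].
pose YY := [seq (a, a) | a <- A].
pose Psi (z : V * V) := psi z.1 - psi z.2.
have := @gaussian_comparison _ Psi (C + C) (2 * kappa)
  (fun z v => l z.1 v.1 - l z.2 v.2) (fun z v => b z.1 v.1 - b z.2 v.2) XX YY.
have -> : 2 * kappa / 2 = kappa by field.
have -> : gsmooths YY (fun z => expR (Psi z)) 0 = 1.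
  have := @gsmooths_affine _ _ _ (fun v : V => (v, v)) (fun v : V => (v, v)) A
     (fun z => expR (Psi z)) 0 (fun z x a => erefl).
  rewrite -/YY => <-.
  rewrite (_ : _ \o _ = (fun=> 1)); first exact: gsmooths_cst.
  by apply/funext => v; rewrite /Psi /= subrr expR0.
have -> : gsmooths XX (fun z => expR (Psi z)) 0 =
    gsmooths A (fun z => expR (psi z)) 0 * gsmooths A (fun z => expR (- psi z)) 0.
  rewrite gsmooths_cat; set k := gsmooths A (fun z => expR (- psi z)) 0.
  have := @gsmooths_affine _ _ _ (fun v : V => (v, 0 : V)) (fun v : V => (v, 0 : V)) A
     (gsmooths [seq (0 : V, a) | a <- A] (fun z => expR (Psi z))) 0.
  move=> <-; last first.
    move=> z x a; apply/eqP; rewrite xpair_eqE/=; apply/andP; split; apply/eqP => //=.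
    by rewrite scaler0 addr0.
  rewrite mulrC -gsmoothsZ//; congr (gsmooths A _ 0); apply/funext => v /=.
  have := @gsmooths_affine _ _ _ (fun w : V => (v, w)) (fun w : V => (0 : V, w)) A
     (fun z => expR (Psi z)) 0.
  move=> <-; last first.
    move=> z x a; apply/eqP; rewrite xpair_eqE/=; apply/andP; split; apply/eqP => //=.
    by rewrite scaler0 addr0.
  rewrite mulrC /k -gsmoothsZ//; congr (gsmooths A _ 0); apply/funext => w /=.
  by rewrite /Psi/= expRD.
rewrite mulr1; apply => //.
- by rewrite addr_ge0.
- by rewrite mulr_ge0.
- by move=> z; exact: jet2_doubling.
move=> z; rewrite big_cat/= !big_map/=.
have l0 w : l w 0 = 0 by rewrite linear_form0//; have [] := jets w.
have b0 w : b w 0 = 0 by rewrite quadratic_form0//; have [] := jets w.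
rewrite -big_split -sumrB/=.
(* The independent pair contributes l1^2 + b1 + l2^2 - b2 and the diagonal pair (l1 - l2)^2 + b1 -
   b2; only the cross term 2 l1 l2 remains. *)
apply: (@le_trans _ _ (2 * \sum_(a <- A) l z.1 a * l z.2 a)); last by rewrite ler_pM2l.
rewrite mulr_sumr le_eqVlt; apply/orP; left; apply/eqP; apply: eq_bigr => a _.
by rewrite !l0 !b0; ring.
Qed.

(** Jensen's inequality, from the tangent of exp at the mean m. *)
Lemma gsmooths_jensen V (A : seq V) (f : V -> R) : explip f ->
  explip (fun z => expR (f z)) ->
  expR (gsmooths A f 0) <= gsmooths A (fun z => expR (f z)) 0.
Proof.
move=> ef ee; set m := gsmooths A f 0.
have -> : expR m = gsmooths A (fun z => expR m * (1 - m + f z)) 0.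
  rewrite gsmoothsZ; last by apply: explipD => //; exact: explip_cst.
  rewrite gsmoothsD//; last exact: explip_cst.
  by rewrite gsmooths_cst -/m subrK mulr1.
apply: gsmooths_le => //.
  by apply: explipZ; apply: explipD => //; exact: explip_cst.
move=> z; rewrite -(subrKC m (f z)) expRD subrKC ler_wpM2l ?expR_ge0//.
by apply: le_trans (expR_ge1Dx _); lra.
Qed.

Section Concentration.
Variables (V : normedModType R) (psi : V -> R) (C kappa : R) (l b : V -> V -> R).
Variable (A : seq V).
Hypothesis C0 : 0 <= C.
Hypothesis kappa0 : 0 <= kappa.
Hypothesis jets : forall z, jet2 psi C z (l z) (b z).
Hypothesis hk : forall z z', \sum_(a <- A) l z a * l z' a <= kappa.
Let m := gsmooths A psi 0.

Let e0 : explip psi. Proof. exact: lip_explip (jet2_lip jets). Qed.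
Let e1 : explip (fun z => expR (psi z)). Proof. exact: explip_expR (jet2_lip jets). Qed.
Let e2 : explip (fun z => expR (- psi z)).
Proof.
by apply: (@explip_expR _ _ _ C) => z z'; rewrite -opprD normrN; exact: (jet2_lip jets).
Qed.

Let jensen : expR m <= gsmooths A (fun z => expR (psi z)) 0.
Proof. exact: gsmooths_jensen. Qed.

Let jensenN : expR (- m) <= gsmooths A (fun z => expR (- psi z)) 0.
Proof.
have := gsmooths_jensen A (explipN e0) e2; congr (expR _ <= _).
rewrite /m -mulN1r -gsmoothsZ//; congr (gsmooths A _ 0).
by apply/funext => z; rewrite mulN1r.
Qed.

(** Jensen's inequality bounds the other factor of the concentration product from below by
    exp(-m). *)
Lemma gaussian_exp_upper : gsmooths A (fun z => expR (psi z)) 0 <= expR (kappa + m).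
Proof.
have := gaussian_exp_concentration C0 kappa0 jets hk.
have p : 0 <= gsmooths A (fun z => expR (psi z)) 0 by apply: le_trans jensen; exact: expR_ge0.
move=> /(le_trans (ler_wpM2l p jensenN)).
by rewrite expRN ler_pdivrMr ?expR_gt0// expRD.
Qed.

Lemma gaussian_exp_lower : gsmooths A (fun z => expR (- psi z)) 0 <= expR (kappa - m).
Proof.
have := gaussian_exp_concentration C0 kappa0 jets hk; rewrite mulrC.
have p : 0 <= gsmooths A (fun z => expR (- psi z)) 0 by apply: le_trans jensenN; exact: expR_ge0.
move=> /(le_trans (ler_wpM2l p jensen)).
by rewrite -ler_pdivlMr ?expR_gt0// expRD expRN.
Qed.

(** From x^2 <= 2 exp x + 2 exp(-x) at x = psi - m; each exponential moment is at most exp kappa. *)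
Lemma gaussian_variance :
  gsmooths A (fun z => (psi z - m) ^+ 2) 0 <= 4 * expR kappa.
Proof.
have eB : explip (fun z => psi z - m) by apply: explipB => //; exact: explip_cst.
pose g z := 2 * expR (- m) * expR (psi z) + 2 * expR m * expR (- psi z).
apply: (@le_trans _ _ (gsmooths A g 0)).
  apply: gsmooths_le.
  - by under eq_fun do rewrite expr2; exact: explipM.
  - by apply: explipD; exact: explipZ.
  move=> z; have -> : g z = 2 * expR (psi z - m) + 2 * expR (- (psi z - m)).
    by rewrite /g opprB !expRD; ring.
  move: (psi z - m) => x.
  have := expR_ge1Dxn 1 (normr_ge0 x); rewrite (_ : (2`!)%:R = 2)// real_normK ?num_real// => h.
  have [x0|x0] := ger0P x; [rewrite ger0_norm// in h|rewrite ltr0_norm// in h].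
    by have := expR_ge0 (- x); lra.
  by have := expR_ge0 x; lra.
rewrite gsmoothsD; [|exact: explipZ|exact: explipZ].
rewrite !gsmoothsZ//.
have h1 := ler_wpM2l (expR_ge0 (- m)) gaussian_exp_upper.
have h2 := ler_wpM2l (expR_ge0 m) gaussian_exp_lower.
rewrite -expRD (addrC kappa) addKr in h1.
rewrite -expRD addrCA subrr addr0 in h2.
by rewrite -!mulrA; lra.
Qed.

End Concentration.

End JetInterpolation.

(** * Gordon's comparison *)

Section Gordon.
Variables (R : realType) (M U : nat).
Local Notation V := 'M[R]_(M.+1, U.+1).

Lemma mx_entry_le m n (z : 'M[R]_(m, n)) i j : `|z i j| <= `|z|.
Proof.
rewrite [leRHS]/Num.norm /= mx_normrE; apply/bigmax_geP; right => /=.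
by exists (i, j).
Qed.

Lemma mx_entry_linear m n i j : linear_form (fun z : 'M[R]_(m, n) => z i j).
Proof. by move=> x z a; rewrite !mxE. Qed.

Variables (q beta : R).

(* With [beta = lam / q] and [q] small, [expR (softminmax z)] approximates
   [expR (- lam * min_i max_j z i j)]. *)
Definition softminmax (z : V) : R :=
  q * lse (fun i => -1 * lse (fun j => beta * z i j)).

Let p (z : V) i : 'I_U.+1 -> R := softmax (fun j => beta * z i j).
Let w (z : V) : 'I_M.+1 -> R := softmax (fun i => -1 * lse (fun j => beta * z i j)).
Let l1 (z : V) i v := \sum_j p z i j * (beta * v i j).
Let b1 (z : V) i v := \sum_j p z i j * (0 + (beta * v i j) ^+ 2) -
   (\sum_j p z i j * (beta * v i j)) ^+ 2.
Let l2 (z : V) v := \sum_i w z i * (-1 * l1 z i v).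

Definition softminmax_weight (z : V) i j : R := w z i * p z i j.

Definition softminmax_diff (z v : V) : R := q * l2 z v.

Definition softminmax_hess (z v : V) : R :=
  q * (\sum_i w z i * (-1 * b1 z i v + (-1 * l1 z i v) ^+ 2) - l2 z v ^+ 2).

Lemma softminmax_jets : exists2 C, 0 <= C &
  forall z, jet2 softminmax C z (softminmax_diff z) (softminmax_hess z).
Proof.
pose K := cumulant_const R + 4.
have K0 : 0 <= K.
  by rewrite /K /cumulant_const !addr_ge0 ?mulr_ge0 ?expR_ge0 ?sqr_ge0.
pose g (C : R) := K * (C + C ^+ 2 + C ^+ 3).
have g0 C : 0 <= C -> 0 <= g C by move=> C0; rewrite mulr_ge0 ?addr_ge0 ?exprn_ge0.
have b0 : 0 <= `|beta| by [].
exists (`|q| * g (`|-1| * g `|beta|)); first by rewrite mulr_ge0// g0// mulr_ge0// g0.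
move=> z; apply: jet2_scale; apply: (jet2_lse ord0); first by rewrite mulr_ge0// g0.
move=> i; apply: (@jet2_scale _ _ (fun z : V => lse (fun j => beta * z i j))).
apply: (@jet2_lse _ _ ord0 _ (fun j (z : V) => beta * z i j)) => // j.
apply: jet2_linear => //.
  by apply: linear_form_scale; exact: mx_entry_linear.
by move=> v; rewrite normrM ler_wpM2l// mx_entry_le.
Qed.

Lemma softminmax_weight_ge0 z i j : 0 <= softminmax_weight z i j.
Proof. by apply: mulr_ge0; apply: softmax_ge0; exact: ord0. Qed.

Lemma softminmax_weight_sum z : \sum_i \sum_j softminmax_weight z i j = 1.
Proof.
rewrite -(softmax_sum ord0 (fun i => -1 * lse (fun j => beta * z i j))).
apply: eq_bigr => i _; rewrite -mulr_sumr.
by rewrite (softmax_sum ord0 (fun j => beta * z i j)) mulr1.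
Qed.

Lemma softminmax_diffE z v : softminmax_diff z v =
  - (q * beta) * \sum_i \sum_j softminmax_weight z i j * v i j.
Proof.
rewrite /softminmax_diff -mulrN -mulrA; congr (_ * _).
rewrite mulNr mulr_sumr -sumrN; apply: eq_bigr => i _.
rewrite /l1 mulN1r mulrN; congr (- _).
rewrite !mulr_sumr; apply: eq_bigr => j _; rewrite /softminmax_weight; ring.
Qed.

(** The covariance of two entries of the Gaussian matrix whose directions are listed in [A]. *)
Definition gram (A : seq V) i j i' j' : R := \sum_(a <- A) a i j * a i' j'.

Lemma gram_sum (A : seq V) (c d : 'I_M.+1 -> 'I_U.+1 -> R) :
  \sum_(a <- A) (\sum_i \sum_j c i j * a i j) * (\sum_i \sum_j d i j * a i j) =
  \sum_i \sum_j \sum_i' \sum_j' c i j * d i' j' * gram A i j i' j'.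
Proof.
under eq_bigr do rewrite mulr_suml.
rewrite exchange_big/=; apply: eq_bigr => i _.
under eq_bigr do rewrite mulr_suml.
rewrite exchange_big/=; apply: eq_bigr => j _.
under eq_bigr do rewrite mulr_sumr.
rewrite exchange_big/=; apply: eq_bigr => i' _.
under eq_bigr do rewrite mulr_sumr.
rewrite exchange_big/=; apply: eq_bigr => j' _.
rewrite /gram mulr_sumr; apply: eq_bigr => a _; ring.
Qed.

Lemma gram_sum_row (A : seq V) i (c d : 'I_U.+1 -> R) :
  \sum_(a <- A) (\sum_j c j * a i j) * (\sum_j d j * a i j) =
  \sum_j \sum_j' c j * d j' * gram A i j i j'.
Proof.
under eq_bigr do rewrite mulr_suml.
rewrite exchange_big/=; apply: eq_bigr => j _.
under eq_bigr do rewrite mulr_sumr.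
rewrite exchange_big/=; apply: eq_bigr => j' _.
rewrite /gram mulr_sumr; apply: eq_bigr => a _; ring.
Qed.

(** The weights are probabilities, so a covariance of two weighted averages is at most the largest
    covariance of entries. This supplies the constant of the concentration bound. *)
Lemma softminmax_diff_gram (A : seq V) (g : R) z z' :
  (forall i j i' j', gram A i j i' j' <= g) ->
  \sum_(a <- A) softminmax_diff z a * softminmax_diff z' a <= (q * beta) ^+ 2 * g.
Proof.
move=> hg.
have -> : \sum_(a <- A) softminmax_diff z a * softminmax_diff z' a =
   (q * beta) ^+ 2 * \sum_(a <- A) (\sum_i \sum_j softminmax_weight z i j * a i j) *
      (\sum_i \sum_j softminmax_weight z' i j * a i j).
  rewrite mulr_sumr; apply: eq_bigr => a _; rewrite !softminmax_diffE; ring.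
rewrite gram_sum ler_wpM2l ?sqr_ge0//.
apply: (@le_trans _ _ (\sum_i \sum_j \sum_i' \sum_j'
   softminmax_weight z i j * softminmax_weight z' i' j' * g)).
  do 4![apply: ler_sum => ? _].
  by rewrite ler_wpM2l// mulr_ge0// softminmax_weight_ge0.
rewrite le_eqVlt; apply/orP; left; apply/eqP.
transitivity (\sum_i \sum_j softminmax_weight z i j * g).
  apply: eq_bigr => i _; apply: eq_bigr => j _.
  transitivity (\sum_i' (softminmax_weight z i j * g) * \sum_j' softminmax_weight z' i' j').
    apply: eq_bigr => i' _; rewrite mulr_sumr; apply: eq_bigr => j' _; ring.
  by rewrite -mulr_sumr softminmax_weight_sum mulr1.
under eq_bigr do rewrite -mulr_suml.
by rewrite -mulr_suml softminmax_weight_sum mul1r.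
Qed.

(* The Hessian of [exp \o softminmax] contributes cross terms between distinct
   rows only through [- q (1 - q) l2 ^ 2]; terms within a row agree for [A] and [B]. *)
Theorem gordon_comparison (A B : seq V) : 0 <= q <= 1 ->
  (forall i j j', gram A i j i j' = gram B i j i j') ->
  (forall i j i' j', gram B i j i' j' <= gram A i j i' j') ->
  gsmooths A (fun z => expR (softminmax z)) 0 <=
  gsmooths B (fun z => expR (softminmax z)) 0.
Proof.
move=> /andP[q0 q1] hrow hall; have [C C0 jets] := softminmax_jets.
have := @gaussian_comparison _ _ _ C 0 _ _ A B C0 (lexx 0) jets.
rewrite mul0r expR0 mul1r; apply => z.
pose r i a := -1 * b1 z i a + (-1 * l1 z i a) ^+ 2.
(* The squared differential q^2 l2^2 and the Hessian term - q l2^2 combine into - q (1 - q) l2^2,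
   where 0 <= q <= 1 fixes the sign. *)
have split_sum (D : seq V) :
    \sum_(a <- D) (softminmax_diff z a ^+ 2 + softminmax_hess z a) =
    q * (\sum_i w z i * \sum_(a <- D) r i a) -
    q * (1 - q) * \sum_(a <- D) l2 z a ^+ 2.
  transitivity (\sum_(a <- D) (q * (\sum_i w z i * r i a) + - (q * (1 - q)) * l2 z a ^+ 2)).
    by apply: eq_bigr => a _; rewrite /softminmax_diff /softminmax_hess -/(r _ _); ring.
  rewrite big_split/= -!mulr_sumr mulNr exchange_big/=; congr (_ * _ - _).
  by apply: eq_bigr => i _; rewrite mulr_sumr.
have row_sum (D : seq V) i : \sum_(a <- D) r i a =
    - beta ^+ 2 * (\sum_j p z i j * gram D i j i j) +
    2 * beta ^+ 2 * \sum_j \sum_j' p z i j * p z i j' * gram D i j i j'.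
  rewrite -gram_sum_row.
  transitivity (\sum_(a <- D) (- beta ^+ 2 * (\sum_j p z i j * a i j ^+ 2) +
     2 * beta ^+ 2 * ((\sum_j p z i j * a i j) * (\sum_j p z i j * a i j)))).
    apply: eq_bigr => a _; rewrite /r /b1 /l1.
    have -> : \sum_j p z i j * (beta * a i j) = beta * \sum_j p z i j * a i j.
      by rewrite mulr_sumr; apply: eq_bigr => j _; ring.
    have -> : \sum_j p z i j * (0 + (beta * a i j) ^+ 2) =
        beta ^+ 2 * \sum_j p z i j * a i j ^+ 2.
      by rewrite mulr_sumr; apply: eq_bigr => j _; ring.
    by ring.
  rewrite big_split/= -!mulr_sumr; congr (_ * _ + _).
  rewrite exchange_big/=; apply: eq_bigr => j _.
  by rewrite -mulr_sumr; congr (_ * _); rewrite /gram; apply: eq_bigr => a _; rewrite expr2.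
have rowAB i : \sum_(a <- A) r i a = \sum_(a <- B) r i a.
  rewrite !row_sum; congr (_ * _ + _ * _).
    by apply: eq_bigr => j _; rewrite hrow.
  by apply: eq_bigr => j _; apply: eq_bigr => j' _; rewrite hrow.
have l2_sum (D : seq V) : \sum_(a <- D) l2 z a ^+ 2 = beta ^+ 2 *
   \sum_i \sum_j \sum_i' \sum_j' softminmax_weight z i j * softminmax_weight z i' j' *
      gram D i j i' j'.
  rewrite -gram_sum mulr_sumr; apply: eq_bigr => a _.
  have -> : l2 z a = - beta * \sum_i \sum_j softminmax_weight z i j * a i j.
    rewrite /l2 mulr_sumr; apply: eq_bigr => i _; rewrite /l1 !mulr_sumr.
    by apply: eq_bigr => j _; rewrite /softminmax_weight; ring.
  by ring.
rewrite !split_sum; under eq_bigr do rewrite rowAB.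
suff : q * (1 - q) * \sum_(a <- B) l2 z a ^+ 2 <= q * (1 - q) * \sum_(a <- A) l2 z a ^+ 2.
  by move=> h; lra.
rewrite ler_wpM2l ?mulr_ge0 ?subr_ge0// !l2_sum ler_wpM2l ?sqr_ge0//.
do 4![apply: ler_sum => ? _].
by rewrite ler_wpM2l// mulr_ge0// softminmax_weight_ge0.
Qed.

End Gordon.

(** * The iterated expectation as Gaussian averaging *)

Section GaussianExpectation.
Variable R : realType.
Local Notation gamma := (normal_prob (0:R) 1).

(** For nonnegative functions the integral is a supremum over simple functions below, hence monotone
    without measurability. Indicators of events are compared through this. *)
Lemma le_integral_nonmeasurable d (T : measurableType d) (mu : {measure set T -> \bar R})
    (f g : T -> \bar R) :
  (forall x, 0 <= f x)%E -> (forall x, f x <= g x)%E ->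
  (\int[mu]_x f x <= \int[mu]_x g x)%E.
Proof.
move=> f0 fg; have g0 x : (0 <= g x)%E by exact: le_trans (f0 x) (fg x).
rewrite !ge0_integralTE//; apply: ge_ereal_sup => _ [h hf <-].
by apply: ereal_sup_ubound; exists h => // x; exact: le_trans (hf x) (fg x).
Qed.

Lemma gexp_ge0 k (f : 'rV[R]_k -> \bar R) : (forall v, 0 <= f v)%E -> (0 <= gexp f)%E.
Proof.
elim: k f => [|k IH] f f0 /=; first exact: f0.
by apply: integral_ge0 => x _; apply: IH => v; exact: f0.
Qed.

Lemma gexp_le k (f g : 'rV[R]_k -> \bar R) :
  (forall v, 0 <= f v)%E -> (forall v, f v <= g v)%E -> (gexp f <= gexp g)%E.
Proof.
elim: k f g => [|k IH] f g f0 fg /=; first exact: fg.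
apply: le_integral_nonmeasurable => x; first by apply: gexp_ge0 => v; exact: f0.
by apply: IH => v; [exact: f0|exact: fg].
Qed.

Lemma gexp_gsmooths (V : normedModType R) k (f : V -> R) (a : 'I_k -> V) z :
  explip f ->
  gexp (fun v : 'rV[R]_k => (f (z + \sum_i v ord0 i *: a i))%:E) =
  (gsmooths [seq a i | i <- enum 'I_k] f z)%:E.
Proof.
move=> ef; elim: k a z => [|k IH] a z /=.
  by rewrite big_ord0 addr0 enum_ord0.
rewrite enum_ordSl/= -map_comp -/(gsmooths _ _) gsmooth_EFin; last exact: explip_gsmooths.
apply: eq_integral => x _; rewrite -(IH (a \o lift ord0)); congr gexp.
apply/funext => v; rewrite big_ord_recl !mxE unlift_none addrA; congr (f (_ + _))%:E.
by apply: eq_bigr => i _; rewrite !mxE liftK.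
Qed.

Definition std_basis k : seq 'rV[R]_k := [seq delta_mx 0 i | i <- enum 'I_k].

Definition gmean k (f : 'rV[R]_k -> R) : R := gsmooths (std_basis k) f 0.

Lemma gexp_gmean k (f : 'rV[R]_k -> R) : explip f ->
  gexp (fun v => (f v)%:E) = (gmean f)%:E.
Proof.
move=> ef; rewrite /gmean -(gexp_gsmooths _ _ ef); congr gexp; apply/funext => v.
by rewrite add0r -row_sum_delta.
Qed.

Lemma gmean_le k (f g : 'rV[R]_k -> R) : explip f -> explip g ->
  (forall v, f v <= g v) -> gmean f <= gmean g.
Proof. exact: gsmooths_le. Qed.

Lemma gmeanD k (f g : 'rV[R]_k -> R) : explip f -> explip g ->
  gmean (fun v => f v + g v) = gmean f + gmean g.
Proof. exact: gsmoothsD. Qed.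

Lemma gmeanB k (f g : 'rV[R]_k -> R) : explip f -> explip g ->
  gmean (fun v => f v - g v) = gmean f - gmean g.
Proof. exact: gsmoothsB. Qed.

Lemma gmeanZ k c (f : 'rV[R]_k -> R) : explip f ->
  gmean (fun v => c * f v) = c * gmean f.
Proof. exact: gsmoothsZ. Qed.

Lemma gmean_cst k c : gmean (fun _ : 'rV[R]_k => c) = c.
Proof. exact: gsmooths_cst. Qed.

Lemma gmean_sum k (I : Type) (r : seq I) (f : I -> 'rV[R]_k -> R) :
  (forall i, explip (f i)) ->
  gmean (fun z => \sum_(i <- r) f i z) = \sum_(i <- r) gmean (f i).
Proof. exact: gsmooths_sum. Qed.

Lemma gmean_linear_image (V : normedModType R) k (a : 'I_k -> V) (f : V -> R) z :
  gmean (fun v => f (z + \sum_i v ord0 i *: a i)) =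
  gsmooths [seq a i | i <- enum 'I_k] f z.
Proof.
pose T (v : 'rV[R]_k) := z + \sum_i v ord0 i *: a i.
pose T' (v : 'rV[R]_k) := \sum_i v ord0 i *: a i.
have := @gsmooths_affine _ _ _ T T' (std_basis k) f 0; rewrite /gmean -/T => ->.
  rewrite /T (_ : \sum_i _ = 0) ?addr0; last first.
    by rewrite big1// => i _; rewrite mxE scale0r.
  congr (gsmooths _ f z); rewrite /std_basis -map_comp; apply: eq_map => i /=.
  rewrite /T' (bigD1 i)//= mxE !eqxx scale1r big1 ?addr0// => j ji.
  by rewrite mxE (negbTE ji) andbF scale0r.
move=> v x w; rewrite /T /T' -addrA; congr (_ + _).
rewrite scaler_sumr -big_split/=; apply: eq_bigr => i _.
by rewrite !mxE scalerDl scalerA.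
Qed.

Lemma row_entry_explip k i : explip (fun v : 'rV[R]_k => v ord0 i).
Proof.
apply: (@lip_explip _ _ _ 1) => v w; rewrite mul1r.
by have := mx_entry_le (v - w) ord0 i; rewrite !mxE.
Qed.

Definition rdot k (v : 'rV[R]_k) (a : 'cV[R]_k) : R := \sum_i v ord0 i * a i 0.

Lemma explip_rdot k (a : 'cV[R]_k) : explip (fun v : 'rV[R]_k => rdot v a).
Proof.
apply: explip_sum => i; apply: explipM; last exact: explip_cst.
exact: row_entry_explip.
Qed.

Lemma rdot_lin k (a : 'cV[R]_k) z x w : rdot (z + x *: w) a = rdot z a + x * rdot w a.
Proof.
rewrite /rdot mulr_sumr -big_split/=; apply: eq_bigr => i _; rewrite !mxE; ring.
Qed.

Lemma gmean_rdot_sqr k (a : 'cV[R]_k) : gmean (fun v => rdot v a ^+ 2) = sqnorm a.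
Proof.
rewrite /gmean (@gsmooths_quad _ _ _ _ (fun w => rdot w a ^+ 2)); last first.
  by move=> z w; exists (2 * rdot z a * rdot w a) => x; rewrite rdot_lin; ring.
rewrite {1}/rdot big1 ?expr0n ?add0r; last by move=> i _; rewrite mxE mul0r.
rewrite /std_basis big_map enumT; apply: eq_bigr => i _; congr (_ ^+ 2).
rewrite /rdot (bigD1 i)//= mxE !eqxx mul1r big1 ?addr0// => j ji.
by rewrite mxE (negbTE ji) andbF mul0r.
Qed.

Lemma gmean_entry_sqr k i : gmean (fun v : 'rV[R]_k => v ord0 i ^+ 2) = 1.
Proof.
have := gmean_rdot_sqr (delta_mx i 0 : 'cV[R]_k).
have -> : sqnorm (delta_mx i 0 : 'cV[R]_k) = 1.
  rewrite /sqnorm (bigD1 i)//= mxE !eqxx expr1n big1 ?addr0// => j ji.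
  by rewrite mxE (negbTE ji) expr0n.
move=> <-; congr gmean; apply/funext => v; congr (_ ^+ 2).
rewrite /rdot (bigD1 i)//= mxE !eqxx mulr1 big1 ?addr0// => j ji.
by rewrite mxE (negbTE ji) mulr0.
Qed.

(** The l1 norm, dual to entrywise closeness: it controls the error of replacing a unit vector by a
    point of the net. *)
Definition rnorm1 k (v : 'rV[R]_k) : R := \sum_i `|v ord0 i|.

Lemma explip_rnorm1 k : explip (@rnorm1 k).
Proof. by apply: explip_sum => i; apply: explip_abs; exact: row_entry_explip. Qed.

Lemma explip_sqr (V : normedModType R) (f : V -> R) : explip f -> explip (fun v => f v ^+ 2).
Proof. by move=> ef; under eq_fun do rewrite expr2; exact: explipM. Qed.

Lemma gmean_rnorm1 k : gmean (@rnorm1 k) <= k%:R.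
Proof.
rewrite /rnorm1 gmean_sum; last first.
  by move=> i; apply: explip_abs; exact: row_entry_explip.
have -> : k%:R = \sum_(i < k) (1 : R) by rewrite sumr_const card_ord.
apply: ler_sum => i _.
have e := row_entry_explip i.
apply: (@le_trans _ _ (gmean (fun v : 'rV[R]_k => 2^-1 * (v ord0 i ^+ 2 + 1)))).
  apply: gmean_le; first exact: explip_abs.
    by apply: explipZ; apply: explipD; [exact: explip_sqr|exact: explip_cst].
  move=> v; rewrite -[v ord0 i ^+ 2]real_normK ?num_real//.
  by have := sqr_ge0 (`|v ord0 i| - 1); lra.
rewrite gmeanZ; last by apply: explipD; [exact: explip_sqr|exact: explip_cst].
rewrite gmeanD; [|exact: explip_sqr|exact: explip_cst].
by rewrite gmean_entry_sqr gmean_cst; lra.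
Qed.

Lemma gmean_rnorm1_sqr k : gmean (fun v : 'rV[R]_k => rnorm1 v ^+ 2) <= k%:R ^+ 2.
Proof.
have e i := @row_entry_explip k i.
have es i : explip (fun v : 'rV[R]_k => v ord0 i ^+ 2) by exact: explip_sqr.
apply: (@le_trans _ _ (gmean (fun v : 'rV[R]_k => k%:R * \sum_i v ord0 i ^+ 2))).
  apply: gmean_le; first exact/explip_sqr/explip_rnorm1.
    by apply: explipZ; exact: explip_sum.
  move=> v; rewrite /rnorm1 expr2 mulr_suml.
  under eq_bigr do rewrite mulr_sumr.
  apply: (@le_trans _ _ (\sum_(i < k) \sum_(j < k) (v ord0 i ^+ 2 + v ord0 j ^+ 2) / 2)).
    apply: ler_sum => i _; apply: ler_sum => j _.
    rewrite -[v ord0 i ^+ 2]real_normK ?num_real// -[v ord0 j ^+ 2]real_normK ?num_real//.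
    by have := sqr_ge0 (`|v ord0 i| - `|v ord0 j|); lra.
  rewrite le_eqVlt; apply/orP; left; apply/eqP.
  under eq_bigr do rewrite -mulr_suml big_split/= sumr_const card_ord.
  rewrite -mulr_suml big_split/= sumr_const card_ord sumrMnl -[in LHS]mulr_natl; by field.
rewrite gmeanZ; last exact: explip_sum.
rewrite gmean_sum//; under eq_bigr do rewrite gmean_entry_sqr.
by rewrite sumr_const card_ord expr2.
Qed.

Lemma gmean_ge0 k (f : 'rV[R]_k -> R) : explip f -> (forall v, 0 <= f v) -> 0 <= gmean f.
Proof. by move=> ef f0; rewrite -(gmean_cst k 0); apply: gmean_le => //; exact: explip_cst. Qed.

(** Cauchy-Schwarz in the form f <= (f^2 + c^2) / (2c). *)
Lemma gmean_le_sqrt k (f : 'rV[R]_k -> R) (g : 'rV[R]_k -> R) (c : R) :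
  explip f -> explip g -> 0 < c -> (forall v, f v ^+ 2 <= g v) -> gmean g <= c ^+ 2 ->
  gmean f <= c.
Proof.
move=> ef eg c0 fg gc.
apply: (@le_trans _ _ (gmean (fun v => (2 * c)^-1 * (g v + c ^+ 2)))).
  apply: gmean_le => //.
    by apply: explipZ; apply: explipD => //; exact: explip_cst.
  move=> v; rewrite mulrC ler_pdivlMr ?mulr_gt0//.
  by have := sqr_ge0 (f v - c); have := fg v; lra.
rewrite gmeanZ; last by apply: explipD => //; exact: explip_cst.
rewrite gmeanD//; last exact: explip_cst.
by rewrite gmean_cst mulrC ler_pdivrMr ?mulr_gt0//; lra.
Qed.

End GaussianExpectation.

Section Nets.
Variable R : realType.

(** The cube is cut into cells of side [eps], and one point of [A] is chosen in each cell that meets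
    [A]; so the net lies in [A] itself. *)
Lemma finite_net n (A : set 'cV[R]_n) (eps : R) : 0 < eps -> A !=set0 ->
  (forall a i, A a -> `|a i 0| <= 1) ->
  exists k (f : 'I_k.+1 -> 'cV[R]_n), (forall i, A (f i)) /\
    forall a, A a -> exists i, forall j, `|a j 0 - f i j 0| <= eps.
Proof.
move=> e0 [a0 Aa0] hA.
pose L := Num.truncn (2 / eps).
pose cell (a : 'cV[R]_n) j := Num.truncn ((a j 0 + 1) / eps).
pose code (a : 'cV[R]_n) : {ffun 'I_n -> 'I_L.+1} := [ffun j => inord (cell a j)].
pose T : finType := {ffun 'I_n -> 'I_L.+1}.
(* Cells that do not meet [A] are represented by [a0], which keeps all representatives in [A]. *)
pose rep (t : T) := xget a0 [set a | A a /\ code a = t].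
have repA t : A (rep t).
  by rewrite /rep; case: xgetP => [a _ []|].
have rep_code a : A a -> code (rep (code a)) = code a.
  move=> Aa; rewrite /rep; case: xgetP => [b _ []//|/(_ a)]; by case.
have T0 : (0 < #|T|)%N by apply/card_gt0P; exists (code a0).
exists #|T|.-1, (fun i => rep (enum_val (cast_ord (prednK T0) i))); split => // a Aa.
exists (cast_ord (esym (prednK T0)) (enum_rank (code a))) => j.
rewrite cast_ordKV enum_rankK; set b := rep _.
have Ab : A b by exact: repA.
have range (c : 'cV[R]_n) : A c -> 0 <= (c j 0 + 1) / eps /\ (cell c j < L.+1)%N.
  move=> Ac; have := hA c j Ac; rewrite ler_norml => /andP[c1 c2].
  split; first by rewrite divr_ge0 ?(ltW e0)//; lra.
  by rewrite ltnS; apply: le_truncn; rewrite ler_wpM2r ?invr_ge0 ?(ltW e0)//; lra.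
have [ra ca] := range a Aa; have [rb cb] := range b Ab.
have cab : cell a j = cell b j.
  have /ffunP/(_ j) := rep_code a Aa; rewrite !ffunE => /(congr1 val).
  by rewrite /= !inordK.
have /andP[a1 a2] := truncn_itv ra; have /andP[b1 b2] := truncn_itv rb.
rewrite -/(cell a j) in a1 a2; rewrite -/(cell b j) -cab in b1 b2.
rewrite -natr1 in a2 b2.
have hab : `|(a j 0 + 1) / eps - (b j 0 + 1) / eps| <= 1 by rewrite ler_norml; lra.
rewrite -mulrBl normrM (gtr0_norm (_ : 0 < eps^-1)) ?invr_gt0// ler_pdivrMr// mul1r in hab.
by apply: le_trans hab; rewrite opprD addrACA subrr addr0.
Qed.

End Nets.

Section MeanLower.
Variables (R : realType) (k : nat).

(** Passes from the mean square of [d] to the mean of [F]. With Y = |F - f| + e one has d <= max(0,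
    f) + Y; since E Y^2 <= c^2, the root mean square of [d] is at most max(0, f) + c. *)
Lemma gmean_lower (F d e : 'rV[R]_k -> R) (v w c : R) :
  explip F -> explip (fun h => d h ^+ 2) -> explip e ->
  (forall h, 0 <= d h) -> (forall h, 0 <= e h) -> (forall h, d h <= F h + e h) ->
  gmean (fun h => (F h - gmean F) ^+ 2) <= v -> gmean (fun h => e h ^+ 2) <= w ->
  0 < c -> c ^+ 2 = 2 * (v + w) -> c < Num.sqrt (gmean (fun h => d h ^+ 2)) ->
  Num.sqrt (gmean (fun h => d h ^+ 2)) - c <= gmean F.
Proof.
move=> eF ed ee d0 e0 dFe hv hw c0 c2 cd.
set f : R := gmean F in hv *; set D : R := gmean _ in cd *.
pose Y h := `|F h - f| + e h.
have eFf : explip (fun h => F h - f) by apply: explipB => //; exact: explip_cst.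
have eY : explip Y by apply: explipD => //; exact: explip_abs.
have Y0 h : 0 <= Y h by rewrite addr_ge0.
have gY2 : gmean (fun h => Y h ^+ 2) <= c ^+ 2.
  apply: (@le_trans _ _ (gmean (fun h => 2 * ((F h - f) ^+ 2 + e h ^+ 2)))).
    apply: gmean_le; first exact: explip_sqr.
      by apply: explipZ; apply: explipD; exact: explip_sqr.
    move=> h; rewrite /Y -[(F h - f) ^+ 2]real_normK ?num_real//.
    by have := sqr_ge0 (`|F h - f| - e h); lra.
  rewrite gmeanZ; last by apply: explipD; exact: explip_sqr.
  rewrite gmeanD; [|exact: explip_sqr|exact: explip_sqr].
  by rewrite c2 ler_pM2l// lerD.
have gY : gmean Y <= c.
  by apply: (@gmean_le_sqrt _ _ _ (fun h => Y h ^+ 2)) => //; exact: explip_sqr.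
pose fp : R := Num.max 0 f.
have fp0 : 0 <= fp by rewrite le_max lexx.
have ffp : f <= fp by rewrite le_max lexx orbT.
have D_le : D <= (fp + c) ^+ 2.
  apply: (@le_trans _ _ (gmean (fun h => fp ^+ 2 + (2 * fp * Y h + Y h ^+ 2)))).
    apply: gmean_le => //.
      apply: explipD; first exact: explip_cst.
      by apply: explipD; [exact: explipZ|exact: explip_sqr].
    move=> h; apply: (@le_trans _ _ ((fp + Y h) ^+ 2)).
      rewrite lerXn2r ?nnegrE ?addr_ge0//.
      rewrite (le_trans (dFe h))// /Y; have := ler_norm (F h - f); lra.
    by rewrite sqrrD; lra.
  rewrite gmeanD; [|exact: explip_cst|]; last first.
    by apply: explipD; [exact: explipZ|exact: explip_sqr].
  rewrite gmeanD; [|exact: explipZ|exact: explip_sqr].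
  rewrite gmean_cst gmeanZ//.
  by have := ler_wpM2l fp0 gY; rewrite sqrrD; lra.
have sD : Num.sqrt D <= fp + c.
  by rewrite -(ger0_norm (_ : 0 <= fp + c)) ?addr_ge0 ?(ltW c0)// -sqrtr_sqr ler_wsqrtr.
(* The assumption that [c] lies below the root mean square forces f > 0, so the positive part is f
   itself. *)
have fp_pos : 0 < fp by lra.
have [f0|f0] := leP f 0; first by move: fp_pos; rewrite /fp (max_idPl f0) ltxx.
by move: sD; rewrite /fp (max_idPr (ltW f0)) lerBlDr.
Qed.

End MeanLower.

(** * The two Gaussian processes on a pair of nets *)

Section GordonProcess.
Variable R : realType.

Lemma lse_shift (I : finType) (i0 : I) (x : I -> R) (c : R) :
  lse (fun i => x i + c) = lse x + c.
Proof.
apply/eqP; rewrite addrC -subr_eq; apply/eqP.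
rewrite (lse_diff i0 x (fun=> c)) -mulr_suml softmax_sum// mul1r expRK//.
Qed.

Lemma lse1 (x : 'I_1 -> R) : lse x = x ord0.
Proof. by rewrite /lse big_ord1 expRK. Qed.

Definition cdot n (u v : 'cV[R]_n) : R := \sum_i u i 0 * v i 0.

Lemma cdot_le1 n (u v : 'cV[R]_n) : sqnorm u = 1 -> sqnorm v = 1 -> cdot u v <= 1.
Proof.
move=> u1 v1; have : \sum_i (u i 0 - v i 0) ^+ 2 = 2 - 2 * cdot u v.
  transitivity (\sum_i (u i 0 ^+ 2 + v i 0 ^+ 2 + - 2 * (u i 0 * v i 0))).
    by apply: eq_bigr => i _; ring.
  rewrite !big_split/= -mulr_sumr -/(sqnorm u) -/(sqnorm v) u1 v1 -/(cdot u v); ring.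
have : 0 <= \sum_i (u i 0 - v i 0) ^+ 2 by apply: sumr_ge0 => i _; exact: sqr_ge0.
by move=> /[swap] ->; lra.
Qed.

Lemma cdotnn n (u : 'cV[R]_n) : cdot u u = sqnorm u.
Proof. by apply: eq_bigr => i _; rewrite expr2. Qed.

Variables (n m N : nat) (e : 'I_N -> 'I_m * 'I_n) (sg : R).
Hypothesis e_bij : bijective e.
Hypothesis sg2 : sg ^+ 2 = 1.

(* The bilinear form [sg * (b^T G a)], where [v] lists the entries of [G] in the order [e]. *)
Definition bilin (v : 'rV[R]_N) (b : 'cV[R]_m) (a : 'cV[R]_n) : R :=
  sg * \sum_k v ord0 k * (b (e k).1 0 * a (e k).2 0).

Variables (M U : nat) (aN : 'I_M.+1 -> 'cV[R]_n) (bN : 'I_U.+1 -> 'cV[R]_m).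
Hypothesis aN1 : forall i, sqnorm (aN i) = 1.
Hypothesis bN1 : forall j, sqnorm (bN j) = 1.
Local Notation V := 'M[R]_(M.+1, U.+1).

(** The [mxdir] directions generate the entries sg <b_j, G a_i>. Those of [gdir] and [hdir] generate
    <h, b_j> - <g, a_i>, whose min-max separates into a maximum over b minus a maximum over a. *)
Definition mxdir k : V := \matrix_(i, j) (sg * (bN j (e k).1 0 * aN i (e k).2 0)).
Definition gdir l : V := \matrix_(i, j) (- aN i l 0).
Definition hdir l : V := \matrix_(i, j) bN j l 0.
Definition gordon_list : seq V := [seq gdir l | l <- enum 'I_n] ++ [seq hdir l | l <- enum 'I_m].

(** The constant direction adds 1 to every covariance, so that within a row, where <a_i, a_i> = 1,
    the process has the covariances of [gordon_list]. *)
Lemma gram_mxdir i j i' j' :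
  gram (const_mx 1 :: [seq mxdir k | k <- enum 'I_N]) i j i' j' =
  1 + cdot (bN j) (bN j') * cdot (aN i) (aN i').
Proof.
rewrite /gram big_cons !mxE mulr1; congr (_ + _).
rewrite big_map big_enum/=.
pose F (p : 'I_m * 'I_n) := (bN j p.1 0 * bN j' p.1 0) * (aN i p.2 0 * aN i' p.2 0).
transitivity (\sum_k F (e k)).
  apply: eq_bigr => k _; rewrite !mxE /F.
  transitivity (sg ^+ 2 * ((bN j (e k).1 0 * bN j' (e k).1 0) *
     (aN i (e k).2 0 * aN i' (e k).2 0))); first by ring.
  by rewrite sg2 mul1r.
transitivity (\sum_p F p); first by rewrite [RHS](reindex e) //; exact: onW_bij.
rewrite -(pair_bigA _ (fun p1 p2 => F (p1, p2)))/=.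
rewrite /cdot mulr_suml; apply: eq_bigr => p _.
by rewrite mulr_sumr.
Qed.

Lemma gram_gordon_list i j i' j' :
  gram gordon_list i j i' j' = cdot (aN i) (aN i') + cdot (bN j) (bN j').
Proof.
rewrite /gram big_cat; congr (_ + _); rewrite big_map big_enum;
  apply: eq_bigr => l _; by rewrite !mxE// mulrNN.
Qed.

Variables (q beta : R).
Hypothesis q01 : 0 < q <= 1.
Hypothesis beta0 : 0 < beta.
Let psi : V -> R := softminmax q beta.

Let psi_lip : exists2 C, 0 <= C & forall z z', `|psi z - psi z'| <= C * `|z - z'|.
Proof.
have [C C0 jets] := @softminmax_jets R M U q beta; exists C => //.
exact: jet2_lip jets.
Qed.

Let epsi : explip psi.
Proof. by have [C _ h] := psi_lip; exact: lip_explip h. Qed.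

Let eexp : explip (fun z => expR (psi z)).
Proof. by have [C _ h] := psi_lip; exact: explip_expR h. Qed.

Let psi_shift z x : psi (z + x *: const_mx 1) = psi z - q * beta * x.
Proof.
rewrite /psi /softminmax.
have -> : (fun i => -1 * lse (fun j => beta * (z + x *: const_mx 1) i j)) =
    (fun i => -1 * lse (fun j => beta * z i j) + - beta * x).
  apply/funext => i; rewrite -[- beta * x](_ : -1 * (beta * x) = _); last by ring.
  rewrite -mulrDr -(lse_shift ord0); congr (_ * lse _).
  by apply/funext => j; rewrite !mxE mulr1 mulrDr.
by rewrite (lse_shift ord0); ring.
Qed.

(* The direction [const_mx 1] is the additional Gaussian variable of Gordon's comparison;
   by Jensen's inequality it only increases the expectation. *)
Lemma gordon_drop_const :
  gsmooths [seq mxdir k | k <- enum 'I_N] (fun z => expR (psi z)) 0 <=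
  gsmooths (const_mx 1 :: [seq mxdir k | k <- enum 'I_N]) (fun z => expR (psi z)) 0.
Proof.
rewrite [X in _ <= X]/= gsmooth_gsmoothsC//.
apply: gsmooths_le => //; first exact: explip_gsmooth.
move=> z; set c := const_mx 1.
apply: (@le_trans _ _ (gsmooth c (fun w => expR (psi z) * (1 - psi z + psi w)) z)).
  rewrite gsmoothZ; last by apply: explipD => //; exact: explip_cst.
  rewrite gsmoothD//; last exact: explip_cst.
  rewrite gsmooth_cst (@gsmooth_quad _ _ _ _ _ (- (q * beta)) 0).
    by rewrite addr0 subrK mulr1.
  by move=> x; rewrite psi_shift; ring.
apply: gsmooth_le => //.
  by apply: explipZ; apply: explipD => //; exact: explip_cst.
move=> w; rewrite -[psi w in leRHS](subrKC (psi z)) expRD ler_wpM2l ?expR_ge0//.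
by rewrite -addrA [- psi z + _]addrC; exact: expR_ge1Dx.
Qed.

Lemma gordon_exp_bound :
  gsmooths [seq mxdir k | k <- enum 'I_N] (fun z => expR (psi z)) 0 <=
  expR ((q * beta) ^+ 2 * 2 + gsmooths gordon_list psi 0).
Proof.
have [C C0 jets] := @softminmax_jets R M U q beta.
apply: (le_trans gordon_drop_const).
apply: (@le_trans _ _ (gsmooths gordon_list (fun z => expR (psi z)) 0)).
  have [q0 q1] := andP q01.
  apply: gordon_comparison; first by rewrite ltW.
    by move=> i j j'; rewrite gram_mxdir gram_gordon_list cdotnn aN1 mulr1.
  move=> i j i' j'; rewrite gram_mxdir gram_gordon_list.
  have h1 := cdot_le1 (aN1 i) (aN1 i'); have h2 := cdot_le1 (bN1 j) (bN1 j').
  rewrite -subr_ge0.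
  (* With x = <a, a'> and y = <b, b'>, the difference of covariances is (1 - x)(1 - y), which is
     nonnegative and vanishes when a = a'. *)
  have -> : 1 + cdot (bN j) (bN j') * cdot (aN i) (aN i') -
     (cdot (aN i) (aN i') + cdot (bN j) (bN j')) =
     (1 - cdot (aN i) (aN i')) * (1 - cdot (bN j) (bN j')) by ring.
  by rewrite mulr_ge0// subr_ge0.
apply: (gaussian_exp_upper C0 _ jets); first by rewrite mulr_ge0// sqr_ge0.
move=> z z'; apply: softminmax_diff_gram => i j i' j'.
rewrite gram_gordon_list.
by have := cdot_le1 (aN1 i) (aN1 i'); have := cdot_le1 (bN1 j) (bN1 j'); lra.
Qed.

Definition softmaxA (g : 'rV[R]_n) : R := beta^-1 * lse (fun i => beta * rdot g (aN i)).
Definition softmaxB (h : 'rV[R]_m) : R := beta^-1 * lse (fun j => beta * rdot h (bN j)).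

Lemma psi_separates (g : 'rV[R]_n) (h : 'rV[R]_m) :
  psi (0 + \sum_l g ord0 l *: gdir l + \sum_l h ord0 l *: hdir l) =
  q * beta * softmaxA g - q * beta * softmaxB h.
Proof.
set Z := _ + _.
have ZE i j : beta * Z i j = beta * rdot h (bN j) + - (beta * rdot g (aN i)).
  rewrite -mulrN -mulrDr; congr (_ * _).
  rewrite /Z add0r !mxE !summxE addrC; congr (_ + _).
    by apply: eq_bigr => l _; rewrite !mxE.
  by rewrite /rdot -sumrN; apply: eq_bigr => l _; rewrite !mxE mulrN.
rewrite /psi /softminmax.
have -> : (fun i => -1 * lse (fun j => beta * Z i j)) =
    (fun i => beta * rdot g (aN i) + - lse (fun j => beta * rdot h (bN j))).
  apply/funext => i.
  have -> : (fun j => beta * Z i j) =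
     (fun j => beta * rdot h (bN j) + - (beta * rdot g (aN i))).
    by apply/funext => j; exact: ZE.
  by rewrite (lse_shift ord0); ring.
rewrite (lse_shift ord0) /softmaxA /softmaxB.
have bK x : q * beta * (beta^-1 * x) = q * x by rewrite -mulrA mulVKf ?gt_eqF.
by rewrite !bK mulrBr.
Qed.

(** The soft maximum over [bN] is minus a soft-min-max with one row. With q beta = 1 and unit
    vectors its concentration constant is 1, whatever the dimension and the net. *)
Lemma softmaxB_jets : exists2 C, 0 <= C &
  exists l b : 'M[R]_(1, U.+1) -> 'M[R]_(1, U.+1) -> R,
  (forall z, jet2 (@softminmax R 0 U beta^-1 beta) C z (l z) (b z)) /\
  forall z z', \sum_(a <- [seq \matrix_(i < 1, j < U.+1) bN j k 0 | k <- enum 'I_m])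
     l z a * l z' a <= 1.
Proof.
have [C C0 jets] := @softminmax_jets R 0 U beta^-1 beta; exists C => //.
exists (@softminmax_diff R 0 U beta^-1 beta), (@softminmax_hess R 0 U beta^-1 beta).
split => // z z'.
have -> : 1 = (beta^-1 * beta) ^+ 2 * 1 :> R.
  by rewrite mulVf ?expr1n ?mulr1// gt_eqF.
apply: softminmax_diff_gram => i j i' j'.
rewrite /gram big_map big_enum/= (le_trans _ (cdot_le1 (bN1 j) (bN1 j')))//.
by rewrite le_eqVlt; apply/orP; left; apply/eqP; apply: eq_bigr => l _; rewrite !mxE.
Qed.

Lemma softmaxBE (h : 'rV[R]_m) :
  softmaxB h = - softminmax beta^-1 beta
    (0 + \sum_l h ord0 l *: \matrix_(i < 1, j < U.+1) bN j l 0).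
Proof.
rewrite /softminmax lse1 mulN1r mulrN opprK /softmaxB; congr (_ * lse _).
apply/funext => j; congr (_ * _); rewrite add0r summxE.
by apply: eq_bigr => l _; rewrite !mxE.
Qed.

Lemma explip_lse_rdot k (I : finType) (i0 : I) (c : I -> 'cV[R]_k) (b : R) :
  explip (fun h : 'rV[R]_k => lse (fun i => b * rdot h (c i))).
Proof.
have lipc i : linear_form (fun h : 'rV[R]_k => b * rdot h (c i)).
  by move=> x z a; rewrite rdot_lin; ring.
pose K := `|b| * \sum_i \sum_l `|c i l 0|.
have K0 : 0 <= K by rewrite mulr_ge0// sumr_ge0// => i _; exact: sumr_ge0.
have hK i (v : 'rV[R]_k) : `|b * rdot v (c i)| <= K * `|v|.
  rewrite normrM /K -mulrA ler_wpM2l// (le_trans (ler_norm_sum _ _ _))//.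
  apply: (@le_trans _ _ ((\sum_l `|c i l 0|) * `|v|)).
    rewrite mulr_suml; apply: ler_sum => l _.
    by rewrite normrM mulrC ler_wpM2l// mx_entry_le.
  rewrite ler_wpM2r// (bigD1 i)//= lerDl; apply: sumr_ge0 => i' _.
  exact: sumr_ge0.
pose C := (cumulant_const R + 4) * (K + K ^+ 2 + K ^+ 3).
apply: (@lip_explip _ _ _ C).
apply: (@jet2_lip _ _ _ _ _ _) => z.
apply: (jet2_lse i0 (phi := fun i (h : 'rV[R]_k) => b * rdot h (c i))) => // i.
exact: jet2_linear.
Qed.

Lemma explip_softmaxA : explip softmaxA.
Proof. by apply: explipZ; apply: explip_lse_rdot; exact: ord0. Qed.

Lemma explip_softmaxB : explip softmaxB.
Proof. by apply: explipZ; apply: explip_lse_rdot; exact: ord0. Qed.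

Lemma gordon_mean :
  gsmooths gordon_list psi 0 = q * beta * (gmean softmaxA - gmean softmaxB).
Proof.
rewrite /gordon_list gsmooths_cat -gmean_linear_image.
under [X in gmean X]eq_fun do rewrite -gmean_linear_image.
have eA := explip_softmaxA; have eB := explip_softmaxB.
transitivity (gmean (fun g => q * beta * softmaxA g - q * beta * gmean softmaxB)).
  congr gmean; apply/funext => g.
  transitivity (gmean (fun h => q * beta * softmaxA g - q * beta * softmaxB h)).
    by congr gmean; apply/funext => h; exact: psi_separates.
  rewrite gmeanB; [|exact: explip_cst|exact: explipZ].
  by rewrite gmean_cst gmeanZ.
rewrite gmeanB; [|exact: explipZ|exact: explip_cst].
by rewrite gmean_cst gmeanZ// mulrBr.
Qed.

Lemma softmaxB_variance :
  gmean (fun h => (softmaxB h - gmean softmaxB) ^+ 2) <= 4 * expR 1.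
Proof.
have [C C0 [l [b [jets hl]]]] := softmaxB_jets.
have := gaussian_variance C0 ler01 jets hl.
set L := [seq _ | _ <- _].
have -> : gsmooths L (@softminmax R 0 U beta^-1 beta) 0 = - gmean softmaxB.
  rewrite -gmean_linear_image -mulN1r -gmeanZ; last exact: explip_softmaxB.
  by congr gmean; apply/funext => h; rewrite softmaxBE mulN1r opprK.
rewrite -gmean_linear_image; congr (_ <= _); congr gmean; apply/funext => h.
by rewrite [in RHS]softmaxBE -[RHS]sqrrN opprD !opprK.
Qed.

Lemma softmaxB_ge j h : rdot h (bN j) <= softmaxB h.
Proof.
rewrite /softmaxB mulrC ler_pdivlMr// mulrC.
exact: (lse_ge ord0 (fun j => beta * rdot h (bN j))).
Qed.

Lemma softmaxA_le (p : 'rV[R]_n -> R) g : (forall i, rdot g (aN i) <= p g) ->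
  softmaxA g <= p g + beta^-1 * ln M.+1%:R.
Proof.
move=> hp; rewrite /softmaxA.
have := lse_le ord0 (x := fun i => beta * rdot g (aN i)) (c := beta * p g).
rewrite card_ord => /(_ (fun i => ler_wpM2l (ltW beta0) (hp i))) h.
have := ler_wpM2l (_ : 0 <= beta^-1) h; rewrite invr_ge0 (ltW beta0) => /(_ isT).
by rewrite mulrDr mulKf// gt_eqF.
Qed.

End GordonProcess.

(** * The escape bound for sets of unit vectors *)

Section CoreBound.
Variable R : realType.

(** Chooses one small parameter that brings two error terms below given thresholds. *)
Lemma small_factor (X Y a b : R) : 0 <= X -> 0 <= Y -> 0 < a -> 0 < b ->
  exists q, [/\ 0 < q <= 1, q * X <= a & q * Y <= b].
Proof.
move=> X0 Y0 a0 b0; pose s : R := 1 + X / a + Y / b.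
have xa : 0 <= X / a by rewrite divr_ge0 // ltW.
have yb : 0 <= Y / b by rewrite divr_ge0 // ltW.
have s1 : 1 <= s by rewrite /s; lra.
have s0 : 0 < s by lra.
exists s^-1; split.
- by rewrite invr_gt0 s0 invf_le1.
- rewrite mulrC ler_pdivrMr// -ler_pdivrMl// mulrC /s; lra.
- rewrite mulrC ler_pdivrMr// -ler_pdivrMl// mulrC /s; lra.
Qed.

Lemma unit_entry_le1 n (a : 'cV[R]_n) i : sqnorm a = 1 -> `|a i 0| <= 1.
Proof.
move=> a1; rewrite -(@ler_pXn2r _ 2)// ?nnegrE// expr1n real_normK ?num_real//.
rewrite -a1 /sqnorm (bigD1 i)//= lerDl; apply: sumr_ge0 => j _; exact: sqr_ge0.
Qed.

Lemma rdot_net_le k (h : 'rV[R]_k) (b b' : 'cV[R]_k) (eps : R) :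
  (forall j, `|b j 0 - b' j 0| <= eps) -> rdot h b <= rdot h b' + eps * rnorm1 h.
Proof.
move=> hb; rewrite -lerBlDl /rdot -sumrB mulr_sumr; apply: ler_sum => j _.
rewrite -mulrBr (le_trans (ler_norm _))// normrM mulrC ler_wpM2r//.
Qed.

Variables (n m N : nat) (e : 'I_N -> 'I_m * 'I_n) (sg : R).
Hypothesis e_bij : bijective e.
Hypothesis sg2 : sg ^+ 2 = 1.

Lemma bilin_net_le (v : 'rV[R]_N) (b : 'cV[R]_m) (a a' : 'cV[R]_n) (eps : R) :
  sqnorm b = 1 -> (forall j, `|a j 0 - a' j 0| <= eps) ->
  bilin e sg v b a' <= bilin e sg v b a + eps * rnorm1 v.
Proof.
move=> b1 ha; rewrite -lerBlDl /bilin -mulrBr -sumrB.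
have sg1 : `|sg| = 1.
  by apply/eqP; rewrite -(@eqrXn2 _ 2)// expr1n real_normK ?num_real// sg2.
rewrite (le_trans (ler_norm _))// normrM sg1 mul1r (le_trans (ler_norm_sum _ _ _))//.
rewrite mulr_sumr; apply: ler_sum => k _.
rewrite -!mulrBr !normrM mulrC ler_wpM2r//.
rewrite -[eps]mul1r ler_pM// ?unit_entry_le1//.
by rewrite distrC.
Qed.

Variables (A : set 'cV[R]_n) (B : set 'cV[R]_m).
Hypothesis A1 : forall a, A a -> sqnorm a = 1.
Hypothesis B1 : forall b, B b -> sqnorm b = 1.
Variable Good : set 'rV[R]_N.
(** Failure is only asked to give F <= eta for every eta > 0, since the separation argument of the
    second part is approximate. *)
Hypothesis bad : forall v, ~ Good v -> forall eta : R, 0 < eta ->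
  exists2 a, A a & forall b, B b -> bilin e sg v b a <= eta.

Section Net.
Variables (M U : nat) (aN : 'I_M.+1 -> 'cV[R]_n) (bN : 'I_U.+1 -> 'cV[R]_m) (eps : R).
Hypothesis eps0 : 0 < eps.
Hypothesis aNA : forall i, A (aN i).
Hypothesis bNB : forall j, B (bN j).
Hypothesis net_A : forall a, A a -> exists i, forall j, `|a j 0 - aN i j 0| <= eps.
Variables (q lam : R).
Hypothesis q01 : 0 < q <= 1.
Hypothesis lam0 : 0 < lam.
Let beta := lam / q.

Let q0 : 0 < q. Proof. by case/andP: q01. Qed.

Let beta0 : 0 < beta. Proof. exact: divr_gt0. Qed.

Let qbeta : q * beta = lam. Proof. by rewrite /beta mulrC divfK// gt_eqF. Qed.

(** A net point near the bad [a] has a row maximum at most eps (1 + |v|_1). The soft maximum exceeds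
    it by ln(U + 1) / beta, and the soft minimum is no larger than that row. *)
Lemma bad_softminmax v : ~ Good v ->
  - (lam * (eps * (1 + rnorm1 v)) + q * ln U.+1%:R) <=
  softminmax q beta (0 + \sum_k v ord0 k *: mxdir e sg aN bN k).
Proof.
move=> /bad /(_ eps eps0) [a Aa hb].
have [i hi] := net_A Aa.
set z := (0 + \sum_k _).
have zE i' j : z i' j = bilin e sg v (bN j) (aN i').
  rewrite /z add0r summxE /bilin mulr_sumr; apply: eq_bigr => k _.
  by rewrite !mxE; ring.
have zi j : z i j <= eps * (1 + rnorm1 v).
  rewrite zE mulrDr mulr1 (le_trans (bilin_net_le v (B1 (bNB j)) hi))//.
  by rewrite lerD2r hb.
have hl : lse (fun j => beta * z i j) <= beta * (eps * (1 + rnorm1 v)) + ln U.+1%:R.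
  have := lse_le ord0 (x := fun j => beta * z i j) (c := beta * (eps * (1 + rnorm1 v))).
  by rewrite card_ord; apply => j; rewrite ler_wpM2l// ltW.
have := lse_ge ord0 (fun i' => -1 * lse (fun j => beta * z i' j)) i => hg.
rewrite /softminmax -qbeta -mulrA -mulrDr -mulrN ler_wpM2l ?(ltW q0)//.
by apply: le_trans hg; rewrite mulN1r lerN2.
Qed.

(** The indicator of [Good] dominates 1 - exp psi - errors: off [Good], exp psi >= 1 + psi makes
    this difference nonpositive. The expectation of exp psi is then Gordon's bound. *)
Lemma good_prob_ge :
  ((1 - (expR (lam ^+ 2 * 2 + lam * (gmean (softmaxA aN beta) - gmean (softmaxB bN beta))) +
     lam * (eps * (1 + N%:R)) + q * ln U.+1%:R))%:E <=
   gexp (fun v => (\1_Good v)%:E))%E.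
Proof.
pose psi := softminmax q beta : 'M[R]_(M.+1, U.+1) -> R.
pose S (v : 'rV[R]_N) : 'M[R]_(M.+1, U.+1) := 0 + \sum_k v ord0 k *: mxdir e sg aN bN k.
have [C C0 jets] := @softminmax_jets R M U q beta.
have eexp : explip (fun z => expR (psi z)).
  by apply: explip_expR (jet2_lip jets).
have eS : explip (fun v => expR (psi (S v))).
  apply: (explip_comp (f := fun z => expR (psi z)) (T := S)
    (K := \sum_k `|mxdir e sg aN bN k|)) => // v v'.
  rewrite /S !add0r -sumrB (le_trans (ler_norm_sum _ _ _))// mulr_suml.
  apply: ler_sum => k _; rewrite -scalerBl normrZ mulrC ler_wpM2l//.
  by have := mx_entry_le (v - v') ord0 k; rewrite !mxE.
pose r0 v := 1 - (expR (psi (S v)) + lam * (eps * (1 + rnorm1 v)) + q * ln U.+1%:R).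
have lnU : 0 <= ln U.+1%:R :> R by rewrite ln_ge0// ler1n.
have er1 := @explip_rnorm1 R N.
have e1r : explip (fun v : 'rV[R]_N => 1 + rnorm1 v).
  by apply: explipD => //; exact: explip_cst.
have e2 : explip (fun v : 'rV[R]_N => lam * (eps * (1 + rnorm1 v))).
  by apply: explipZ; exact: explipZ.
have e3 : explip (fun v => expR (psi (S v)) + lam * (eps * (1 + rnorm1 v))).
  exact: explipD.
have e4 : explip (fun v => expR (psi (S v)) + lam * (eps * (1 + rnorm1 v)) + q * ln U.+1%:R).
  by apply: explipD => //; exact: explip_cst.
have er0 : explip r0 by apply: explipB => //; exact: explip_cst.
(* Monotonicity of [gexp] holds between nonnegative functions, hence the positive part. *)
apply: (@le_trans _ _ (gexp (fun v => (Num.max 0 (r0 v))%:E))); last first.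
  apply: gexp_le => v; rewrite lee_fin ?le_max ?lexx//.
  have rn0 : 0 <= rnorm1 v by exact: sumr_ge0.
  have x0 : 0 <= lam * (eps * (1 + rnorm1 v)) by rewrite !mulr_ge0 ?addr_ge0 // ltW.
  have qU : 0 <= q * ln U.+1%:R by rewrite mulr_ge0// ltW.
  have ep0 := expR_ge0 (psi (S v)).
  rewrite indicE ge_max; apply/andP; split; first by rewrite ler0n.
  have [/set_mem G|] := boolP (v \in Good).
    rewrite /r0 /=; lra.
  rewrite notin_setE => /bad_softminmax; rewrite -/(S v) -/(psi _) => h.
  have := expR_ge1Dx (psi (S v)); rewrite /r0/=; lra.
rewrite gexp_gmean; last exact: explip_max0.
rewrite lee_fin; apply: le_trans (gmean_le er0 (explip_max0 er0) _); last first.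
  by move=> v; rewrite le_max lexx orbT.
rewrite /r0 gmeanB//; last exact: explip_cst.
rewrite gmean_cst lerD2l lerN2 gmeanD//; last exact: explip_cst.
rewrite gmean_cst lerD2r gmeanD//.
rewrite lerD//.
  rewrite (gmean_linear_image (mxdir e sg aN bN) (fun z => expR (psi z))).
  have := gordon_exp_bound e_bij sg2 (fun i => A1 (aNA i)) (fun j => B1 (bNB j)) beta q01.
  rewrite qbeta gordon_mean// qbeta; exact.
rewrite gmeanZ; last exact: explipZ.
rewrite gmeanZ// ler_wpM2l ?(ltW lam0)// ler_wpM2l ?(ltW eps0)// gmeanD//.
  by rewrite gmean_cst lerD2l gmean_rnorm1.
exact: explip_cst.
Qed.

End Net.

(** The loss c of [gmean_lower], where c^2 = 2 (v + w): v = 4e is the variance bound of the soft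
    maximum and w = 4 bounds the mean square of its discrepancy from [d]. *)
Definition core_loss : R := Num.sqrt (2 * (4 * expR 1 + 4)).

Lemma core_loss_gt0 : 0 < core_loss.
Proof. by rewrite sqrtr_gt0; have := expR_gt0 (1 : R); lra. Qed.

Variables (p : 'rV[R]_n -> R) (d : 'rV[R]_m -> R).
Hypothesis ep : explip (fun g => p g ^+ 2).
Hypothesis ed : explip (fun h => d h ^+ 2).
Hypothesis d0 : forall h, 0 <= d h.
Hypothesis rdot_p : forall a g, A a -> rdot g a <= p g.
Hypothesis rdot_d : forall h, 0 < d h -> exists2 b, B b & d h <= rdot h b.

Lemma softmaxA_mean M (aN : 'I_M.+1 -> 'cV[R]_n) beta : 0 < beta -> (forall i, A (aN i)) ->
  gmean (softmaxA aN beta) <=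
  Num.sqrt (gmean (fun g => p g ^+ 2)) + 1 + beta^-1 * ln M.+1%:R.
Proof.
move=> beta0 aNA; set P : R := gmean (fun g => p g ^+ 2).
have P0 : 0 <= P by apply: gmean_ge0 => // v; exact: sqr_ge0.
(* The bound p <= (p^2 + s^2) / (2s) needs s > 0 even if P = 0, hence the added 1. *)
set s : R := Num.sqrt P + 1.
have s0 : 0 < s by rewrite /s ltr_wpDl// sqrtr_ge0.
set L : R := beta^-1 * _.
have es : explip (fun g => (2 * s)^-1 * (p g ^+ 2 + s ^+ 2)).
  by apply: explipZ; apply: explipD => //; exact: explip_cst.
apply: (@le_trans _ _ (gmean (fun g => (2 * s)^-1 * (p g ^+ 2 + s ^+ 2) + L))).
  apply: gmean_le; first exact: explip_softmaxA.
    by apply: explipD => //; exact: explip_cst.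
  move=> g; rewrite (le_trans (softmaxA_le beta0 (p := p) (g := g) _))//.
    by move=> i; exact: rdot_p.
  rewrite lerD2r mulrC ler_pdivlMr ?mulr_gt0//.
  by have := sqr_ge0 (p g - s); lra.
rewrite gmeanD//; last exact: explip_cst.
rewrite gmean_cst lerD2r gmeanZ; last by apply: explipD => //; exact: explip_cst.
rewrite gmeanD//; last exact: explip_cst.
rewrite gmean_cst -/P mulrC ler_pdivrMr ?mulr_gt0//.
have : P <= s ^+ 2.
  by rewrite -[P in leLHS]sqr_sqrtr// lerXn2r ?nnegrE ?sqrtr_ge0 ?(ltW s0)// /s lerDl.
by rewrite expr2 => h; lra.
Qed.

Lemma softmaxB_mean U (bN : 'I_U.+1 -> 'cV[R]_m) beta eps : 0 < beta -> 0 < eps ->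
  eps * m%:R <= 1 -> (forall j, B (bN j)) ->
  (forall b, B b -> exists i, forall j, `|b j 0 - bN i j 0| <= eps) ->
  core_loss < Num.sqrt (gmean (fun h => d h ^+ 2)) ->
  Num.sqrt (gmean (fun h => d h ^+ 2)) - core_loss <= gmean (softmaxB bN beta).
Proof.
move=> beta0 eps0 em bNB net_B.
(* The first term is the net error where d > 0; the second covers d = 0, where the soft maximum may
   be negative. The mean square is at most 2 (1 + 1). *)
pose f (h : 'rV[R]_m) := eps * rnorm1 h + `|rdot h (bN ord0)|.
have er1 := @explip_rnorm1 R m.
have e1 : explip (fun h : 'rV[R]_m => eps * rnorm1 h) by exact: explipZ.
have erd := explip_rdot (bN ord0).
have ef : explip f by apply: explipD => //; exact: explip_abs.
have rn0 (h : 'rV[R]_m) : 0 <= rnorm1 h by exact: sumr_ge0.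
apply: (@gmean_lower _ _ _ d f (4 * expR 1) 4) => //.
- exact: explip_softmaxB.
- by move=> h; rewrite addr_ge0// mulr_ge0// ltW.
- move=> h; have := d0 h; rewrite le_eqVlt => /orP[/eqP <-|/rdot_d[b Bb db]].
    have := softmaxB_ge bN beta0 ord0 h.
    have := ler_norm (- rdot h (bN ord0)); rewrite normrN.
    by have := mulr_ge0 (ltW eps0) (rn0 h); rewrite /f; lra.
  have [i hi] := net_B b Bb.
  have := rdot_net_le h hi; have := softmaxB_ge bN beta0 i h.
  by have := normr_ge0 (rdot h (bN ord0)); rewrite /f; lra.
- by apply: softmaxB_variance => // j; exact/B1.
- have es : explip (fun h : 'rV[R]_m => rnorm1 h ^+ 2) by exact: explip_sqr.
  have er : explip (fun h => rdot h (bN ord0) ^+ 2) by exact: explip_sqr.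
  have ees : explip (fun h : 'rV[R]_m => eps ^+ 2 * rnorm1 h ^+ 2) by exact: explipZ.
  apply: (@le_trans _ _ (gmean (fun h =>
      2 * (eps ^+ 2 * rnorm1 h ^+ 2 + rdot h (bN ord0) ^+ 2)))).
    apply: gmean_le; first exact: explip_sqr.
      by apply: explipZ; exact: explipD.
    move=> h; rewrite /f -[rdot h _ ^+ 2]real_normK ?num_real// -exprMn.
    by have := sqr_ge0 (eps * rnorm1 h - `|rdot h (bN ord0)|); lra.
  rewrite gmeanZ; last exact: explipD.
  rewrite gmeanD// gmeanZ// gmean_rdot_sqr B1//.
  have h1 : eps ^+ 2 * gmean (fun h : 'rV[R]_m => rnorm1 h ^+ 2) <= 1.
    rewrite (le_trans (ler_wpM2l (sqr_ge0 _) (gmean_rnorm1_sqr R m)))// -exprMn.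
    by rewrite expr_le1// mulr_ge0// ltW.
  by lra.
- exact: core_loss_gt0.
- by rewrite sqr_sqrtr//; have := expR_gt0 (1 : R); lra.
Qed.

(** Used with lam = sqrt t. The exponent is driven down to -2t rather than -t, so that exp(-t) -
    exp(-2t) is left to absorb the errors of the nets and of the softening. *)
Theorem gordon_core t : 1 <= t ->
  (core_loss + 6) * Num.sqrt t <=
    Num.sqrt (gmean (fun h => d h ^+ 2)) - Num.sqrt (gmean (fun g => p g ^+ 2)) ->
  ((1 - expR (- t))%:E <= gexp (fun v => (\1_Good v)%:E))%E.
Proof.
move=> t1; set s : R := Num.sqrt t.
set D : R := Num.sqrt (gmean (fun h => d h ^+ 2)); set P : R := Num.sqrt _ => hDP.
set c := core_loss in hDP *; have c0 : 0 < c := core_loss_gt0.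
have P0 : 0 <= P by exact: sqrtr_ge0.
have s0 : 0 <= s by exact: sqrtr_ge0.
have ss : s ^+ 2 = t by rewrite sqr_sqrtr//; lra.
have s1 : 1 <= s by rewrite -sqrtr1 ler_wsqrtr.
have spos : 0 < s by lra.
have cD : c < D.
  by have := ler_wpM2l (ltW c0) s1; lra.
(* If [A] is empty no [v] can be bad, so the event is certain. *)
have [A0|/set0P/negP/negPn/eqP A0] := pselect (A !=set0); last first.
  have GT v : Good v.
    by apply: contrapT => /bad /(_ 1 ltr01)[a]; rewrite A0.
  have -> : (fun v => (\1_Good v)%:E) = (fun _ : 'rV[R]_N => (1:R)%:E).
    by apply/funext => v; rewrite indicE mem_set.
  rewrite gexp_gmean; last exact: explip_cst.
  by rewrite gmean_cst lee_fin gerBl expR_ge0.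
(* If [B] were empty, [d] would vanish identically, against c < D. *)
have B0 : B !=set0.
  apply: contrapT => B0.
  have dz h : d h = 0.
    apply/eqP; rewrite eq_le d0 andbT leNgt; apply/negP => /rdot_d[b Bb _].
    by apply: B0; exists b.
  move: cD; rewrite /D.
  have -> : (fun h => d h ^+ 2) = (fun=> 0) by apply/funext => h; rewrite dz expr0n.
  by rewrite gmean_cst sqrtr0; lra.
pose kap : R := expR (- t) - expR (- (2 * t)).
have kap0 : 0 < kap by rewrite subr_gt0 ltr_expR; lra.
have k20 : 0 < kap / 2 by lra.
have sN0 : 0 <= s * (1 + N%:R) by rewrite mulr_ge0// addr_ge0.
have [eps [/andP[eps0 _] epsN epsm]] := small_factor sN0 (ler0n R m) k20 ltr01.
have [M [aN [aNA net_A]]] := finite_net eps0 A0 (fun a i Aa => unit_entry_le1 i (A1 Aa)).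
have [U [bN [bNB net_B]]] := finite_net eps0 B0 (fun b i Bb => unit_entry_le1 i (B1 Bb)).
have lnM : 0 <= ln M.+1%:R :> R by rewrite ln_ge0// ler1n.
have lnU : 0 <= ln U.+1%:R :> R by rewrite ln_ge0// ler1n.
have [q [q01 qU qM]] := small_factor lnU lnM k20 ltr01.
have [q0 _] := andP q01.
pose beta := s / q.
have beta0 : 0 < beta by exact: divr_gt0.
have := good_prob_ge eps0 aNA bNB net_A q01 spos.
apply: le_trans; rewrite lee_fin lerD2l lerN2 -/beta.
have hA := softmaxA_mean beta0 aNA; rewrite -/P in hA.
have hB := softmaxB_mean beta0 eps0 epsm bNB net_B cD; rewrite -/D -/c in hB.
have sb : s * (beta^-1 * ln M.+1%:R) = q * ln M.+1%:R.
  by rewrite mulrA /beta invf_div mulrCA divff ?mulr1// gt_eqF.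
set mA := gmean _ in hA *; set mB := gmean _ in hB *.
(* This consumes the constant 6: 2t from the concentration term, s <= t from [softmaxA_mean], q ln(M
   + 1) <= 1 <= t, and 2t as the target. The loss s c is covered by c t. *)
have hexp : s ^+ 2 * 2 + s * (mA - mB) <= - (2 * t).
  have : s * (mA - mB) <= s * (P + 1 + beta^-1 * ln M.+1%:R - D + c).
    by rewrite ler_wpM2l//; lra.
  have -> : s * (P + 1 + beta^-1 * ln M.+1%:R - D + c) =
     s * (P - D) + s + q * ln M.+1%:R + s * c by rewrite -sb; ring.
  have : s * (P - D) <= s * (- ((c + 6) * s)) by rewrite ler_wpM2l//; lra.
  have -> : s * (- ((c + 6) * s)) = - (c * t) - 6 * t by rewrite -ss; ring.
  have st : s <= t by rewrite -ss expr2 ler_peMl.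
  have : s * c <= c * t by rewrite mulrC ler_pM2l.
  by rewrite ss; lra.
have : expR (s ^+ 2 * 2 + s * (mA - mB)) <= expR (- (2 * t)) by rewrite ler_expR.
have -> : s * (eps * (1 + N%:R)) = eps * (s * (1 + N%:R)) by ring.
by move: epsN qU; rewrite /kap; lra.
Qed.

End CoreBound.

(** * Convex cones *)

Section Euclidean.
Variables (R : realType) (n : nat).
Implicit Types (u v w : 'cV[R]_n) (s : R).

Lemma cdotC u v : cdot u v = cdot v u.
Proof. by apply: eq_bigr => i _; rewrite mulrC. Qed.

Lemma cdotDl u v w : cdot (u + v) w = cdot u w + cdot v w.
Proof. by rewrite /cdot -big_split/=; apply: eq_bigr => i _; rewrite !mxE mulrDl. Qed.

Lemma cdotZl s u v : cdot (s *: u) v = s * cdot u v.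
Proof. by rewrite /cdot mulr_sumr; apply: eq_bigr => i _; rewrite !mxE mulrA. Qed.

Lemma cdotDr u v w : cdot u (v + w) = cdot u v + cdot u w.
Proof. by rewrite !(cdotC u) cdotDl. Qed.

Lemma cdotZr s u v : cdot u (s *: v) = s * cdot u v.
Proof. by rewrite !(cdotC u) cdotZl. Qed.

Lemma cdotNl u v : cdot (- u) v = - cdot u v.
Proof. by rewrite -scaleN1r cdotZl mulN1r. Qed.

Lemma cdotNr u v : cdot u (- v) = - cdot u v.
Proof. by rewrite !(cdotC u) cdotNl. Qed.

Lemma cdot0l v : cdot 0 v = 0.
Proof. by rewrite -(scale0r v) cdotZl mul0r. Qed.

Lemma sqnormDZ u v s : sqnorm (u + s *: v) = sqnorm u + 2 * s * cdot u v + s ^+ 2 * sqnorm v.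
Proof. by rewrite -!cdotnn cdotDl !cdotDr !cdotZl !cdotZr (cdotC v u); ring. Qed.

Lemma sqnormZ s u : sqnorm (s *: u) = s ^+ 2 * sqnorm u.
Proof. by rewrite -!cdotnn cdotZl cdotZr mulrA. Qed.

Lemma sqnorm_ge0 u : 0 <= sqnorm u.
Proof. by apply: sumr_ge0 => i _; exact: sqr_ge0. Qed.

Lemma entry_sqr_le u i : u i 0 ^+ 2 <= sqnorm u.
Proof.
by rewrite /sqnorm (bigD1 i)//= lerDl; apply: sumr_ge0 => j _; exact: sqr_ge0.
Qed.

Lemma sqnorm_eq0 u : sqnorm u = 0 -> u = 0.
Proof.
move=> u0; apply/matrixP => i j; rewrite (ord1 j) mxE; apply/eqP.
by rewrite -sqrf_eq0 eq_le sqr_ge0 andbT -u0 entry_sqr_le.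
Qed.

Lemma sqnorm_gt0 u : u <> 0 -> 0 < sqnorm u.
Proof.
move=> u0; rewrite lt_neqAle sqnorm_ge0 andbT eq_sym; apply/eqP.
by move=> /sqnorm_eq0.
Qed.

(** Kept apart from the norm of column vectors as a normed module, which is the max norm. *)
Definition enorm u : R := Num.sqrt (sqnorm u).

Lemma enorm_ge0 u : 0 <= enorm u. Proof. exact: sqrtr_ge0. Qed.

Lemma sqr_enorm u : enorm u ^+ 2 = sqnorm u.
Proof. by rewrite sqr_sqrtr// sqnorm_ge0. Qed.

Lemma enorm_gt0 u : u <> 0 -> 0 < enorm u.
Proof. by move=> u0; rewrite sqrtr_gt0 sqnorm_gt0. Qed.

Lemma sqnorm_normalize u : u <> 0 -> sqnorm ((enorm u)^-1 *: u) = 1.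
Proof.
move=> u0; have := enorm_gt0 u0 => e0.
by rewrite sqnormZ -sqr_enorm -exprMn mulVf ?expr1n// gt_eqF.
Qed.

Lemma cdot_le_enorm u v : cdot u v <= enorm u * enorm v.
Proof.
have [->|/eqP u0] := eqVneq u 0; first by rewrite cdot0l mulr_ge0// enorm_ge0.
have [->|/eqP v0] := eqVneq v 0.
  by rewrite cdotC cdot0l mulr_ge0// enorm_ge0.
have := cdot_le1 (sqnorm_normalize u0) (sqnorm_normalize v0).
have := enorm_gt0 u0 => eu; have := enorm_gt0 v0 => ev.
by rewrite cdotZl cdotZr mulrA -invfM mulrC ler_pdivrMr ?mulr_gt0// mul1r.
Qed.

End Euclidean.

Local Notation proj := Defs.proj.

(** * Metric projection onto a closed convex cone *)

Section Projection.
Variables (R : realType) (n : nat).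
Implicit Types (y mu nu : 'cV[R]_n).

Lemma mx_norm_le m k (M : 'M[R]_(m, k)) (c : R) : 0 <= c ->
  (forall i j, `|M i j| <= c) -> `|M| <= c.
Proof.
by move=> c0 hM; rewrite [leLHS]/Num.norm/= mx_normrE; apply/bigmax_leP; split => // -[].
Qed.

Lemma sqnorm_le_norm (u : 'cV[R]_n) : sqnorm u <= n%:R * `|u| ^+ 2.
Proof.
apply: (@le_trans _ _ (\sum_(i < n) `|u| ^+ 2)).
  apply: ler_sum => i _; rewrite -[u i 0 ^+ 2]real_normK ?num_real//.
  by rewrite lerXn2r ?nnegrE// mx_entry_le.
by rewrite sumr_const card_ord mulr_natl.
Qed.

Lemma explip_entry m k i j : explip (fun M : 'M[R]_(m, k) => M i j).
Proof.
apply: (@lip_explip _ _ _ 1) => M M'; rewrite mul1r.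
by have := mx_entry_le (M - M') i j; rewrite !mxE.
Qed.

Lemma explip_sqnorm (V : normedModType R) (F : V -> 'cV[R]_n) :
  (forall i, explip (fun v => F v i 0)) -> explip (fun v => sqnorm (F v)).
Proof. by move=> hF; apply: explip_sum => i; exact: explip_sqr. Qed.

Lemma lip_trmx (v w : 'rV[R]_n) : `|v^T - w^T| <= 1 * `|v - w|.
Proof.
rewrite mul1r; apply: mx_norm_le => // i j.
by rewrite -linearB/= mxE mx_entry_le.
Qed.

Lemma lip_continuous (V W : normedModType R) (T : V -> W) (C : R) :
  (forall v w, `|T v - T w| <= C * `|v - w|) -> continuous T.
Proof.
move=> hT v; apply/cvgrPdist_le => eps eps0.
have K0 : 0 < `|C| + 1 by rewrite ltr_wpDl.
near=> w; rewrite (le_trans (hT _ _))//.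
apply: (@le_trans _ _ ((`|C| + 1) * `|v - w|)).
  by rewrite ler_wpM2r// (le_trans (ler_norm C))// lerDl.
rewrite -ler_pdivlMl//; near: w.
by apply: cvgr_dist_le => //; rewrite mulr_gt0// invr_gt0.
Unshelve. all: by end_near. Qed.

(** The sublevel set of f(x0) within [K] is bounded and closed. Transposition moves it to row
    vectors, where the compactness criterion is applied. *)
Lemma closed_min (K : set 'cV[R]_n) (f : 'cV[R]_n -> R) (r : R) x0 :
  closed K -> K x0 -> explip f -> (forall x, K x -> f x <= f x0 -> sqnorm x <= r) ->
  exists2 c, K c & forall x, K x -> f c <= f x.
Proof.
move=> cK Kx0 ef hr.
have ctr := lip_continuous lip_trmx.
have esq : explip (fun x : 'cV[R]_n => sqnorm x).
  by apply: explip_sqnorm => i; exact: explip_entry.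
pose A : set 'rV[R]_n := [set v | K v^T] `&` [set v | sqnorm v^T <= r].
have cA : compact A.
  apply: bounded_closed_compact.
    exists (1 + r); split; first exact: num_real.
    move=> x rx v [_ vr]; apply: (@le_trans _ _ (1 + r)); last exact: ltW.
    have r0 : 0 <= r by exact: le_trans (sqnorm_ge0 _) vr.
    apply: mx_norm_le => [|i j]; first by lra.
    have h : v i j ^+ 2 <= r.
      by rewrite (le_trans _ vr)// (le_trans _ (entry_sqr_le v^T j))// mxE (ord1 i).
    have : `|v i j| ^+ 2 <= r by rewrite real_normK ?num_real.
    by have := sqr_ge0 (`|v i j| - 1); lra.
  apply: closedI; first exact: (preimage_closed (fun v _ => ctr v)).
  apply: (@preimage_closed _ _ (fun v : 'rV[R]_n => sqnorm v^T) [set x | x <= r]).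
    by move=> v _; apply: continuous_comp; [exact: ctr|exact: explip_continuous].
  exact: closed_le.
have A0 : A !=set0 by exists x0^T; split; rewrite /= trmxK//; exact: hr.
have [|c /set_mem[Kc _] hc] := compact_EVT_min (f := fun v : 'rV[R]_n => f v^T) A0 cA.
  apply: continuous_subspaceT => v.
  by apply: continuous_comp; [exact: ctr|exact: explip_continuous].
exists c^T => // x Kx; have [xx0|xx0] := leP (f x) (f x0).
  have Ax : A x^T by split; rewrite /= trmxK//; exact: hr.
  by have := hc _ (mem_set Ax); rewrite trmxK.
apply: le_trans (ltW xx0).
have Ax : A x0^T by split; rewrite /= trmxK//; exact: hr.
by have := hc _ (mem_set Ax); rewrite trmxK.
Qed.

(** The passage s -> 0 in first-order optimality conditions, after division by s. *)
Lemma le0_linear_bound (c M : R) : (forall s, 0 < s -> s <= 1 -> c <= s * M) -> c <= 0.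
Proof.
move=> h; rewrite leNgt; apply/negP => c0.
have M0 : 0 < M by have := h 1 ltr01 (lexx _); rewrite mul1r; exact: lt_le_trans.
pose s : R := c / (2 * (M + c)).
have s0 : 0 < s by rewrite divr_gt0//; lra.
have s1 : s <= 1 by rewrite ler_pdivrMr; lra.
have := h s s0 s1; rewrite /s mulrAC ler_pdivlMr; last by lra.
by have : 0 < c * M by [exact: mulr_gt0]; have : 0 < c * c by [exact: mulr_gt0]; lra.
Qed.

Variable K : set 'cV[R]_n.
Hypothesis coneK : closed_convex_cone K.

Lemma coneZ s x : 0 <= s -> K x -> K (s *: x).
Proof. by case: coneK => _ _ h _ s0 Kx; exact: h. Qed.

Lemma coneD x y : K x -> K y -> K (x + y).
Proof.
move=> Kx Ky; have [_ _ _ h] := coneK.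
have := coneZ (ler0n _ 2) (h x y 2^-1 Kx Ky _).
rewrite scalerDr !scalerA.
have -> : 2%:R * (1 - 2^-1) = 1 :> R by lra.
have -> : 2%:R * 2^-1 = 1 :> R by lra.
rewrite !scale1r; apply.
by apply/andP; split; lra.
Qed.

Lemma projP y : K (proj K y) /\
  forall nu, K nu -> sqnorm (y - proj K y) <= sqnorm (y - nu).
Proof.
rewrite /proj; case: xgetP => [mu _ //|noproj]; exfalso.
have [cK K0 _ _] := coneK.
(* If |y - x| <= |y| then |x| <= 2|y|, which is the radius; the comparison point 0 lies in the
   cone. *)
have [||c Kc hc] := @closed_min K (fun x => sqnorm (y - x)) (4 * sqnorm y) 0 cK K0.
- apply: explip_sqnorm => i; under eq_fun do rewrite !mxE.
  by apply: explipB; [exact: explip_cst|exact: explip_entry].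
- move=> x _; rewrite subr0 => h.
  have -> : x = y + (-1) *: (y - x) by rewrite scaleN1r opprB addrC subrK.
  rewrite sqnormDZ.
  have := sqnorm_ge0 (y + 1 *: (y - x)); rewrite sqnormDZ; lra.
by have := noproj c; apply.
Qed.

Lemma proj_mem y : K (proj K y). Proof. by case: (projP y). Qed.

Lemma proj_min y nu : K nu -> sqnorm (y - proj K y) <= sqnorm (y - nu).
Proof. by case: (projP y) => _; exact. Qed.

(** First-order optimality along proj(y) + s nu, which stays in the cone: the residual lies in the
    polar cone. *)
Lemma proj_cdot_le0 y nu : K nu -> cdot (y - proj K y) nu <= 0.
Proof.
move=> Kn; set r := y - _.
suff : 2 * cdot r nu <= 0 by lra.
apply: (@le0_linear_bound _ (sqnorm nu)) => s s0 _.
have := proj_min y (coneD (proj_mem y) (coneZ (ltW s0) Kn)).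
rewrite opprD addrA -/r -scaleNr sqnormDZ.
by rewrite -subr_ge0 => h; rewrite -(ler_pM2l s0) -subr_ge0; apply: le_trans h _; lra.
Qed.

(** The reverse inequality comes from shrinking the projection to (1 - s) proj(y). *)
Lemma proj_cdot_self y : cdot (y - proj K y) (proj K y) = 0.
Proof.
apply/eqP; rewrite eq_le proj_cdot_le0/=; last exact: proj_mem.
set P := proj K y; set r := y - _.
suff : - (2 * cdot r P) <= 0 by lra.
apply: (@le0_linear_bound _ (sqnorm P)) => s s0 s1.
have s1' : 0 <= 1 - s by rewrite subr_ge0.
have := proj_min y (coneZ s1' (proj_mem y)).
rewrite -/P scalerBl scale1r opprB [s *: P - P]addrC addrA -/r sqnormDZ.
by rewrite -subr_ge0 => h; rewrite -(ler_pM2l s0) -subr_ge0; apply: le_trans h _; lra.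
Qed.

Lemma cdot_proj y : cdot y (proj K y) = sqnorm (proj K y).
Proof.
by apply/eqP; rewrite -subr_eq0 -cdotnn -cdotNl -cdotDl proj_cdot_self.
Qed.

Lemma cdot_proj_compl y : cdot y (y - proj K y) = sqnorm (y - proj K y).
Proof.
apply/eqP; rewrite -subr_eq0 -cdotnn -cdotNl -cdotDl opprB addrC subrK.
by rewrite cdotC proj_cdot_self.
Qed.

Lemma proj_pythagoras y : sqnorm (y - proj K y) = sqnorm y - sqnorm (proj K y).
Proof.
by rewrite -cdot_proj_compl cdotDr cdotNr cdot_proj cdotnn.
Qed.

(** Combine the polar inequalities at [y] and [z], and use that (y - z) - (P - Q) has nonnegative
    square norm. This is what brings projections into the [explip] class. *)
Lemma proj_nonexpansive y z :
  sqnorm (proj K y - proj K z) <= sqnorm (y - z).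
Proof.
have := proj_cdot_le0 y (proj_mem z); have := proj_cdot_le0 z (proj_mem y).
have := proj_cdot_self y; have := proj_cdot_self z.
set P := proj K y; set Q := proj K z.
have := sqnorm_ge0 ((y - z) + (-1) *: (P - Q)); rewrite sqnormDZ.
rewrite -!cdotnn !(cdotDl, cdotDr, cdotNl, cdotNr).
rewrite (cdotC Q P) (cdotC z y); lra.
Qed.

Lemma explip_proj_entry i : explip (fun y => proj K y i 0).
Proof.
(* Comparing Euclidean and max norms costs sqrt n, and n + 1 is a convenient upper bound for it. *)
apply: (@lip_explip _ _ _ n.+1%:R) => y z.
have h : `|proj K y i 0 - proj K z i 0| ^+ 2 <= (n.+1%:R * `|y - z|) ^+ 2.
  rewrite real_normK ?num_real//.
  have := entry_sqr_le (proj K y - proj K z) i; rewrite !mxE => /le_trans; apply.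
  rewrite (le_trans (proj_nonexpansive _ _))// (le_trans (sqnorm_le_norm _))//.
  rewrite exprMn ler_wpM2r ?sqr_ge0// -natrX ler_nat.
  by rewrite -mulnn (leq_trans (leqnSn n))// leq_pmulr.
by move: h; rewrite ler_pXn2r// nnegrE// mulr_ge0.
Qed.

End Projection.

(** * Unit vectors of a cone and of its polar *)

Section ConeSpheres.
Variables (R : realType) (n : nat).
Implicit Types (K : set 'cV[R]_n) (g : 'rV[R]_n).

Definition sphere K : set 'cV[R]_n := [set a | K a /\ sqnorm a = 1].

Definition polar_sphere K : set 'cV[R]_n :=
  [set b | (forall nu, K nu -> cdot b nu <= 0) /\ sqnorm b = 1].

Lemma rdotE g (a : 'cV[R]_n) : rdot g a = cdot g^T a.
Proof. by apply: eq_bigr => i _; rewrite mxE. Qed.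

Lemma explip_tr (f : 'cV[R]_n -> R) : explip f -> explip (fun g : 'rV[R]_n => f g^T).
Proof. exact/explip_comp/lip_trmx. Qed.

Lemma explip_cdot (a : 'cV[R]_n) : explip (fun x => cdot a x).
Proof.
by apply: explip_sum => i; apply: explipM; [exact: explip_cst|exact: explip_entry].
Qed.

Lemma gmean_sqnorm_tr : gmean (fun g : 'rV[R]_n => sqnorm g^T) = n%:R.
Proof.
transitivity (gmean (fun g : 'rV[R]_n => \sum_i g ord0 i ^+ 2)).
  by congr gmean; apply/funext => g; apply: eq_bigr => i _; rewrite mxE.
rewrite gmean_sum; last by move=> i; apply: explip_sqr; exact: row_entry_explip.
by under eq_bigr do rewrite gmean_entry_sqr; rewrite sumr_const card_ord.
Qed.

Lemma enorm_scaled_self (u : 'cV[R]_n) : 0 < enorm u -> (enorm u)^-1 * sqnorm u = enorm u.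
Proof. by move=> u0; rewrite -sqr_enorm expr2 mulKf// gt_eqF. Qed.

Lemma enorm_neq0 (u : 'cV[R]_n) : 0 < enorm u -> u <> 0.
Proof.
by move=> + u0; rewrite u0 /enorm -cdotnn cdot0l sqrtr0 ltxx.
Qed.

Lemma enorm1 (u : 'cV[R]_n) : sqnorm u = 1 -> enorm u = 1.
Proof. by rewrite /enorm => ->; rewrite sqrtr1. Qed.

Variable K : set 'cV[R]_n.
Hypothesis coneK : closed_convex_cone K.

Lemma explip_sqnorm_proj : explip (fun g : 'rV[R]_n => sqnorm (proj K g^T)).
Proof.
apply: (explip_tr (f := fun y => sqnorm (proj K y))).
by apply: explip_sqnorm => i; exact: explip_proj_entry.
Qed.

Lemma explip_sqnorm_residual : explip (fun g : 'rV[R]_n => sqnorm (g^T - proj K g^T)).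
Proof.
apply: (explip_tr (f := fun y => sqnorm (y - proj K y))).
apply: explip_sqnorm => i; under eq_fun do rewrite !mxE.
by apply: explipB; [exact: explip_entry|exact: explip_proj_entry].
Qed.

Lemma stat_dimE : fine (stat_dim K) = gmean (fun g => sqnorm (proj K g^T)).
Proof. by rewrite /stat_dim gexp_gmean//; exact: explip_sqnorm_proj. Qed.

(** By Pythagoras the codimension is the mean square distance to the cone, the form in which it
    enters Gordon's bound. *)
Lemma stat_codimE : n%:R - fine (stat_dim K) = gmean (fun g => sqnorm (g^T - proj K g^T)).
Proof.
rewrite stat_dimE -gmean_sqnorm_tr -gmeanB.
- by congr gmean; apply/funext => g; rewrite proj_pythagoras.
- apply: (explip_tr (f := fun y => sqnorm y)).
  by apply: explip_sqnorm => i; exact: explip_entry.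
- exact: explip_sqnorm_proj.
Qed.

(** In g = projection + residual, the residual pairs nonpositively with the cone, and Cauchy-Schwarz
    bounds the rest. *)
Lemma rdot_sphere_le a g : sphere K a -> rdot g a <= enorm (proj K g^T).
Proof.
move=> [Ka a1]; rewrite rdotE -[g^T in leLHS](subrK (proj K g^T)) cdotDl.
have := proj_cdot_le0 coneK g^T Ka; have := cdot_le_enorm (proj K g^T) a.
by rewrite (enorm1 a1) mulr1; lra.
Qed.

Lemma rdot_polar_le b g : polar_sphere K b -> rdot g b <= enorm (g^T - proj K g^T).
Proof.
move=> [Kb b1]; rewrite rdotE -[g^T in leLHS](subrK (proj K g^T)) cdotDl.
have := Kb _ (proj_mem coneK g^T); have := cdot_le_enorm (g^T - proj K g^T) b.
by rewrite (enorm1 b1) mulr1 (cdotC b); lra.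
Qed.

Lemma enorm_proj_attained g : 0 < enorm (proj K g^T) ->
  exists2 a, sphere K a & enorm (proj K g^T) <= rdot g a.
Proof.
move=> P0; exists ((enorm (proj K g^T))^-1 *: proj K g^T).
  split; last exact/sqnorm_normalize/enorm_neq0.
  by apply: coneZ => //; [rewrite invr_ge0 enorm_ge0|exact: proj_mem].
by rewrite rdotE cdotZr cdot_proj// enorm_scaled_self.
Qed.

Lemma enorm_residual_attained g : 0 < enorm (g^T - proj K g^T) ->
  exists2 b, polar_sphere K b & enorm (g^T - proj K g^T) <= rdot g b.
Proof.
move=> P0; exists ((enorm (g^T - proj K g^T))^-1 *: (g^T - proj K g^T)).
  split; last exact/sqnorm_normalize/enorm_neq0.
  move=> nu Kn; rewrite cdotZl pmulr_rle0 ?invr_gt0//.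
  exact: proj_cdot_le0.
by rewrite rdotE cdotZr cdot_proj_compl// enorm_scaled_self.
Qed.

Lemma explip_closed_le (f : 'cV[R]_n -> R) c : explip f -> closed [set x | f x <= c].
Proof.
move=> ef; apply: (@preimage_closed _ _ f [set x | x <= c]) => [x _|].
  exact: explip_continuous.
exact: closed_le.
Qed.

Lemma half_cone a : closed_convex_cone (K `&` [set x | 0 <= cdot a x]).
Proof.
have [cK K0 KZ Kcvx] := coneK; split.
- apply: closedI => //.
  have -> : [set x | 0 <= cdot a x] = [set x | - cdot a x <= 0].
    by apply/funext => x /=; rewrite oppr_le0.
  by apply: explip_closed_le; apply: explipN; exact: explip_cdot.
- by split => //=; rewrite cdotC cdot0l.
- by move=> x l [Kx ax] l0; split; [exact: KZ|rewrite /= cdotZr mulr_ge0].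
- move=> x y l [Kx ax] [Ky ay] l01; split; first exact: Kcvx.
  have /andP[l0 l1] := l01.
  by rewrite /= cdotDr !cdotZr addr_ge0// mulr_ge0// subr_ge0.
Qed.

(* Moving [proj K y] along [a] to the boundary of the half-space costs at most [<y, a>^2]. *)
Lemma half_cone_residual a y : K a -> sqnorm a = 1 ->
  sqnorm (y - proj (K `&` [set x | 0 <= cdot a x]) y) <=
  sqnorm (y - proj K y) + cdot y a ^+ 2.
Proof.
move=> Ka a1; set x := proj K y; have Kx : K x := proj_mem coneK y.
have [ax|ax] := leP 0 (cdot a x).
  by apply: le_trans (proj_min (half_cone a) _ (_ : _ x)) _; rewrite ?lerDl ?sqr_ge0.
have s0 : 0 <= - cdot a x by rewrite oppr_ge0 ltW.
have hx : (K `&` [set z | 0 <= cdot a z]) (x + (- cdot a x) *: a).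
  split; first by apply: coneD => //; exact: coneZ.
  by rewrite /= cdotDr cdotZr cdotnn a1 mulr1 subrr.
apply: le_trans (proj_min (half_cone a) y hx) _.
rewrite opprD addrA -scaleNr opprK sqnormDZ a1 mulr1 cdotDl cdotNl (cdotC x).
by have := sqr_ge0 (cdot y a - cdot a x); lra.
Qed.

(** The added 1 is the second moment of <g, a> for the unit vector [a]. *)
Lemma half_cone_codim a : K a -> sqnorm a = 1 ->
  gmean (fun g => sqnorm (g^T - proj (K `&` [set x | 0 <= cdot a x]) g^T)) <=
  n%:R - fine (stat_dim K) + 1.
Proof.
move=> Ka a1; have er : explip (fun g : 'rV[R]_n => rdot g a ^+ 2).
  by apply: explip_sqr; exact: explip_rdot.
rewrite stat_codimE -[X in _ <= _ + X]a1 -gmean_rdot_sqr -gmeanD//; last first.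
  exact: explip_sqnorm_residual.
apply: gmean_le.
- apply: (explip_tr (f := fun y => sqnorm (y - proj (K `&` [set x | 0 <= cdot a x]) y))).
  apply: explip_sqnorm => i; under eq_fun do rewrite !mxE.
  by apply: explipB; [exact: explip_entry|exact/explip_proj_entry/half_cone].
- by apply: explipD => //; exact: explip_sqnorm_residual.
- by move=> g; rewrite rdotE; exact: half_cone_residual.
Qed.

End ConeSpheres.

(** * Approximate separation of a cone from a translated image *)

Section Separation.
Variables (R : realType) (n m : nat).

Lemma lip_mulmx (G : 'M[R]_(m, n)) (a : 'cV[R]_m) (k k' : 'cV[R]_n) :
  `|(G *m k - a) - (G *m k' - a)| <= (\sum_i \sum_j `|G i j|) * `|k - k'|.
Proof.
rewrite opprB addrA subrK -mulmxBr.
have S0 : 0 <= \sum_i \sum_j `|G i j| by apply: sumr_ge0 => i _; exact: sumr_ge0.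
apply: mx_norm_le => [|i j]; first exact: mulr_ge0.
rewrite mxE (le_trans (ler_norm_sum _ _ _))//.
apply: (@le_trans _ _ ((\sum_j `|G i j|) * `|k - k'|)).
  rewrite mulr_suml; apply: ler_sum => l _; rewrite normrM ler_wpM2l//.
  exact: mx_entry_le.
rewrite ler_wpM2r// (bigD1 i)//= lerDl; apply: sumr_ge0 => i' _; exact: sumr_ge0.
Qed.

Variables (K : set 'cV[R]_n) (L : set 'cV[R]_m) (G : 'M[R]_(m, n)) (a : 'cV[R]_m).
Hypothesis coneK : closed_convex_cone K.
Hypothesis coneL : closed_convex_cone L.
Hypothesis avoid : forall k, K k -> ~ L (G *m k - a).

(* The separating direction is the residual, at a point [G k0 - a] nearest to [L] with [k0]
   in [K] of norm at most [rho]; a minimizer over all of [K] need not exist. *)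
Lemma approximate_separation (rho : R) : 0 < rho ->
  exists2 u, polar_sphere L u &
    forall k, sphere K k -> - (enorm a / rho) <= cdot u (G *m k).
Proof.
move=> rho0; pose w (k : 'cV[R]_n) := G *m k - a.
pose f k := sqnorm (w k - proj L (w k)).
have [cK K0 KZ Kcvx] := coneK.
have ef : explip f.
  apply: explip_sqnorm => i; under eq_fun do rewrite mxE [X in _ + X]mxE.
  apply: explipB.
    apply: (explip_comp (f := fun y : 'cV[R]_m => y i 0) (T := w) (lip_mulmx G a)).
    exact: explip_entry.
  apply: (explip_comp (f := fun y => proj L y i 0) (T := w) (lip_mulmx G a)).
  exact: explip_proj_entry.
pose Kr := K `&` [set k | sqnorm k <= rho ^+ 2].
have cKr : closed Kr.
  apply: closedI => //; apply: explip_closed_le.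
  by apply: explip_sqnorm => i; exact: explip_entry.
have Kr0 : Kr 0 by split => //=; rewrite -cdotnn cdot0l sqr_ge0.
have [k0 [Kk0 k0r] hk0] := closed_min cKr Kr0 ef (fun k (Kk : Kr k) _ => proj2 Kk).
pose l0 := proj L (w k0); pose r := w k0 - l0.
have r0 : r <> 0.
  move=> /subr0_eq r0; apply: (avoid Kk0).
  by rewrite -/(w k0) r0; exact: proj_mem.
(* First-order optimality of [k0] along the segment to [k], inside the convex set [Kr]. The distance
   to [L] near [k0] is bounded by the distance to the fixed point [l0]. *)
have hD k : Kr k -> 0 <= cdot r (G *m (k - k0)).
  move=> [Kk kr]; set D := G *m _.
  suff : - (2 * cdot r D) <= 0 by lra.
  apply: (@le0_linear_bound _ _ (sqnorm D)) => s s0 s1.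
  have Ks : Kr (k0 + s *: (k - k0)).
    split.
      have -> : k0 + s *: (k - k0) = s *: k + (1 - s) *: k0.
        by rewrite scalerBr scalerBl scale1r addrCA addrA.
      by apply: Kcvx => //; rewrite (ltW s0).
    rewrite /= sqnormDZ; move: kr k0r => /=.
    have -> : sqnorm k = sqnorm k0 + 2 * 1 * cdot k0 (k - k0) + 1 ^+ 2 * sqnorm (k - k0).
      by rewrite -sqnormDZ scale1r addrC subrK.
    set X := sqnorm k0; set Y := cdot _ _; set Z := sqnorm _; set T := rho ^+ 2.
    have Z0 : 0 <= Z := sqnorm_ge0 _.
    move=> h1 h2; have := ler_wpM2l (ltW s0) h1.
    have : 0 <= 1 - s by rewrite subr_ge0.
    move=> s1'; have := ler_wpM2l s1' h2; have := mulr_ge0 (mulr_ge0 (ltW s0) s1') Z0.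
    by lra.
  have wk : w (k0 + s *: (k - k0)) - l0 = r + s *: D.
    by rewrite /r /w mulmxDr -scalemxAr -/D !(addrAC _ (s *: D)).
  have := le_trans (hk0 _ Ks) (proj_min coneL (w (k0 + s *: (k - k0))) (proj_mem coneL (w k0))).
  rewrite /f -/l0 -/r wk sqnormDZ.
  by rewrite -subr_ge0 => h; rewrite -(ler_pM2l s0) -subr_ge0; apply: le_trans h _; lra.
have er0 := enorm_gt0 r0.
exists ((enorm r)^-1 *: r).
  split; last exact: sqnorm_normalize.
  move=> nu Ln; rewrite cdotZl pmulr_rle0 ?invr_gt0//; exact: proj_cdot_le0.
move=> k [Kk k1].
have Krk : Kr (rho *: k).
  by split; [apply: KZ => //; exact: ltW|rewrite /= sqnormZ k1 mulr1].
have := hD _ Krk; rewrite mulmxBr cdotDr cdotNr -scalemxAr cdotZr.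
(* Since r is orthogonal to [l0], optimality at rho k gives rho <r, G k> >= <r, G k0> = |r|^2 + <r,
   a> >= - |r| |a|, and dividing by rho |r| yields the claim. *)
have rr : sqnorm r = cdot r (G *m k0) - cdot r a.
  have := proj_cdot_self coneL (w k0); rewrite -/l0 -/r => rl.
  by rewrite -cdotnn {2}/r !cdotDr !cdotNr rl subr0.
have ca := cdot_le_enorm (- r) a.
have eN : enorm (- r) = enorm r by rewrite /enorm -!cdotnn cdotNl cdotNr opprK.
rewrite eN cdotNl in ca.
have r2 := sqnorm_ge0 r.
move=> h; rewrite cdotZl -mulNr ler_pdivrMr// -mulrA ler_pdivlMl//.
by lra.
Qed.

End Separation.

(** * The two phases of the intersection of cones *)

Section ConeIntersection.
Variables (R : realType) (m n : nat).

(** The inverse of [mxvec_index]: the matrix position held by coordinate [k] of the vectorized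
    matrix. *)
Definition mxvec_pair (k : 'I_(m * n)) : 'I_m * 'I_n :=
  enum_val (cast_ord (esym (mxvec_cast m n)) k).

Lemma mxvec_pairK : cancel mxvec_pair (uncurry (@mxvec_index m n)).
Proof.
move=> k; case/mxvec_indexP: k => i j.
by rewrite /mxvec_pair /mxvec_index cast_ordK enum_rankK.
Qed.

Lemma mxvec_pair_bij : bijective mxvec_pair.
Proof.
exists (uncurry (@mxvec_index m n)); first exact: mxvec_pairK.
by case=> i j; rewrite /mxvec_pair /= /mxvec_index cast_ordK enum_rankK.
Qed.

Lemma cdot_mulmx_vec_mx (v : 'rV[R]_(m * n)) (b : 'cV[R]_m) (a : 'cV[R]_n) :
  \sum_k v ord0 k * (b (mxvec_pair k).1 0 * a (mxvec_pair k).2 0) =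
  cdot b (vec_mx v *m a).
Proof.
pose F (p : 'I_m * 'I_n) := b p.1 0 * (vec_mx v p.1 p.2 * a p.2 0).
transitivity (\sum_k F (mxvec_pair k)).
  apply: eq_bigr => k _; rewrite /F mxE.
  have := mxvec_pairK k; case: (mxvec_pair k) => i j /= ->.
  by rewrite mulrCA.
transitivity (\sum_p F p).
  by rewrite [RHS](reindex mxvec_pair)//; exact/onW_bij/mxvec_pair_bij.
rewrite -(pair_bigA _ (fun i j => F (i, j)))/=.
by apply: eq_bigr => i _; rewrite mxE mulr_sumr.
Qed.

Variables (K : set 'cV[R]_n) (L : set 'cV[R]_m).
Hypotheses (coneK : closed_convex_cone K) (coneL : closed_convex_cone L).

Lemma gmean_enorm_sqr k (F : 'rV[R]_k -> 'cV[R]_k) :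
  gmean (fun g => enorm (F g) ^+ 2) = gmean (fun g => sqnorm (F g)).
Proof. by congr gmean; apply/funext => g; rewrite sqr_enorm. Qed.

Lemma cone_miss t : 1 <= t ->
  (core_loss R + 6) * Num.sqrt t <=
    Num.sqrt (m%:R - fine (stat_dim L)) - Num.sqrt (fine (stat_dim K)) ->
  ((1 - expR (- t))%:E <= gauss_mx_prob (fun G => trivial_intersection L G K))%E.
Proof.
move=> t1; rewrite stat_codimE// stat_dimE// -!gmean_enorm_sqr => gap.
apply: (gordon_core mxvec_pair_bij (expr1n R 2) (A := sphere K) (B := polar_sphere L)
  _ _ _ _ _ _ _ _ t1 gap).
- by move=> a [].
- by move=> b [].
- move=> v bad eta eta0.
  (* A nonzero l = G mu in [L] has <b, l> <= 0 for every b in the polar, so the normalized mu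
     witnesses badness with bound 0. *)
  have [l [Ll [mu Kmu lE]] l0] :
      exists2 l, (L `&` [set vec_mx v *m mu | mu in K]) l & l <> 0.
    apply: contrapT => none; apply: bad; rewrite /= /trivial_intersection.
    apply/seteqP; split => [l Hl|_ ->] /=.
      by apply: contrapT => l0; apply: none; exists l.
    split; first by case: coneL.
    by exists 0; [case: coneK|rewrite mulmx0].
  have mu0 : mu <> 0 by move=> mu0; apply: l0; rewrite -lE mu0 mulmx0.
  have emu := enorm_gt0 mu0.
  exists ((enorm mu)^-1 *: mu).
    split; last exact: sqnorm_normalize.
    by apply: coneZ => //; rewrite invr_ge0 ltW.
  move=> b [Lb _]; rewrite /bilin mul1r cdot_mulmx_vec_mx -scalemxAr cdotZr lE.
  rewrite (le_trans _ (ltW eta0))// pmulr_rle0 ?invr_gt0//.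
  exact: Lb.
- under eq_fun do rewrite sqr_enorm; exact: explip_sqnorm_proj.
- under eq_fun do rewrite sqr_enorm; exact: explip_sqnorm_residual.
- by move=> h; exact: enorm_ge0.
- by move=> a g; exact: rdot_sphere_le.
- by move=> h; exact: enorm_residual_attained.
Qed.

Lemma cone_hit t : L <> [set 0] -> 1 <= t ->
  (core_loss R + 7) * Num.sqrt t <=
    Num.sqrt (fine (stat_dim K)) - Num.sqrt (m%:R - fine (stat_dim L)) ->
  ((1 - expR (- t))%:E <= gauss_mx_prob (fun G => ~ trivial_intersection L G K))%E.
Proof.
move=> L0 t1 gap.
have [a La a1] : exists2 a, L a & sqnorm a = 1.
  have [x Lx x0] : exists2 x, L x & x <> 0.
    apply: contrapT => none; apply: L0; apply/seteqP; split => [x Lx|_ ->] /=.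
      by apply: contrapT => x0; apply: none; exists x.
    by case: coneL.
  exists ((enorm x)^-1 *: x); last exact: sqnorm_normalize.
  by apply: coneZ => //; rewrite invr_ge0 enorm_ge0.
pose L' := L `&` [set x | 0 <= cdot a x].
have coneL' : closed_convex_cone L' := half_cone coneL a.
(* Here the inner maximum runs over [K] and the outer minimum over the polar of [L'], so the roles
   of rows and columns of the matrix are exchanged; the sign is -1. *)
pose swap (p : 'I_m * 'I_n) := (p.2, p.1).
have swap_bij : bijective (swap \o mxvec_pair).
  apply: bij_comp mxvec_pair_bij.
  by exists (fun p => (p.2, p.1)) => -[].
have gap' : (core_loss R + 6) * Num.sqrt t <=
    Num.sqrt (gmean (fun h => enorm (proj K h^T) ^+ 2)) -
    Num.sqrt (gmean (fun g => enorm (g^T - proj L' g^T) ^+ 2)).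
  rewrite !gmean_enorm_sqr -stat_dimE//.
  have := half_cone_codim coneL La a1; rewrite -/L'.
  set X : R := gmean _; set Y : R := m%:R - _ in gap * => XY.
  have Y0 : 0 <= Y.
    rewrite /Y stat_codimE//; apply: gmean_ge0 => [|v]; last exact: sqnorm_ge0.
    exact: explip_sqnorm_residual.
  (* The half-cone costs at most 1 <= sqrt t in the gap, which raises 6 to 7. *)
  have XsY : Num.sqrt X <= Num.sqrt Y + 1.
    have s0 : 0 <= Num.sqrt Y + 1 by rewrite addr_ge0// sqrtr_ge0.
    rewrite -[leRHS](ger0_norm s0) -sqrtr_sqr ler_wsqrtr// (le_trans XY)//.
    have := sqr_sqrtr Y0; have := sqrtr_ge0 Y; rewrite sqrrD; lra.
  have : 1 <= Num.sqrt t by rewrite -sqrtr1 ler_wsqrtr.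
  by lra.
have sg : (-1) ^+ 2 = 1 :> R by rewrite sqrrN expr1n.
apply: (gordon_core swap_bij sg (A := polar_sphere L') (B := sphere K)
  _ _ _ _ _ _ _ _ t1 gap').
- by move=> b [].
- by move=> b [].
- move=> v /contrapT triv eta eta0; rewrite /= in triv.
  (* If G k - a lay in [L'], adding a would put G k in [L], so G k = 0; but then <a, -a> = -1
     contradicts the half-space. *)
  have avoid k : K k -> ~ L' (vec_mx v *m k - a).
    move=> Kk [Lk ak].
    have : (L `&` [set vec_mx v *m mu | mu in K]) (vec_mx v *m k).
      split; last by exists k.
      by rewrite -(subrK a (_ *m _)); exact: coneD.
    rewrite triv /= => k0; move: ak; rewrite /= k0 sub0r cdotNr cdotnn a1; lra.
  (* The truncation radius for which the separation error |a| / rho equals eta. *)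
  have rho0 : 0 < enorm a / eta by rewrite divr_gt0// (enorm1 a1).
  have [u Lu hu] := approximate_separation coneK coneL' avoid rho0.
  exists u => // k /hu; rewrite invf_div mulrCA (enorm1 a1) divr1 mulr1 => h.
  rewrite /bilin mulN1r lerNl (le_trans h)// -cdot_mulmx_vec_mx le_eqVlt.
  by apply/orP; left; apply/eqP; apply: eq_bigr => i _; rewrite /= [u _ _ * _]mulrC.
- under eq_fun do rewrite sqr_enorm; exact: explip_sqnorm_residual.
- under eq_fun do rewrite sqr_enorm; exact: explip_sqnorm_proj.
- by move=> h; exact: enorm_ge0.
- by move=> b g; exact: rdot_polar_le.
- by move=> h; exact: enorm_proj_attained.
Qed.

End ConeIntersection.

Theorem theorem1p1 (R : realType) :
  exists C : R, 0 < C /\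
  forall (n m : nat) (K : set 'cV[R]_n) (L : set 'cV[R]_m),
    closed_convex_cone K -> nontrivial K ->
    closed_convex_cone L -> nontrivial L ->
    forall t : R, 1 <= t ->
      (Num.sqrt (fine (stat_dim K)) - Num.sqrt (m%:R - fine (stat_dim L))
         <= - (C * Num.sqrt t) ->
       (gauss_mx_prob (fun G : 'M[R]_(m, n) => trivial_intersection L G K)
         >= (1 - expR (- t))%:E)%E)
      /\
      (Num.sqrt (fine (stat_dim K)) - Num.sqrt (m%:R - fine (stat_dim L))
         >= C * Num.sqrt t ->
       (gauss_mx_prob (fun G : 'M[R]_(m, n) => ~ trivial_intersection L G K)
         >= (1 - expR (- t))%:E)%E).
Proof.
exists (core_loss R + 7); split; first by have := core_loss_gt0 R; lra.
move=> n m K L coneK _ coneL L0 t t1; split => gap; last exact: cone_hit.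
apply: cone_miss => //; move: gap.
by have := sqrtr_ge0 t; lra.
Qed.
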